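(* Let $f$ be a finite Blaschke product with $f(0)=0$ which is not a rotation. Let $\{a_n\}_{n\ge 1}$ be a sequence of complex numbers tending to $0$ and such that $\sum_{n=1}^\infty |a_n| = \infty$. Then for any $w\in\mathbb{C}$, the set $$A(w)=\left\{\xi\in\partial\mathbb{D}\colon \sum_{n=1}^\infty a_n f^n(\xi)\text{ converges and }\sum_{n=1}^\infty a_n f^n(\xi)=w\right\}$$ has Hausdorff dimension $1$.
   Context: $\mathbb{D}$ is the open unit disk in $\mathbb{C}$ and $\partial\mathbb{D}$ the unit circle. A finite Blaschke product with $f(0)=0$ is a function of the form $f(z)=\alpha z^m\prod_{n=1}^N\frac{z-z_n}{1-\overline{z_n}z}$ with $|\alpha|=1$, $m\ge 1$ an integer and $\{z_n\}_{n=1}^N$ a finite (possibly empty) set of points of $\mathbb{D}$ (an empty product is omitted); it extends analytically across $\partial\mathbb{D}$ and maps $\partial\mathbb{D}$ to itself. A rotation is a map $z\mapsto\alpha z$ with $|\alpha|=1$. $f^n=f\circ\dots\circ f$ denotes the $n$-th iterate (not the $n$-th power) of $f$. For an arc $I\subseteq\partial\mathbb{D}$, $\mathrm{m}(I)$ is its normalised length (so $\mathrm{m}(\partial\mathbb{D})=1$). For $s>0$ and $E\subseteq\partial\mathbb{D}$, $$\mathcal{H}^s(E)=\lim_{\delta\to0^+}\inf\left\{\sum_{n=1}^\infty \mathrm{m}(I_n)^s\colon E\subseteq\bigcup_{n=1}^\infty I_n,\ \mathrm{m}(I_n)<\delta\text{ for } n\ge1\right\},$$ the infimum being over countable covers of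 $E$ by arcs. The Hausdorff dimension of a Borel set $E$ is $\dim(E)=\sup\{s>0\colon\mathcal{H}^s(E)>0\}$. *)

(* Defs.v *)
From mathcomp Require Import all_boot all_order all_algebra.
From mathcomp Require Import all_classical all_reals all_analysis.
From mathcomp Require Import complex.

Set Implicit Arguments.
Unset Strict Implicit.
Unset Printing Implicit Defensive.

Import Order.TTheory GRing.Theory Num.Theory numFieldNormedType.Exports.

Local Open Scope classical_set_scope.
Local Open Scope ring_scope.

(** The complex numbers are [R[i]] for [R : realType]. The norm [`|z|] of
    [z : R[i]] lives in [R[i]], so that [`|z| <= 1] compares complex numbers
    (whose order is that of the reals on real elements); [Normc.normc z : R] is
    the same modulus as a real number. The usual topology of the complex plane
    is found by the library on the alias [R[i]^o]. *)

(** Maps of the closed unit disk are represented by total functions on [R[i]];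
    only their values on the closed unit disk are specified. Since the latter is
    stable under a finite Blaschke product, so are the iterates there. The list
    [zs] is that of the zeros, with multiplicities. *)
Definition finite_blaschke0 (R : realType) (f : R[i] -> R[i]) : Prop :=
  exists (alpha : R[i]) (m : nat) (zs : seq R[i]),
    [/\ `|alpha| = 1, (0 < m)%N, (forall a, a \in zs -> `|a| < 1) &
        forall z, `|z| <= 1 ->
          f z = alpha * z ^+ m *
                \prod_(a <- zs) ((z - a) / (1 - (a^*)%C * z))].

Definition is_rotation (R : realType) (f : R[i] -> R[i]) : Prop :=
  exists alpha : R[i], `|alpha| = 1 /\ forall z, `|z| <= 1 -> f z = alpha * z.

Definition unit_circle (R : realType) : set R[i] := [set xi | `|xi| = 1].

Definition cis2pi (R : realType) (t : R) : R[i] :=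
  (cos (2 * pi * t) +i* sin (2 * pi * t))%C.

(** Arcs of any kind: open, closed or half-open, the whole circle included.
    Points and the empty set also occur; they have length [0], hence no effect
    on the Hausdorff measures of positive dimension. *)
Definition is_arc (R : realType) (A : set R[i]) : Prop :=
  exists I : interval R, A = (@cis2pi R) @` [set` I].

(** Normalised length: [cis2pi] is a bijection from [[0, 1[] to the circle. *)
Definition circle_length (R : realType) (A : set R[i]) : \bar R :=
  lebesgue_measure (`[0, 1[%classic `&` (@cis2pi R) @^-1` A).

Definition hausdorff_pre (R : realType) (s delta : R) (E : set R[i]) : \bar R :=
  ereal_inf [set (\sum_(0 <= n <oo) (circle_length (I n)) `^ s)%E |
    I in [set I : nat -> set R[i] |
      [/\ forall n, is_arc (I n),
          E `<=` \bigcup_n I n &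
          forall n, (circle_length (I n) < delta%:E)%E]]].

Definition hausdorff_measure (R : realType) (s : R) (E : set R[i]) : \bar R :=
  lim (hausdorff_pre s delta E @[delta --> 0^'+]).

(** The element [0] is added so that the supremum over an empty set of
    exponents is [0], and not [-oo]. *)
Definition hausdorff_dim (R : realType) (E : set R[i]) : \bar R :=
  ereal_sup (0%E |` [set s%:E | s in
    [set s : R | 0 < s /\ (0 < hausdorff_measure s E)%E]]).

(** [iter n f] is the [n]-th iterate of [f]; convergence of the partial sums to
    [w] says both that the series converges and that its sum is [w]. *)
Definition series_level_set (R : realType) (f : R[i] -> R[i]) (a : nat -> R[i])
    (w : R[i]) : set R[i] :=
  [set xi | unit_circle xi /\
    ((\sum_(1 <= n < N.+1) a n * iter n f xi : R[i]^o) @[N --> \oo]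
       --> (w : R[i]^o))].

(* Main.v *)
(** On the circle, [f (cis2pi t) = cis2pi (G t)] with [G] a uniformly expanding
    map of the line whose derivative is Lipschitz, so that the inverse images of
    a fixed point of [G] cut the line into nested cylinders with bounded
    distortion. The average over the circle of [f^k], of [f^k * f^l], and of
    [(f^k - conj b * f^(k+1)) * h(f^(k+1))], where [b = f'(0)], vanishes, because
    [f^k = 0] at the origin. Hence [f^k - conj b * f^(k+1)] is a reversed
    martingale difference, and second and fourth moments show that a block sum
    [sum_(n <= k < n') a_k f^k] has, in any given direction, a component at
    least [c0 * (sum |a_k|^2)^(1/2)] on a set of measure at least [p0], with
    [c0], [p0] depending on [f] only. In a cylinder of generation [n] one keeps
    the subcylinders of generation [n'] on which the block sum points towards
    [w] minus the current partial sum. The blocks have length between [N] and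
    [2 N], with endpoints chosen where the oscillation of the partial sums on
    cylinders is small compared with [(sum |a_k|^2)^(1/2)]: then the divergence
    of [sum |a_k|] forces the partial sums to converge to [w] along every branch
    of the resulting tree. Since a proportion [p0] is kept at each step, while
    lengths are divided by an exponentially large number in [N], the dimension of
    the limit set tends to [1] as [N] grows. *)

Require Import Defs.
From mathcomp Require Import all_boot all_order all_algebra.
From mathcomp Require Import all_classical all_reals all_analysis.
From mathcomp Require Import complex.
From mathcomp Require Import ring lra zify.
Import Order.TTheory GRing.Theory Num.Theory numFieldNormedType.Exports.
Local Open Scope classical_set_scope.
Local Open Scope ring_scope.

Set Implicit Arguments.
Unset Strict Implicit.
Unset Printing Implicit Defensive.

(** * Trees of intervals and coverings *)

(** No measure or integral is built. Countable covers are compared directly with the s-powers of the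
    lengths in the tree, and averages over the circle are limits of averages over rotated roots of
    unity: these are exact on polynomials, and counting sample points turns them into lengths. The
    obstacle is that the partial sum of order [n] oscillates on a cylinder of generation [n] by
    about the sum of [m^(k-n) |a_k|] over [k < n], which the last coefficients before [n] can make
    as large as the gain of a block. Averaging this oscillation over [N] candidate endpoints leaves
    [O(1/N)] times the l^1 norm of nearby coefficients, that is [O(N^(-1/2))] times l^2 norms,
    negligible against the gain for large [N]. On the other hand the length of blocks has to stay
    bounded: the gain is of l^2 type while divergence is assumed in l^1, and the two norms are
    comparable only on blocks of bounded length. Martingale differences are used because the
    iterates themselves are not orthogonal when [b] is nonzero; they do not degenerate because
    [|b| < 1], which is where rotations are excluded. *)

Lemma ler_sum_mem (R : numDomainType) (T : eqType) (r : seq T) (F G : T -> R) :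
  (forall i, i \in r -> F i <= G i) ->
  \sum_(i <- r) F i <= \sum_(i <- r) G i.
Proof. by move=> FG; rewrite big_seq [leRHS]big_seq; apply: ler_sum. Qed.

Lemma expr_small (R : realType) (z e : R) : 0 < e -> 0 <= z < 1 ->
  exists k, z ^+ k < e.
Proof.
move=> e0 /andP[z0 z1].
have := @cvg_expr R z; rewrite ger0_norm // => /(_ z1) /cvgr_lt/(_ e e0) [N _ HN].
by exists N; apply: (HN N) => /=.
Qed.

Section SeparatedTree.
Variables (R : realType) (T : eqType) (lo hi : T -> R) (ch : T -> seq T).
Variables (s kap : R).
Hypothesis s_gt0 : 0 < s.
Hypothesis kap_gt0 : 0 < kap.
Let len I := hi I - lo I.
Hypothesis len_gt0 : forall I, 0 < len I.
Hypothesis ch_sub : forall I J, J \in ch I -> lo I <= lo J /\ hi J <= hi I.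
Hypothesis ch_half : forall I J, J \in ch I -> len J <= len I / 2.
Hypothesis ch_kap : forall I J, J \in ch I -> kap * len I <= len J.
(** Disjointness of the children up to endpoints, tested on increments of a monotone [phi]: taking
    for [phi] the projection onto a window bounds the total length of the children inside this
    window. *)
Hypothesis ch_disj : forall I (phi : R -> R),
  (forall x y, x <= y -> phi x <= phi y) ->
  \sum_(J <- ch I) (phi (hi J) - phi (lo J)) <= phi (hi I) - phi (lo I).
(** This stands in for a Frostman measure: splitting an interval never decreases its s-weight, so
    the weight that a cover captures below [I] can be compared with that of [I]. *)
Hypothesis ch_pow : forall I, len I `^ s <= \sum_(J <- ch I) len J `^ s.

Definition meets (U : set R) (I : T) := exists2 x, U x & lo I <= x <= hi I.

(** Projection of the line onto [[z - r, z + r]]; its increment over an interval is the length of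
    the part inside this window. *)
Definition clamp (z r x : R) := Num.max (z - r) (Num.min x (z + r)).

Lemma clampE z r x : clamp z r x =
  if x <= z + r then if z - r <= x then x else z - r
  else if z - r <= z + r then z + r else z - r.
Proof.
rewrite /clamp; case: (leP x (z + r)) => h.
  by case: (leP (z - r) x).
by case: (leP (z - r) (z + r)).
Qed.

Lemma clamp_le z r x y : x <= y -> clamp z r x <= clamp z r y.
Proof.
by move=> xy; rewrite !clampE; do 6 ?[case: ifPn; rewrite -?ltNge => ?]; lra.
Qed.

(** Total s-weight of the first descendants of [I] that have length at most [u] and are reached
    through intervals meeting [U]. The depth [k] is fuel: a branch that has not stopped by then
    counts [0], so the weight increases with [k]. *)
Fixpoint tree_weight (U : set R) (u : R) (k : nat) (I : T) : R :=
  if k is k'.+1 then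
    if `[< meets U I >] then
      if len I <= u then len I `^ s else \sum_(J <- ch I) tree_weight U u k' J
    else 0
  else 0.

Lemma tree_weight_ge0 U u k I : 0 <= tree_weight U u k I.
Proof.
elim: k I => [|k IH] I //=; case: ifP => // _; case: ifP => _.
  exact: powR_ge0.
by apply: sumr_ge0 => J _; apply: IH.
Qed.

Lemma tree_weightS U u k I : tree_weight U u k I <= tree_weight U u k.+1 I.
Proof.
elim: k I => [|k IH] I; first exact: tree_weight_ge0.
rewrite [leLHS]/= [leRHS]/=; case: ifP => // _; case: ifP => // _.
by apply: ler_sum => J _; apply: IH.
Qed.

Lemma tree_weight_le U u k l I : (k <= l)%N ->
  tree_weight U u k I <= tree_weight U u l I.
Proof.
move=> kl; rewrite -(subnKC kl); elim: (l - k)%N => [|m IH].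
  by rewrite addn0.
by rewrite addnS (le_trans IH) // tree_weightS.
Qed.

(* The stopping intervals have length between [kap u] and [u] and lie in an
   interval of length [4 u], whence at most [4 / kap] of them count. *)
Lemma tree_weight_clamp (U : set R) (u z : R) k I : 0 < u ->
  (forall x, U x -> `|x - z| <= u) -> kap * u <= len I ->
  tree_weight U u k I <=
    u `^ s / (kap * u) * (clamp z (2 * u) (hi I) - clamp z (2 * u) (lo I)).
Proof.
move=> u0 Uz uI; set phi := clamp z (2 * u).
have phi_mono := @clamp_le z (2 * u).
have c0 : 0 <= u `^ s / (kap * u).
  by rewrite divr_ge0 ?powR_ge0 // mulr_ge0 // ltW.
have lohi J : lo J <= hi J by have := len_gt0 J; rewrite /len; lra.
elim: k I uI => [|k IH] I uI /=.
  by rewrite mulr_ge0 // subr_ge0 phi_mono.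
case: ifP => [/asboolP[x Ux /andP[lox xhi]]|_]; last first.
  by rewrite mulr_ge0 // subr_ge0 phi_mono.
have := Uz _ Ux; rewrite ler_norml => /andP[xz1 xz2].
have [Iu|Iu] := leP (len I) u.
  have -> : phi (hi I) - phi (lo I) = len I.
    have := len_gt0 I; move: Iu; rewrite /phi /len => Iu I0.
    by rewrite !clampE; do 6 ?[case: ifPn; rewrite -?ltNge => ?]; lra.
  apply: (@le_trans _ _ (u `^ s)).
    by apply: ge0_ler_powR => //; rewrite ?nnegrE ltW.
  rewrite -mulrA ler_peMr ?powR_ge0 // mulrC ler_pdivlMr ?mul1r //.
  exact: mulr_gt0.
apply: (@le_trans _ _ (\sum_(J <- ch I)
    u `^ s / (kap * u) * (phi (hi J) - phi (lo J)))).
  apply: ler_sum_mem => J JI; apply: IH.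
  by rewrite (le_trans _ (ch_kap JI)) // ler_pM2l // ltW.
by rewrite -mulr_sumr ler_wpM2l //; apply: ch_disj.
Qed.

Lemma tree_weight_bound (U : set R) (u : R) k I : 0 < u ->
  (forall x y, U x -> U y -> `|x - y| <= u) -> kap * u <= len I ->
  tree_weight U u k I <= 4 / kap * u `^ s.
Proof.
move=> u0 Ud uI; have [->|/set0P[z Uz]] := eqVneq U set0.
  rewrite (_ : tree_weight _ _ _ _ = 0).
    by rewrite mulr_ge0 ?powR_ge0 // divr_ge0 // ltW.
  by case: k => //= k; case: asboolP => // -[].
apply: (le_trans (@tree_weight_clamp U u z k I u0 _ uI)) => //.
  by move=> x Ux; exact: Ud.
have -> : 4 / kap * u `^ s = u `^ s / (kap * u) * (4 * u).
  by field; rewrite !gt_eqF.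
rewrite ler_wpM2l //.
  by rewrite divr_ge0 ?powR_ge0 // mulr_ge0 // ltW.
by rewrite !clampE; do 6 ?[case: ifPn; rewrite -?ltNge => ?]; lra.
Qed.

Variables (U : nat -> set R) (u : nat -> R).

(** The number of sets and the depth are both cut at [k], so that a single monotone sequence
    exhausts the countable family. *)
Definition total_weight k I := \sum_(n < k) tree_weight (U n) (u n) k I.

Lemma total_weight_le k l I : (k <= l)%N -> total_weight k I <= total_weight l I.
Proof.
move=> kl; rewrite /total_weight.
rewrite -(big_mkord xpredT (fun n => tree_weight (U n) (u n) k I)).
rewrite -(big_mkord xpredT (fun n => tree_weight (U n) (u n) l I)).
rewrite [leRHS](big_cat_nat (leq0n k) kl) /= -[leLHS]addr0; apply: lerD.
  by apply: ler_sum => n _; apply: tree_weight_le.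
by apply: sumr_ge0 => n _; apply: tree_weight_ge0.
Qed.

Definition uncovered I := exists2 e : R, 0 < e &
  forall k, total_weight k I <= len I `^ s - e.

(** A set [U n] that meets [I] with [len I <= u n] stops at [I] itself and captures all of its
    s-weight, leaving no margin. *)
Lemma uncovered_not_small I n : uncovered I -> meets (U n) I -> u n < len I.
Proof.
move=> [e e0 He] Un; rewrite ltNge; apply/negP => lenu.
have /le_trans/(_ (He n.+1)) : tree_weight (U n) (u n) n.+1 I <= total_weight n.+1 I.
  rewrite /total_weight big_ord_recr /= lerDr.
  by apply: sumr_ge0 => i _; apply: (@tree_weight_ge0 _ _ n.+1).
by rewrite /= asboolT // lenu; lra.
Qed.

(** Otherwise the children, finitely many, are all captured up to [e'] at a common depth [K]. Since
    their s-weights add up to at least that of [I], the interval [I] is then captured up to less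
    than [e] at depth [K + 1]. *)
Lemma uncovered_child I : uncovered I -> exists2 J, J \in ch I & uncovered J.
Proof.
move=> uI; apply: contrapT => /forall2NP noJ.
have [e e0 He] := uI.
pose e' := e / 2 / (size (ch I)).+1%:R.
have e'0 : 0 < e' by rewrite !divr_gt0.
have [K HK] : exists K, forall J, J \in ch I ->
    len J `^ s - e' < total_weight K J.
  elim: (ch I) noJ => [|J0 c IH] noJ; first by exists 0%N.
  have [|K HK] := IH.
    move=> J; case: (noJ J) => [h|h]; [left|by right].
    by apply: contra_not h; rewrite in_cons => ->; rewrite orbT.
  have [k Hk] : exists k, len J0 `^ s - e' < total_weight k J0.
    case: (noJ J0) => [|nu]; first by rewrite mem_head.
    apply: contrapT => /forallNP nk; apply: nu; exists e' => // k.
    by rewrite leNgt; apply/negP/nk.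
  exists (maxn K k) => J; rewrite inE => /predU1P[->|Jc].
    by rewrite (lt_le_trans Hk) // total_weight_le // leq_maxr.
  by rewrite (lt_le_trans (HK _ Jc)) // total_weight_le // leq_maxl.
(* No [U n] stops at [I]: those that meet it have [u n < len I], and those that miss it miss the
   children too. The set of index [K], counted on the right only, is a nonnegative surplus. *)
have step : \sum_(J <- ch I) total_weight K J <= total_weight K.+1 I.
  rewrite /total_weight exchange_big /= big_ord_recr /= -[leLHS]addr0.
  apply: lerD; last exact: (@tree_weight_ge0 _ _ K.+1).
  apply: ler_sum => n _ /=.
  case: asboolP => [Un|nUn].
    by rewrite ifF //; apply: lt_geF; exact: uncovered_not_small.
  rewrite big_seq big1 // => J JI.
  move: (nat_of_ord n) nUn => m nUn; case: (K) => //= k; rewrite asboolF // => -[x Ux xJ].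
  apply: nUn; exists x => //; have [? ?] := ch_sub JI; lra.
have : \sum_(J <- ch I) (len J `^ s - e') <= \sum_(J <- ch I) total_weight K J.
  by apply: ler_sum_mem => J JI; apply/ltW/HK.
move=> h; have := le_trans (le_trans h step) (He K.+1).
rewrite big_split /= sumrN big_const_seq count_predT iter_addr addr0.
have := ch_pow I.
suff : e' *+ size (ch I) < e by lra.
rewrite -mulr_natr; apply: (@lt_trans _ _ (e' * (size (ch I)).+1%:R)).
  by rewrite ltr_pM2l // ltr_nat.
by rewrite /e' divfK // ltr_pdivrMr //; lra.
Qed.

(** The family is too cheap to capture the root, so an uncovered branch starts there. Its common
    point lies in no [U n]: an uncovered interval that meets [U n] is longer than [u n], while
    lengths tend to [0] along the branch. *)
Lemma branch_avoiding root :
  (forall n, 0 < u n) ->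
  (forall n x y, U n x -> U n y -> `|x - y| <= u n) ->
  (forall n, kap * u n <= len root) ->
  (exists2 c, c < len root `^ s &
     forall N, \sum_(n < N) 4 / kap * u n `^ s <= c) ->
  exists (J : nat -> T) (x : R),
    [/\ J 0%N = root, forall k, J k.+1 \in ch (J k),
        forall k, lo (J k) <= x <= hi (J k) & forall n, ~ U n x].
Proof.
move=> u0 Ud uroot [c cl Hc].
have Proot : uncovered root.
  exists (len root `^ s - c); first by lra.
  move=> k; rewrite opprB addrCA subrr addr0; apply: le_trans (Hc k).
  by apply: ler_sum => n _; apply: tree_weight_bound => //; exact: Ud.
have [J [J0 JS Ju]] : exists J : nat -> T, [/\ J 0%N = root,
    forall k, J k.+1 \in ch (J k) & forall k, uncovered (J k)].
  have nxt (I : {I | uncovered I}) :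
      {I' : {I | uncovered I} | sval I' \in ch (sval I)}.
    have [K KI uK] := cid2 (uncovered_child (svalP I)).
    by exists (exist _ K uK).
  pose F k := iter k (fun I => sval (nxt I)) (exist _ root Proot).
  exists (fun k => sval (F k)); split=> // k; last exact: (svalP (F k)).
  exact: (svalP (nxt (F k))).
have lohi K : lo K <= hi K by have := len_gt0 K; rewrite /len; lra.
have mono k l : (k <= l)%N -> lo (J k) <= lo (J l) /\ hi (J l) <= hi (J k).
  move=> kl; rewrite -(subnKC kl); elim: (l - k)%N => [|m [IH1 IH2]].
    by rewrite addn0.
  by rewrite addnS; have [? ?] := ch_sub (JS (k + m)%N); split; lra.
have cross k l : lo (J k) <= hi (J l).
  have [h1 _] := mono _ _ (leq_maxl k l); have [_ h2] := mono _ _ (leq_maxr k l).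
  by have := lohi (J (maxn k l)); lra.
pose x := sup (range (lo \o J)).
have hsx : has_sup (range (lo \o J)).
  by split; [exists (lo (J 0%N)), 0%N | exists (hi (J 0%N)) => _ [k _ <-]; exact: cross].
have xJ k : lo (J k) <= x <= hi (J k).
  apply/andP; split; first by apply: sup_ubound; [exact: hsx.2|exists k].
  by apply: ge_sup; [exact: hsx.1|move=> _ [l _ <-]; exact: cross].
exists J, x; split=> // n Ux.
have lenk k : len (J k) <= len root / 2 ^+ k.
  elim: k => [|k IH]; first by rewrite J0 divr1.
  apply: (le_trans (ch_half (JS k))).
  by rewrite exprS invfM mulrCA [leRHS]mulrC ler_pM2r ?invr_gt0.
have [k Hk] : exists k, len root / 2 ^+ k < u n.
  have [k Hk] := expr_small (z := 2^-1) (divr_gt0 (u0 n) (len_gt0 root)) ltac:(lra).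
  by exists k; rewrite mulrC -exprVn -ltr_pdivlMr.
have := uncovered_not_small (Ju k) (ex_intro2 _ _ x Ux (xJ k)).
by have := lenk k; lra.
Qed.
End SeparatedTree.

(** * The parametrization of the circle *)

Section Cis.
Variable R : realType.
Implicit Types (x y t : R) (z : R[i]).
Local Notation cis := (@cis2pi R).
Local Notation normc := (@Normc.normc R).

Lemma cis2pi0 : cis 0 = 1.
Proof. by rewrite /cis2pi mulr0 cos0 sin0. Qed.

Lemma cis2piD x y : cis (x + y) = cis x * cis y.
Proof.
rewrite /cis2pi mulrDr cosD sinD; apply/eqP; rewrite eq_complex /=.
by rewrite eqxx /= addrC [X in X + _]mulrC [X in _ + X]mulrC; apply/eqP; ring.
Qed.

Lemma cis2pi1 : cis 1 = 1.
Proof. by rewrite /cis2pi mulr1 mulrC mulr_natr cos2pi sin2pi. Qed.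

Lemma cis2pi_nat n : cis n%:R = 1.
Proof.
by elim: n => [|n IH]; rewrite ?cis2pi0 // -natr1 cis2piD IH cis2pi1 mulr1.
Qed.

Lemma cis2piN x : cis (- x) = (cis x)^-1.
Proof.
have e : cis (- x) * cis x = 1 by rewrite -cis2piD addNr cis2pi0.
have x0 : cis x != 0.
  by apply/eqP => h; move: e; rewrite h mulr0 => /eqP; rewrite eq_sym oner_eq0.
by rewrite -[LHS](mulfK x0) e mul1r.
Qed.

Lemma cis2pi_int (k : int) : cis k%:~R = 1.
Proof.
case: k => n; first exact: cis2pi_nat.
by rewrite NegzE mulrNz cis2piN cis2pi_nat invr1.
Qed.

Lemma cis2piMn x n : cis (x *+ n) = cis x ^+ n.
Proof. by elim: n => [|n IH]; rewrite ?cis2pi0 // mulrS exprS cis2piD IH. Qed.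

Lemma normc_cis2pi t : normc (cis t) = 1.
Proof. by rewrite /= cos2Dsin2 sqrtr1. Qed.

Lemma normcE z : `|z| = (normc z)%:C%C.
Proof. by case: z. Qed.

Lemma normc_eq1 z : (`|z| = 1) <-> (normc z = 1).
Proof. by rewrite normcE; split=> [/complexI|->]. Qed.

Lemma cis2pi_surj z : normc z = 1 -> exists t, z = cis t.
Proof.
case: z => a b /= h.
have ab : a ^+ 2 + b ^+ 2 = 1.
  by rewrite -[LHS]sqr_sqrtr ?h ?expr1n // addr_ge0 ?sqr_ge0.
have a1 : -1 <= a <= 1.
  by rewrite -ler_norml -(@ler_pXn2r _ 2) ?nnegrE // expr1n real_normK ?num_real //;
     have := sqr_ge0 b; lra.
have pi0 := pi_gt0 R.
have sE : sin (acos a) = `|b|.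
  by rewrite sin_acos // (_ : 1 - a ^+ 2 = b ^+ 2) ?sqrtr_sqr //; lra.
have [b0|b0] := leP 0 b.
  exists (acos a / (2 * pi)); rewrite /cis2pi mulrC divfK; last by rewrite gt_eqF ?mulr_gt0.
  by rewrite sE acosK ?in_itv //= ger0_norm.
exists (- acos a / (2 * pi)); rewrite /cis2pi mulrC divfK; last by rewrite gt_eqF ?mulr_gt0.
by rewrite cosN sinN sE acosK ?in_itv //= ltr0_norm // opprK.
Qed.

(** With [r] the fractional part of [t], the quantity [1 - cos (2 pi r) = 2 sin (pi r) ^ 2] is
    positive for [0 < r < 1]. *)
Lemma cis2pi_eq1 t : cis t = 1 -> exists k : int, t = k%:~R.
Proof.
move=> t1; exists (Num.floor t).
pose r := t - (Num.floor t)%:~R.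
have := floor_itv t; rewrite intrD1 => /andP[f1 f2].
have rE : cis r = 1 by rewrite cis2piD t1 cis2piN cis2pi_int invr1 mulr1.
have pi0 := pi_gt0 R.
suff : r = 0 by rewrite /r; lra.
apply/eqP; rewrite eq_le; apply/andP; split; last by rewrite /r; lra.
rewrite leNgt; apply/negP => r0.
have : 0 < sin (pi * r).
  apply: sin_gt0_pi; rewrite mulr_gt0 //= -[ltRHS]mulr1 ltr_pM2l // /r; lra.
case: rE => c1 _; have : cos (2 * pi * r) = 1 - 2 * sin (pi * r) ^+ 2.
  by rewrite -mulrA mulrC mulr_natr cos_mulr2n cos2sin2; ring.
rewrite c1 => h s0; have := exprn_gt0 2 s0; lra.
Qed.

Lemma cis2pi_inj x y : cis x = cis y -> exists k : int, x = y + k%:~R.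
Proof.
move=> xy; have [|k kE] := @cis2pi_eq1 (x - y).
  by rewrite cis2piD cis2piN xy -cis2piN -cis2piD subrr cis2pi0.
by exists k; rewrite -kE; ring.
Qed.

Lemma normc_le_ReIm z : normc z <= `|complex.Re z| + `|complex.Im z|.
Proof.
case: z => a b /=; rewrite -(@ler_pXn2r _ 2) ?nnegrE ?sqrtr_ge0 ?addr_ge0 //.
rewrite sqr_sqrtr ?addr_ge0 ?sqr_ge0 // sqrrD !real_normK ?num_real //.
by rewrite lerD2r lerDl mulrn_wge0 // mulr_ge0.
Qed.

Lemma mean_value (f df : R -> R) x y : (forall t, is_derive t 1 f (df t)) ->
  x <= y -> exists2 c, x <= c <= y & f y - f x = df c * (y - x).
Proof.
move=> fdf xy; have [|c cxy ->] := @MVT_segment R f df x y xy (fun t _ => fdf t).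
  by apply: derivable_within_continuous => t _; exact: (@ex_derive _ _ _ _ _ _ _ (fdf t)).
by exists c => //; rewrite in_itv in cxy.
Qed.

Lemma lipschitz1 (f df : R -> R) : (forall t, is_derive t 1 f (df t)) ->
  (forall t, `|df t| <= 1) -> forall x y, `|f x - f y| <= `|x - y|.
Proof.
move=> fdf df1 x y; wlog xy : x y / x <= y => [H|].
  by have [/H//|/ltW/H] := leP x y; rewrite distrC [leRHS]distrC.
have [c _ E] := mean_value fdf xy.
by rewrite distrC E normrM [leRHS]distrC ler_piMl.
Qed.

(** Each coordinate contributes [2 pi]; adding them is crude, and is the origin of the [4 pi] in all
    oscillation bounds. *)
Lemma cis2pi_lip x y : normc (cis x - cis y) <= 4 * pi * `|x - y|.
Proof.
apply: le_trans (normc_le_ReIm _) _.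
have pi0 := pi_gt0 R.
have e : 2 * pi * `|x - y| = `|2 * pi * x - 2 * pi * y|.
  by rewrite -mulrBr normrM ger0_norm // mulr_ge0 // ltW.
have -> : 4 * pi * `|x - y| = 2 * pi * `|x - y| + 2 * pi * `|x - y| by ring.
rewrite e; apply: lerD => /=.
  apply: (lipschitz1 (df := fun x => - sin x)) => t.
  by rewrite normrN sin_max.
apply: (lipschitz1 (df := fun x => cos x)) => t.
exact: cos_max.
Qed.
End Cis.

(** * Hausdorff measures on the circle *)

Section HausdorffBounds.
Variable R : realType.
Implicit Types (x y t s delta : R) (E A : set R[i]).
Local Notation cis := (@cis2pi R).

Lemma circle_length_ge0 A : (0 <= circle_length A)%E.
Proof. exact: measure_ge0. Qed.

Lemma lebesgue_measure_co x y : x <= y ->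
  lebesgue_measure (`[x, y[ : set R) = (y - x)%:E.
Proof.
move=> xy; rewrite lebesgue_measure_itv /= lte_fin; case: ltP => // yx.
by rewrite (_ : y = x) ?subrr //; lra.
Qed.

(** An integer may cut [[x, y]] when it is brought back to [[0, 1[], but one of its two halves
    always fits in one piece, whence the factor [1/2]. *)
Lemma circle_length_segment A x y : x <= y <= x + 1 ->
  (forall t, x <= t <= y -> A (cis t)) -> (((y - x) / 2)%:E <= circle_length A)%E.
Proof.
move=> /andP[xy yx1] At.
have := floor_itv x; rewrite intrD1; set k := Num.floor x => /andP[f1 f2].
have sub z : 0 <= z -> z + (y - x) / 2 <= 1 ->
    (forall t, z <= t < z + (y - x) / 2 -> exists j : int, x <= t + j%:~R <= y) ->
    (((y - x) / 2)%:E <= circle_length A)%E.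
  move=> z0 z1 zt.
  rewrite -[X in X%:E](_ : z + (y - x) / 2 - z = _); last by ring.
  rewrite -lebesgue_measure_co; last lra.
  apply: le_mu_ext => t /=; rewrite in_itv /= => /andP[tz1 tz2]; split.
    by rewrite in_itv /=; lra.
  have [|j jt] := zt t; first by rewrite tz1.
  by rewrite -[cis t]mulr1 -(cis2pi_int R j) -cis2piD; apply: At.
have [h|h] := leP (x - k%:~R + (y - x) / 2) 1.
  apply: (sub (x - k%:~R)) => // [|t /andP[t1 t2]]; first lra.
  by exists k; lra.
apply: (sub (x - k%:~R + (y - x) / 2 - 1)) => [||t /andP[t1 t2]]; try lra.
by exists (k + 1); rewrite intrD1; lra.
Qed.

Lemma int_small (k : int) : `|k%:~R : R| < 1 -> k = 0.
Proof.
by rewrite -intr_norm -[1]/(1%:~R) ltr_int; case: k => [[|n]|n].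
Qed.

(** The two parameters agree modulo integers with points of one interval at distance at most [2 l].
    The integers are equal because their difference is at most [|x - y| + 2 l < 1]. *)
Lemma arc_dist A x y l : is_arc A -> (circle_length A <= l%:E)%E -> l < 4^-1 ->
  `|x - y| <= 2^-1 -> A (cis x) -> A (cis y) -> `|x - y| <= 2 * l.
Proof.
move=> [I ->] lA l4 xy [u Iu ux] [v Iv vy].
wlog uv : x y u v xy Iu ux Iv vy / u <= v => [H|].
  have [uv|/ltW vu] := leP u v; first exact: (H x y u v).
  by rewrite distrC; apply: (H y x v u) => //; rewrite distrC.
have Iuv t : u <= t <= v -> t \in I.
  move=> /andP[ut tv]; move: Iu Iv; rewrite /=; case: (I) => a b.
  rewrite !itv_boundlr => /andP[au _] /andP[_ vb]; apply/andP; split.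
    exact: le_trans au _.
  by apply: le_trans vb.
have uv1 : v - u <= 2 * l.
  have {}lA w : u <= w <= v -> w <= u + 1 -> w - u <= 2 * l.
    move=> /andP[uw wv] wu; have := @circle_length_segment (cis @` [set` I]) u w.
    rewrite uw wu => /(_ isT) h.
    have {}h := le_trans (h _) lA; move: h; rewrite lee_fin => h.
    suff : (w - u) / 2 <= l by lra.
    by apply: h => t /andP[? ?]; exists t => //; apply: Iuv; lra.
  have [h|h] := leP v (u + 1); first by apply: lA => //; rewrite uv lexx.
  by have := lA (u + 1); lra.
have [j jE] := cis2pi_inj ux; have [k kE] := cis2pi_inj vy.
suff jk : j - k = 0.
  have {}jk : j = k by apply/eqP; rewrite -subr_eq0 jk.
  move: jE kE; rewrite jk => jE kE.
  by rewrite ler_norml; lra.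
apply: int_small; rewrite intrB; move: xy; rewrite !ler_norml ltr_norml; lra.
Qed.

Lemma hausdorff_pre_homo s E : {in `]0, +oo[ &,
  {homo (fun delta => hausdorff_pre s delta E) : n m / n <= m >-> (m <= n)%E}}.
Proof.
move=> d e _ _ de; apply: ereal_inf_le_tmp => _ [I [Ia EI Id] <-].
by exists I => //; split=> // n; apply: lt_le_trans (Id n) _; rewrite lee_fin.
Qed.

(** The premeasure grows as [delta] decreases, so its limit is a supremum and a lower bound at a
    single [delta] is enough. *)
Lemma hausdorff_measureE s E : hausdorff_measure s E =
  ereal_sup [set hausdorff_pre s delta E | delta in `]0, +oo[].
Proof.
apply: cvg_lim => //.
exact: (nonincreasing_at_right_cvge _ _ (@hausdorff_pre_homo s E)).
Qed.

Lemma hausdorff_measure_gt0 s E c delta : 0 < c -> 0 < delta ->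
  (forall I : nat -> set R[i], (forall n, is_arc (I n)) -> E `<=` \bigcup_n I n ->
     (forall n, (circle_length (I n) < delta%:E)%E) ->
     (c%:E <= \sum_(0 <= n <oo) (circle_length (I n)) `^ s)%E) ->
  (0 < hausdorff_measure s E)%E.
Proof.
move=> c0 d0 H; apply: (@lt_le_trans _ _ c%:E); first by rewrite lte_fin.
rewrite hausdorff_measureE; apply: (@le_trans _ _ (hausdorff_pre s delta E)).
  by apply: le_ereal_inf_tmp => _ [I [Ia EI Id] <-]; exact: H.
by apply: ereal_sup_ubound; exists delta => //=; rewrite in_itv /= d0.
Qed.

Lemma circle_length_subdivision (N k : nat) : (k < N)%N ->
  (circle_length (cis @` [set` (`[k%:R / N%:R, k.+1%:R / N%:R[)%R]) <= (N%:R^-1)%:E)%E.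
Proof.
move=> kN; have N0 : 0 < N%:R :> R by rewrite ltr0n; case: N kN.
have NE : N%:R^-1 = k.+1%:R / N%:R - k%:R / N%:R :> R.
  by rewrite -mulrBl -natrB // subSnn mul1r.
rewrite [X in (_ <= X%:E)%E]NE -lebesgue_measure_co; last by rewrite ler_pM2r ?invr_gt0 // ler_nat.
apply: le_mu_ext => t [/= + [u + utE]]; rewrite !in_itv /=.
move=> /andP[t0 t1] /andP[u1 u2].
have k0 : 0 <= k%:R / N%:R :> R by rewrite divr_ge0 // ler0n.
have k1 : k.+1%:R / N%:R <= 1 :> R by rewrite ler_pdivrMr // mul1r ler_nat.
have [j jE] := cis2pi_inj utE.
suff j0 : j = 0 by move: jE; rewrite j0 addr0 => <-; rewrite u1.
by apply: int_small; rewrite ltr_norml; lra.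
Qed.

(** Covering the circle by [N] arcs of length [1/N] costs [N ^ (1 - s)]; the second argument of the
    minimum [m] is what brings this below [e]. *)
Lemma hausdorff_measure_gt1 s E : E `<=` @unit_circle R -> 1 < s ->
  hausdorff_measure s E = 0%E.
Proof.
move=> EU s1; rewrite hausdorff_measureE.
have s0 : 0 < s by lra.
suff H delta : 0 < delta -> (hausdorff_pre s delta E <= 0)%E.
  apply/eqP; rewrite eq_le; apply/andP; split.
    by apply: ge_ereal_sup => _ [d + <-]; rewrite /= in_itv /= andbT => /H.
  apply: ereal_sup_ubound; exists 1 => /=; first by rewrite in_itv /= ltr01.
  apply/eqP; rewrite eq_le H //=; apply: le_ereal_inf_tmp => _ [I _ <-].
  by apply: nneseries_ge0 => n _ _; exact: poweR_ge0.
move=> d0; apply/lee_addgt0Pr => e e0; rewrite add0e.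
have s10 : 0 < s - 1 by lra.
pose m := Num.min delta (e `^ (s - 1)^-1).
have m0 : 0 < m by rewrite /m lt_min d0 powR_gt0.
pose N := (Num.truncn m^-1).+1.
have N0 : 0 < N%:R^-1 :> R by rewrite invr_gt0 ltr0n.
have Nm : N%:R^-1 < m.
  by rewrite -[ltRHS]invrK ltf_pV2 ?posrE ?invr_gt0 ?ltr0n // truncnS_gt.
have [Nd Ne] : N%:R^-1 < delta /\ N%:R^-1 < e `^ (s - 1)^-1.
  by move: Nm; rewrite /m lt_min => /andP[].
have NE : N%:R^-1 `^ (s - 1) < e.
  have -> : e = (e `^ (s - 1)^-1) `^ (s - 1).
    by rewrite -powRrM mulVf ?powRr1 ?ltW // gt_eqF.
  by apply: gt0_ltr_powR => //; rewrite nnegrE ?powR_ge0 // ltW.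
pose I n := if (n < N)%N then cis @` [set` `[n%:R / N%:R, n.+1%:R / N%:R[]
            else set0.
apply: (@le_trans _ _ (\sum_(0 <= n <oo) (circle_length (I n)) `^ s)%E).
  apply: ereal_inf_lbound; exists I => //; split.
  - move=> n; rewrite /I; case: ifP => _; first by eexists.
    exists `]0, 0[; rewrite set_itvoo0 image_set0 //.
  - move=> z /EU /normc_eq1 /cis2pi_surj[t ->].
    pose r := t - (Num.floor t)%:~R.
    have := floor_itv t; rewrite intrD1 => /andP[f1 f2].
    have r0 : 0 <= r * N%:R by rewrite mulr_ge0 ?ler0n // /r; lra.
    have /andP[n1 n2] := truncn_itv r0.
    have nN : (Num.truncn (r * N%:R) < N)%N.
      rewrite -(ltr_nat R) (le_lt_trans n1) // -[ltRHS]mul1r ltr_pM2r ?ltr0n //.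
      by rewrite /r; lra.
    exists (Num.truncn (r * N%:R)) => //; rewrite /I nN; exists r.
      rewrite /= in_itv /= ler_pdivrMr ?ltr0n // n1 ltr_pdivlMr ?ltr0n //.
    by rewrite cis2piD cis2piN cis2pi_int invr1 mulr1.
  - move=> n; rewrite /I; case: ifP => nN.
      by rewrite (le_lt_trans (circle_length_subdivision nN)) // lte_fin.
    by rewrite /circle_length preimage_set0 setI0 measure0 lte_fin.
rewrite (@nneseries_split _ _ 0 N); last by move=> n _; exact: poweR_ge0.
rewrite [X in (_ + X)%E]eseries0 ?adde0; last first.
  move=> n; rewrite add0n => Nn _; rewrite /I ltnNge Nn /=.
  by rewrite /circle_length preimage_set0 setI0 measure0 poweR0r // gt_eqF.
apply: (@le_trans _ _ (\sum_(0 <= n < 0 + N) (N%:R^-1 `^ s)%:E)%E).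
  rewrite big_nat [leRHS]big_nat; apply: lee_sum => n; rewrite add0n => /andP[_ nN].
  rewrite /I nN -poweR_EFin; apply: gt0_ler_poweR; first exact: ltW.
  - by rewrite in_itv /= circle_length_ge0 leey.
  - by rewrite in_itv /= lee_fin ltW //= leey.
  - exact: circle_length_subdivision.
rewrite sumEFin lee_fin big_const_nat iter_addr addr0 subn0 add0n -[leLHS]mulr_natr.
rewrite -(mulr_powRB1 (ltW N0)) // mulrAC mulVf ?mul1r ?ltW //.
by rewrite pnatr_eq0.
Qed.

Lemma hausdorff_dim_eq1 E : E `<=` @unit_circle R ->
  (forall s, 0 < s < 1 -> (0 < hausdorff_measure s E)%E) ->
  hausdorff_dim E = 1%E.
Proof.
move=> EU H; apply/eqP; rewrite eq_le; apply/andP; split.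
  apply: ge_ereal_sup => _ [->|[s [s0 sE] <-]]; first by rewrite lee_fin.
  rewrite lee_fin leNgt; apply/negP => s1.
  by move: sE; rewrite hausdorff_measure_gt1 // ltxx.
apply/lee_subgt0Pr => e e0.
have [e1|e1] := leP 1 e.
  apply: (@le_trans _ _ 0%E); first by rewrite -EFinB lee_fin; lra.
  by apply: ereal_sup_ubound; left.
apply: ereal_sup_ubound; right; exists (1 - e) => //.
by split; [lra|apply: H; lra].
Qed.

End HausdorffBounds.

(** * Lifts of Blaschke products *)

Section CircleLift.
Variable R : realType.
Implicit Types (x y t : R) (a z : R[i]) (f h : R[i] -> R[i]).
Local Notation cis := (@cis2pi R).
Local Notation normc := (@Normc.normc R).

Lemma is_derive_add (f g : R -> R) t (a b : R) : is_derive t 1 f a ->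
  is_derive t 1 g b -> is_derive t 1 (fun x => f x + g x) (a + b).
Proof. by move=> df dg; exact: is_deriveD. Qed.

Lemma is_derive_mul (f g : R -> R) t (a b : R) : is_derive t 1 f a ->
  is_derive t 1 g b -> is_derive t 1 (fun x => f x * g x) (f t * b + g t * a).
Proof. by move=> df dg; exact: is_deriveM. Qed.

Lemma is_derive_scale (f : R -> R) (k t a : R) : is_derive t 1 f a ->
  is_derive t 1 (fun x => k * f x) (k * a).
Proof. by move=> df; exact: is_deriveZ. Qed.

Lemma is_derive_shift (f : R -> R) (k t a : R) : is_derive t 1 f a ->
  is_derive t 1 (fun x => k + f x) a.
Proof.
by move=> df; rewrite -[a]add0r; apply: is_derive_add; exact: is_derive_cst.
Qed.

Record circle_lift f (G g : R -> R) (d : nat) (gmin gmax C : R) : Prop := CircleLift {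
  lift_eq : forall t, f (cis t) = cis (G t);
  lift_derive : forall t, is_derive t 1 G (g t);
  lift_degree : forall t, G (t + 1) = G t + d%:R;
  lift_gmin : forall t, gmin <= g t;
  lift_gmax : forall t, g t <= gmax;
  lift_lip : forall x y, `|g x - g y| <= C * `|x - y|
}.

(** Arguments add up under multiplication, and so do derivatives, degrees and all bounds: a Blaschke
    product is lifted factor by factor. *)
Lemma circle_liftM f h G g d m M C G' g' d' m' M' C' :
  circle_lift f G g d m M C -> circle_lift h G' g' d' m' M' C' ->
  circle_lift (fun z => f z * h z) (G \+ G') (g \+ g') (d + d') (m + m') (M + M') (C + C').
Proof.
move=> [f1 f2 f3 f4 f5 f6] [h1 h2 h3 h4 h5 h6]; split=> [t|t|t|t|t|x y] /=.
- by rewrite f1 h1 -cis2piD.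
- exact: is_deriveD.
- by rewrite f3 h3 natrD; ring.
- exact: lerD.
- exact: lerD.
- rewrite mulrDl (_ : _ - _ = (g x - g y) + (g' x - g' y)); last by ring.
  by apply: le_trans (ler_normD _ _) _; apply: lerD.
Qed.

Lemma circle_lift_monomial a m : normc a = 1 ->
  exists G, circle_lift (fun z => a * z ^+ m) G (fun=> m%:R) m m%:R m%:R 0.
Proof.
move=> /cis2pi_surj[t0 ->]; exists (fun t => t0 + m%:R * t); split=> //.
- by move=> t; rewrite cis2piD mulr_natl cis2piMn.
- move=> t; apply: is_derive_shift; rewrite -[X in is_derive _ _ _ X]mulr1.
  by apply: is_derive_scale; exact: is_derive_id.
- by move=> t; ring.
- by move=> x y; rewrite subrr normr0 mul0r.
Qed.

(** For [u > 0] the argument of [u + iv] is [atan (v / u)], and dividing the conjugate by the number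
    yields minus twice this argument. *)
Lemma cis2pi_atan (u v : R) : 0 < u ->
  cis (- (atan (v / u) / pi)) = (u +i* (- v))%C / (u +i* v)%C.
Proof.
move=> u0; have pi0 := pi_gt0 R.
have uv0 : 0 < u ^+ 2 + v ^+ 2 by have := exprn_gt0 2 u0; have := sqr_ge0 v; lra.
have w0 : (u +i* v)%C != 0.
  by apply/eqP => -[h _]; move: u0; rewrite h ltxx.
apply: (mulIf w0); rewrite divfK // /cis2pi.
have -> : 2 * pi * - (atan (v / u) / pi) = - (atan (v / u) *+ 2).
  by move: (pi) (gt_eqF pi0) => p p0; field; rewrite p0.
rewrite cosN sinN sin_mulr2n cos_mulr2n.
have cA : cos (atan (v / u)) != 0.
  by rewrite gt_eqF // cos_gt0_pihalf // atan_gtNpi2 atan_ltpi2.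
have sE : sin (atan (v / u)) = v / u * cos (atan (v / u)).
  have := atanK (v / u); rewrite /tan => tE.
  by rewrite -[X in _ = X * _]tE divfK.
have cE : cos (atan (v / u)) ^+ 2 = u ^+ 2 / (u ^+ 2 + v ^+ 2).
  rewrite -[LHS]invrK cos2_tan2 // atanK; field.
  by rewrite !gt_eqF //.
have csE : cos (atan (v / u)) * sin (atan (v / u)) = u * v / (u ^+ 2 + v ^+ 2).
  by rewrite sE mulrCA -expr2 cE; field; rewrite !gt_eqF.
rewrite csE cE; apply/eqP; rewrite eq_complex /=; apply/andP; split; apply/eqP.
  by field; rewrite gt_eqF.
by field; rewrite gt_eqF.
Qed.

(* With [u +i* v = 1 - a^* cis t], one has [(cis t - a) / (1 - a^* cis t) =
   cis t * (u -i* v) / (u +i* v)], whose argument is given by [atan (v / u)]; the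
   lift has derivative [(1 - |a|^2) / (u^2 + v^2)]. *)
Lemma circle_lift_factor a : normc a < 1 -> exists G g M C m,
  0 < m /\ circle_lift (fun z => (z - a) / (1 - a^*%C * z)) G g 1 m M C.
Proof.
case: a => a1 a2 a_lt1; have pi0 := pi_gt0 R.
pose r2 := a1 ^+ 2 + a2 ^+ 2.
have r20 : 0 <= r2 by rewrite addr_ge0 ?sqr_ge0.
have r21 : r2 < 1.
  by move: a_lt1; rewrite /= -[X in _ < X]sqrtr1 ltr_sqrt.
pose u t := 1 - a1 * cos (2 * pi * t) - a2 * sin (2 * pi * t).
pose v t := a2 * cos (2 * pi * t) - a1 * sin (2 * pi * t).
(* The number [1 - (u + iv)] is [conj a * cis t], of modulus [|a|]; hence [u^2 + v^2] is affine in
   [u]. *)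
have uvE t : u t ^+ 2 + v t ^+ 2 = 2 * u t - 1 + r2.
  rewrite /u /v /r2; have := cos2Dsin2 (2 * pi * t).
  set c := cos _; set s := sin _ => cs.
  have -> : a1 ^+ 2 + a2 ^+ 2 = (a1 ^+ 2 + a2 ^+ 2) * (c ^+ 2 + s ^+ 2) by rewrite cs mulr1.
  by ring.
have dl t : is_derive t (1 : R) (fun x => 2 * pi * x) (2 * pi).
  by rewrite -[X in is_derive _ _ _ X]mulr1; apply: is_derive_scale; exact: is_derive_id.
have dc t : is_derive t (1 : R) (fun x => cos (2 * pi * x)) (- sin (2 * pi * t) * (2 * pi)).
  exact: (@is_derive1_comp _ cos (fun x => 2 * pi * x)).
have ds t : is_derive t (1 : R) (fun x => sin (2 * pi * x)) (cos (2 * pi * t) * (2 * pi)).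
  exact: (@is_derive1_comp _ sin (fun x => 2 * pi * x)).
have du t : is_derive t 1 u (- (2 * pi * v t)).
  have -> : u = fun x => 1 + (- a1 * cos (2 * pi * x) + - a2 * sin (2 * pi * x)).
    by apply/funext => x; rewrite /u; ring.
  have H := is_derive_shift 1 (is_derive_add (is_derive_scale (- a1) (dc t))
    (is_derive_scale (- a2) (ds t))).
  by apply: (is_derive_eq H); rewrite /v; ring.
have dv t : is_derive t 1 v (2 * pi * (u t - 1)).
  have -> : v = fun x => a2 * cos (2 * pi * x) + - a1 * sin (2 * pi * x).
    by apply/funext => x; rewrite /v; ring.
  have H := is_derive_add (is_derive_scale a2 (dc t)) (is_derive_scale (- a1) (ds t)).
  by apply: (is_derive_eq H); rewrite /u; ring.
have u0 t : (1 - r2) / 2 <= u t.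
  by have := sqr_ge0 (u t); have := sqr_ge0 (v t); have := uvE t; lra.
have u2 t : u t <= 2.
  have := sqr_ge0 (v t); have := uvE t; nra.
pose w t := 2 * u t - 1 + r2.
have w0 t : ((1 - r2) / 2) ^+ 2 <= w t.
  have := u0 t; have := sqr_ge0 (v t); rewrite /w -uvE; nra.
have w4 t : w t <= 4 by have := u2 t; rewrite /w; lra.
pose e := ((1 - r2) / 2) ^+ 2.
have e0 : 0 < e by rewrite exprn_gt0 // divr_gt0 //; lra.
have v2 t : `|v t| <= 2.
  by rewrite ler_norml; have := uvE t; have := w4 t; have := sqr_ge0 (u t); rewrite /w; nra.
have lip_u x y : `|u x - u y| <= 4 * pi * `|x - y|.
  wlog xy : x y / x <= y => [H|].
    by have [/H//|/ltW/H] := leP x y; rewrite distrC [in leRHS]distrC.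
  have [c _ E] := mean_value du xy.
  rewrite distrC E normrM [in leRHS]distrC ler_wpM2r // normrN normrM.
  have pi2 : 0 <= 2 * pi :> R by rewrite mulr_ge0 // ltW.
  rewrite ger0_norm // (_ : 4 * pi = 2 * pi * 2 :> R); last by ring.
  by rewrite ler_pM2l ?mulr_gt0.
(* The derivative [(1 - r2) / w] is the Poisson kernel. Its bounds come from [e <= w <= 4], and its
   Lipschitz constant from [w = 2 u - 1 + r2] and the constant [4 pi] for [u]. *)
exists (fun t => t - atan (v t / u t) / pi), (fun t => (1 - r2) / w t),
  ((1 - r2) / e), ((1 - r2) / e ^+ 2 * (8 * pi)), ((1 - r2) / 4).
have r20' : 0 < 1 - r2 by lra.
split; first lra.
split=> [t|t|t|t|t|x y].
- rewrite cis2piD cis2pi_atan; last by have := u0 t; lra.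
  rewrite mulrA; congr (_ / _); apply/eqP; rewrite eq_complex /=; apply/andP.
    rewrite /u /v; have := cos2Dsin2 (2 * pi * t).
    set c := cos _; set s := sin _ => cs.
    have cs' : c ^+ 2 = 1 - s ^+ 2 by lra.
    split; apply/eqP; ring: cs'.
  by rewrite /u /v /=; split; apply/eqP; ring.
- have u0' : u t != 0 by rewrite gt_eqF //; have := u0 t; lra.
  have dq : is_derive t (1 : R) (fun x => v x / u x)
      (2 * pi * ((u t ^+ 2 + v t ^+ 2 - u t) / u t ^+ 2)).
    have H := is_derive_mul (dv t) (is_deriveV u0' (du t)).
    apply: (is_derive_eq H); rewrite /GRing.scale /=.
    by move: (pi : R) => p; field.
  have dat : is_derive t (1 : R) (fun x => atan (v x / u x)) (2 * pi * ((w t - u t) / w t)).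
    have H := @is_derive1_comp R atan (fun x => v x / u x) t _ _
      (is_derive1_atan (v t / u t)) dq.
    apply: (is_derive_eq H); rewrite /w -uvE.
    have wt : u t ^+ 2 + v t ^+ 2 != 0 by rewrite uvE gt_eqF //; have := w0 t; rewrite /w -/e; lra.
    by move: (pi : R) => p; field; rewrite u0' wt.
  have H := is_derive_add (is_derive_id t (1 : R)) (is_derive_scale (- pi^-1) dat).
  have -> : (fun x => x - atan (v x / u x) / pi) =
      (fun x => x + - pi^-1 * atan (v x / u x)).
    by apply/funext => x; rewrite mulNr mulrC.
  have wt : w t != 0 by rewrite gt_eqF //; have := w0 t; rewrite -/e; lra.
  apply: (is_derive_eq H); move: (gt_eqF pi0); move: (pi : R) => p p0.
  have -> : (1 - r2) / w t = (2 * u t - w t) / w t by congr (_ / _); rewrite /w; ring.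
  by field; rewrite p0 wt.
- have e2 : 2 * pi * (t + 1) = 2 * pi * t + pi *+ 2 by rewrite -mulr_natr; ring.
  by rewrite /u /v e2 cosD2pi sinD2pi; ring.
- by rewrite ler_pM2l ?lef_pV2 ?posrE ?w4 //; have := w0 t; rewrite -/e; lra.
- by rewrite ler_pM2l ?lef_pV2 ?posrE ?w0 //; have := w0 t; rewrite -/e; lra.
- have wx := w0 x; have wy := w0 y; rewrite -/e in wx wy.
  have wx0 : 0 < w x by lra.
  have wy0 : 0 < w y by lra.
  have -> : (1 - r2) / w x - (1 - r2) / w y =
      (1 - r2) / (w x * w y) * (2 * (u y - u x)).
    rewrite (_ : 2 * (u y - u x) = w y - w x); last by rewrite /w; ring.
    by field; rewrite !gt_eqF.
  rewrite normrM -[leRHS]mulrA; apply: ler_pM => //; last first.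
    rewrite normrM ger0_norm // distrC (_ : 8 * pi * _ = 2 * (4 * pi * `|x - y|)).
      by rewrite ler_pM2l // lip_u.
    by rewrite !mulrA -natrM.
  rewrite ger0_norm; last first.
    by rewrite divr_ge0 ?mulr_ge0 ?(ltW wx0) ?(ltW wy0) //; lra.
  rewrite ler_pM2l; last lra.
  rewrite [e ^+ 2]expr2 lef_pV2 ?posrE ?mulr_gt0 //.
  by apply: ler_pM => //; exact: ltW.
Qed.
Lemma circle_lift_prod (zs : seq R[i]) : (forall a, a \in zs -> `|a| < 1) ->
  exists G g m M C, [/\ 0 <= m, zs != [::] -> 0 < m &
    circle_lift (fun z => \prod_(a <- zs) ((z - a) / (1 - a^*%C * z)))
      G g (size zs) m M C].
Proof.
elim: zs => [|a zs IH] zs1.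
  exists (fun=> 0), (fun=> 0), 0, 0, 0; split=> //; split=> //.
  - by move=> t; rewrite big_nil cis2pi0.
  - by move=> t; exact: is_derive_cst.
  - by move=> t; rewrite addr0.
  - by move=> x y; rewrite subrr normr0 mul0r.
have [|G [g [m [M [C [m0 _ L]]]]]] := IH.
  by move=> b bzs; apply: zs1; rewrite in_cons bzs orbT.
have a1 : normc a < 1 by have := zs1 a (mem_head _ _); rewrite normcE ltcR.
have [G' [g' [M' [C' [m' [m'0 L']]]]]] := circle_lift_factor a1.
exists (G' \+ G), (g' \+ g), (m' + m), (M' + M), (C' + C); split; [lra|by move=> _; lra|].
have -> : (fun z => \prod_(b <- a :: zs) ((z - b) / (1 - b^*%C * z))) =
    (fun z => (z - a) / (1 - a^*%C * z) *
       \prod_(b <- zs) ((z - b) / (1 - b^*%C * z))).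
  by apply/funext => z; rewrite big_cons.
by rewrite /= -add1n; exact: circle_liftM L' L.
Qed.

(** The derivative is at least the exponent of [z] plus a positive amount when there are further
    zeros. The bound is [1] only for exponent one and no further zero, that is for a rotation. *)
Lemma blaschke_lift f : finite_blaschke0 f -> ~ is_rotation f ->
  exists G g d m M C, circle_lift f G g d m M C /\ 1 < m.
Proof.
move=> [al [n [zs [/normc_eq1 al1 n0 zs1 fE]]]] nrot.
have [G [g [m [M [C [m0 mpos L]]]]]] := circle_lift_prod zs1.
have [G' L'] := circle_lift_monomial n al1.
have [p1 p2 p3 p4 p5 p6] := circle_liftM L' L.
exists (G' \+ G), ((fun=> n%:R) \+ g), (n + size zs)%N, (n%:R + m), (n%:R + M), (0 + C).
split.
  split=> // t; rewrite fE ?p1 //.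
  by rewrite normcE normc_cis2pi.
case: n n0 {L' p1 p2 p3 p4 p5 p6} fE => // n _ fE.
have [z0|/mpos m_gt0] := eqVneq zs [::].
  case: n fE => [|n] fE; last by rewrite -natr1 -natr1; have := ler0n R n; lra.
  exfalso; apply: nrot; exists al; split; first exact/normc_eq1.
  by move=> z z1; rewrite fE // z0 big_nil mulr1 expr1.
by rewrite -natr1; have := ler0n R n; lra.
Qed.
End CircleLift.

(** * Cylinders and bounded distortion *)

Section Cylinders.
Variables (R : realType) (f : R[i] -> R[i]) (G g : R -> R) (d : nat) (m M C : R).
Hypothesis L : circle_lift f G g d m M C.
Hypothesis m_gt1 : 1 < m.
Implicit Types (x y t p : R) (n k N : nat) (i : int).
Local Notation cis := (@cis2pi R).
Local Notation normc := (@Normc.normc R).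

Lemma lift_expand x y : x <= y ->
  m * (y - x) <= G y - G x <= M * (y - x).
Proof.
move=> xy; have [c _ ->] := mean_value (lift_derive L) xy.
by rewrite !ler_wpM2r ?subr_ge0 // ?(lift_gmin L) ?(lift_gmax L).
Qed.

Lemma lift_gmax_ge1 : 1 <= M.
Proof. exact: le_trans (ltW m_gt1) (le_trans (lift_gmin L 0) (lift_gmax L 0)). Qed.

Lemma lift_continuous : continuous G.
Proof.
move=> x; apply: differentiable_continuous; apply/derivable1_diffP.
exact: (@ex_derive _ _ _ _ _ _ _ (lift_derive L x)).
Qed.

Lemma lift_surj v : exists x, G x = v.
Proof.
have m1 := m_gt1.
pose b := `|v - G 0|.
have b0 : 0 <= b by exact: normr_ge0.
have [h1 h2] : v - G 0 <= b /\ - b <= v - G 0.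
  by have := lexx b; rewrite {1}/b ler_norml => /andP[].
have [|||x _ xE] := @IVT R G (- b) b v; last by exists x.
- by lra.
- by apply: continuous_subspaceT => x; exact: lift_continuous.
- have /andP[e1 _] := lift_expand b0; have mb : b <= m * b by rewrite ler_peMl // ltW.
  have nb0 : - b <= 0 by rewrite oppr_le0.
  have /andP[e2 _] := lift_expand nb0.
  rewrite ge_min le_max; apply/andP; split; apply/orP; [left|right]; nra.
Qed.

(** The slope of [G x - x] is at least [m - 1], which forces a change of sign on [[-b, b]]. *)
Lemma lift_fixpoint : exists p, G p = p.
Proof.
pose b := `|G 0| / (m - 1).
have m1 : 0 < m - 1 by rewrite subr_gt0.
have b0 : 0 <= b by rewrite divr_ge0 // ltW.
have bE : b * (m - 1) = `|G 0| by rewrite divfK // gt_eqF.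
have [h1 h2] : G 0 <= b * (m - 1) /\ - (b * (m - 1)) <= G 0.
  by rewrite bE; have := lexx `|G 0|; rewrite {1}ler_norml => /andP[].
have [|||x _ xE] := @IVT R (fun x => G x - x) (- b) b 0.
- by lra.
- apply: continuous_subspaceT => x; apply: continuousB; first exact: lift_continuous.
  exact: cvg_id.
- have /andP[e1 _] := lift_expand b0; have nb0 : - b <= 0 by rewrite oppr_le0.
  have /andP[e2 _] := lift_expand nb0.
  rewrite ge_min le_max; apply/andP; split; apply/orP; [left|right]; nra.
by exists x; lra.
Qed.

Lemma iter_lift_surj n v : exists x, iter n G x = v.
Proof.
elim: n v => [|n IH] v; first by exists v.
have [y <-] := lift_surj v; have [x <-] := IH y.
by exists x.
Qed.

Lemma iter_lift_expand n x y : x <= y ->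
  m ^+ n * (y - x) <= iter n G y - iter n G x <= M ^+ n * (y - x).
Proof.
have m1 := m_gt1.
move=> xy; elim: n => [|n /andP[IH1 IH2]]; first by rewrite !mul1r /= lexx.
have le : iter n G x <= iter n G y.
  rewrite -subr_ge0 (le_trans _ IH1) // mulr_ge0 ?subr_ge0 // exprn_ge0 //; lra.
have /andP[e1 e2] := lift_expand le; have := lift_gmax_ge1 => M1.
rewrite !exprS -!mulrA /=; apply/andP; split.
  by apply: le_trans e1; rewrite ler_pM2l //; lra.
by apply: (le_trans e2); rewrite ler_pM2l //; lra.
Qed.

Lemma iter_lift_le n x y : (iter n G x <= iter n G y) = (x <= y).
Proof.
have m1 := m_gt1.
have m0 : 0 < m ^+ n by rewrite exprn_gt0 //; lra.
have [xy|yx] := leP x y.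
  have /andP[h _] := iter_lift_expand n xy; rewrite -subr_ge0.
  by apply: le_trans h; rewrite mulr_ge0 ?subr_ge0 // ltW.
apply/negP => h; have /andP[+ _] := iter_lift_expand n (ltW yx).
have : 0 < m ^+ n * (x - y) by rewrite mulr_gt0 ?subr_gt0.
lra.
Qed.

Lemma iter_lift_inj n : injective (iter n G).
Proof. by move=> x y e; apply/eqP; rewrite eq_le; apply/andP; split; rewrite -(iter_lift_le n) e lexx. Qed.

Lemma iter_lift_dist n k x y : (k <= n)%N ->
  `|iter k G x - iter k G y| <= m^-1 ^+ (n - k) * `|iter n G x - iter n G y|.
Proof.
have m1 := m_gt1.
move=> kn; wlog xy : x y / x <= y => [H|].
  by have [/H//|/ltW/H] := leP x y; rewrite distrC [in leRHS]distrC.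
have m0 : 0 < m by lra.
have h := iter_lift_le k x y; rewrite xy in h.
have /andP[e _] := iter_lift_expand (n - k) h.
rewrite -!iterD (subnK kn) in e.
have hn := iter_lift_le n x y; rewrite xy in hn.
rewrite distrC ger0_norm ?subr_ge0 // distrC ger0_norm ?subr_ge0 //.
by rewrite exprVn mulrC ler_pdivlMr ?exprn_gt0 // mulrC.
Qed.

Lemma iter_lift_int n x i : iter n G (x + i%:~R) = iter n G x + (d ^ n)%:R * i%:~R.
Proof.
have nat_case k t : G (t + k%:R) = G t + d%:R * k%:R.
  elim: k => [|k IH]; first by rewrite mulr0 !addr0.
  by rewrite -natr1 addrA (lift_degree L) IH; ring.
have int_case t j : G (t + j%:~R) = G t + d%:R * j%:~R.
  case: j => k; first exact: nat_case.
  rewrite NegzE mulrNz mulrN; apply: (addIr (d%:R * k.+1%:R)).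
  by rewrite -nat_case !addrNK.
elim: n => [|n IH]; first by rewrite mul1r.
rewrite /= IH (_ : (d ^ n)%:R * i%:~R = ((d ^ n)%:Z * i)%:~R) ?int_case.
  by rewrite expnS intrM !natrM mulrA.
by rewrite intrM.
Qed.

Lemma iter_lift_cis n x : iter n f (cis x) = cis (iter n G x).
Proof. by elim: n => //= n ->; rewrite (lift_eq L). Qed.

Lemma iter_dist n k x y : (k <= n)%N -> `|iter n G x - iter n G y| <= 1 ->
  normc (iter k f (cis x) - iter k f (cis y)) <= 4 * pi * m^-1 ^+ (n - k).
Proof.
have m1 := m_gt1.
move=> kn xy1; rewrite !iter_lift_cis; apply: le_trans (cis2pi_lip _ _) _.
rewrite ler_wpM2l ?mulr_ge0 ?(ltW (pi_gt0 R)) //.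
apply: (le_trans (iter_lift_dist _ _ kn)); rewrite ler_piMr // exprn_ge0 // invr_ge0.
lra.
Qed.

Definition distortion := expR (C / (m - 1)).

Lemma lift_lip_ge0 : 0 <= C.
Proof. by have := lift_lip L 1 0; rewrite subr0 normr1 mulr1; apply: le_trans. Qed.

Lemma distortion_ge1 : 1 <= distortion.
Proof.
have m1 := ltW m_gt1.
by rewrite -expR0 ler_expR divr_ge0 ?subr_ge0 ?lift_lip_ge0.
Qed.

(** At time [k] both segments lie in an interval of length at most [m^(k-n)], so one more
    application of [G] changes the ratio of their lengths by a factor at most
    [1 + C m^(k-n) <= exp (C m^(k-n))]. The exponents form a geometric series. The products avoid
    dividing by lengths that may vanish. *)
Lemma bounded_distortion n x y x1 y1 x2 y2 :
  iter n G y - iter n G x <= 1 ->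
  x <= x1 <= y1 -> y1 <= y -> x <= x2 <= y2 -> y2 <= y ->
  (iter n G y1 - iter n G x1) * (y2 - x2) <=
  distortion * (iter n G y2 - iter n G x2) * (y1 - x1).
Proof.
move=> h1 /andP[xx1 xy1] y1y /andP[xx2 xy2] y2y.
have m1 : 0 < m - 1 by rewrite subr_gt0.
have C0 := lift_lip_ge0.
(* Chosen so that [T k.+1 - T k = C m^(k-n)] and [T n = C / (m - 1)]. *)
pose T k := C * (m ^+ k / (m ^+ n * (m - 1))).
have mk k : 0 < m ^+ k by rewrite exprn_gt0 //; lra.
suff H k : (k <= n)%N -> (iter k G y1 - iter k G x1) * (y2 - x2) <=
    expR (T k) * (iter k G y2 - iter k G x2) * (y1 - x1).
  have := H n (leqnn n); rewrite (_ : T n = C / (m - 1)) //.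
  by rewrite /T; field; rewrite !gt_eqF.
elim: k => [|k IH] kn /=.
  rewrite mulrC -mulrA ler_peMl ?mulr_ge0 ?subr_ge0 //.
  by rewrite -expR0 ler_expR mulr_ge0 // ltW // divr_gt0 // mulr_gt0.
have {}IH := IH (ltnW kn).
have g_le u v : iter k G u <= iter k G v = (u <= v) by exact: iter_lift_le.
have [c1 /andP[c1a c1b] ->] := mean_value (lift_derive L) (etrans (g_le x1 y1) xy1).
have [c2 /andP[c2a c2b] ->] := mean_value (lift_derive L) (etrans (g_le x2 y2) xy2).
have lk : iter k G y - iter k G x <= m ^+ k / m ^+ n.
  have xy : x <= y by lra.
  have := @iter_lift_dist n k y x (ltnW kn).
  rewrite !ger0_norm ?subr_ge0 ?iter_lift_le // => h.
  apply: (le_trans h); rewrite exprVn -[in leRHS](subnK (ltnW kn)) exprD invfM.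
  rewrite mulrCA divff ?mulr1 ?gt_eqF //.
  by rewrite ler_piMr // invr_ge0 ltW.
have gc : g c1 <= g c2 * expR (C * (m ^+ k / m ^+ n)).
  have := lift_lip L c1 c2; have := lift_gmin L c2 => g2.
  have c12 : `|c1 - c2| <= m ^+ k / m ^+ n.
    apply: le_trans lk; rewrite ler_norml.
    have := g_le x x1; have := g_le y1 y; have := g_le x x2; have := g_le y2 y.
    rewrite xx1 y1y xx2 y2y; lra.
  rewrite ler_norml => /andP[_ h].
  apply: (@le_trans _ _ (g c2 * (1 + C * (m ^+ k / m ^+ n)))).
    have := ler_wpM2l C0 c12.
    have : 0 <= C * (m ^+ k / m ^+ n) by rewrite mulr_ge0 // ltW // divr_gt0.
    set X := C * (m ^+ k / _); nra.
  by rewrite ler_wpM2l ?expR_ge1Dx //; lra.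
have TS : T k.+1 = C * (m ^+ k / m ^+ n) + T k.
  by rewrite /T exprS; field; rewrite !gt_eqF.
have D1 := g_le x1 y1; have D2 := g_le x2 y2; rewrite xy1 in D1; rewrite xy2 in D2.
have g2 : 0 <= g c2 by have := lift_gmin L c2; lra.
rewrite TS expRD -mulrA.
apply: (@le_trans _ _ ((g c2 * expR (C * (m ^+ k / m ^+ n))) *
    ((iter k G y1 - iter k G x1) * (y2 - x2)))).
  by rewrite ler_wpM2r // mulr_ge0 // subr_ge0.
apply: (@le_trans _ _ ((g c2 * expR (C * (m ^+ k / m ^+ n))) *
    (expR (T k) * (iter k G y2 - iter k G x2) * (y1 - x1)))).
  by rewrite ler_wpM2l // mulr_ge0 // expR_ge0.
by rewrite le_eqVlt; apply/orP; left; apply/eqP; ring.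
Qed.

Variable p : R.
Hypothesis Gp : G p = p.

(** Left endpoint of the cylinder of generation [n] and index [i]. As [p] is fixed and [G] has
    degree [d], an endpoint of one generation remains an endpoint in all later ones, its index being
    multiplied by powers of [d]. *)
Definition cyl n i : R := sval (cid (iter_lift_surj n (p + i%:~R))).

Lemma cylE n i : iter n G (cyl n i) = p + i%:~R.
Proof. exact: (svalP (cid (iter_lift_surj n (p + i%:~R)))). Qed.

Definition cyl_len n i := cyl n (i + 1) - cyl n i.

Lemma iter_cyl n N i : iter n G (cyl (n + N) i) = cyl N i.
Proof. by apply: (@iter_lift_inj N); rewrite -iterD addnC !cylE. Qed.

Lemma iter_lift_fix n i : iter n G (p + i%:~R) = p + ((d ^ n)%:Z * i)%:~R.
Proof.
rewrite iter_lift_int intrM; congr (_ + _).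
by elim: n => //= n ->.
Qed.

Lemma cyl_nest n N i : cyl (n + N) ((d ^ N)%:Z * i) = cyl n i.
Proof.
apply: (@iter_lift_inj (n + N)).
by rewrite cylE addnC iterD cylE iter_lift_fix.
Qed.

Lemma cyl_shift N i j : cyl N ((d ^ N)%:Z * i + j) = cyl N j + i%:~R.
Proof.
apply: (@iter_lift_inj N); rewrite cylE iter_lift_int cylE intrD intrM.
by ring.
Qed.

Lemma cyl_len_bounds n i : m ^+ n * cyl_len n i <= 1 <= M ^+ n * cyl_len n i.
Proof.
have le : cyl n i <= cyl n (i + 1).
  by rewrite -(iter_lift_le n) !cylE lerD2l ler_int lerDl.
have := iter_lift_expand n le; rewrite !cylE intrD.
by rewrite (_ : _ + _ - _ = 1 :> R) //; ring.
Qed.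

Lemma cyl_len_gt0 n i : 0 < cyl_len n i.
Proof.
have /andP[_ h] := cyl_len_bounds n i.
have M0 : 0 < M ^+ n by rewrite exprn_gt0 // (lt_le_trans _ lift_gmax_ge1).
by rewrite -(pmulr_rgt0 _ M0) (lt_le_trans _ h).
Qed.

Lemma cyl_le n i j : i <= j -> cyl n i <= cyl n j.
Proof. by move=> ij; rewrite -(iter_lift_le n) !cylE lerD2l ler_int. Qed.

Definition child N i k : int := (d ^ N)%:Z * i + k%:Z.

Lemma childS N i k : child N i k + 1 = child N i k.+1.
Proof. by rewrite /child -addrA -[k.+1]addn1 PoszD. Qed.

Lemma child0 n N i : cyl (n + N) (child N i 0) = cyl n i.
Proof. by rewrite /child addr0 cyl_nest. Qed.

Lemma child_last n N i : cyl (n + N) (child N i (d ^ N)) = cyl n (i + 1).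
Proof. by rewrite -(cyl_nest n N (i + 1)) /child mulrDr mulr1. Qed.

Lemma child_sub n N i k : (k < d ^ N)%N ->
  cyl n i <= cyl (n + N) (child N i k) /\
  cyl (n + N) (child N i k + 1) <= cyl n (i + 1).
Proof.
move=> kN; split.
  by rewrite -(child0 n N i); apply: cyl_le; rewrite /child lerD2l lez_nat.
by rewrite -(child_last n N i) childS; apply: cyl_le; rewrite /child lerD2l lez_nat.
Qed.

Lemma child_telescope n N i (phi : R -> R) :
  \sum_(k < d ^ N) (phi (cyl (n + N) (child N i k + 1)) - phi (cyl (n + N) (child N i k)))
  = phi (cyl n (i + 1)) - phi (cyl n i).
Proof.
rewrite -(child0 n N i) -(child_last n N i).
under eq_bigr do rewrite childS.
rewrite -(big_mkord xpredT (fun k => phi (cyl (n + N) (child N i k.+1)) -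
  phi (cyl (n + N) (child N i k)))).
by rewrite (telescope_sumr (fun k => phi (cyl (n + N) (child N i k)))).
Qed.

Lemma child_image n N i k :
  iter n G (cyl (n + N) (child N i k)) = cyl N k + i%:~R.
Proof. by rewrite iter_cyl /child cyl_shift. Qed.

(** Lengths are multiplicative up to [distortion]: [iter n G] stretches the parent to length [1] and
    the child to length [cyl_len N k]. *)
Lemma child_len n N i k : (k < d ^ N)%N ->
  cyl_len N k * cyl_len n i <= distortion * cyl_len (n + N) (child N i k) /\
  cyl_len (n + N) (child N i k) <= distortion * cyl_len N k * cyl_len n i.
Proof.
move=> kN; have [s1 s2] := child_sub n i kN.
have l1 : iter n G (cyl n (i + 1)) - iter n G (cyl n i) = 1.
  by rewrite !cylE intrD; ring.
have e : iter n G (cyl (n + N) (child N i k + 1)) -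
    iter n G (cyl (n + N) (child N i k)) = cyl_len N k.
  by rewrite childS !child_image /cyl_len -[k.+1]addn1 PoszD; ring.
have h1 := ltW (cyl_len_gt0 n i); rewrite /cyl_len subr_ge0 in h1.
have h2 := ltW (cyl_len_gt0 (n + N) (child N i k)); rewrite /cyl_len subr_ge0 in h2.
have hx : cyl n i <= cyl n i <= cyl n (i + 1) by rewrite lexx.
have hc : cyl n i <= cyl (n + N) (child N i k) <= cyl (n + N) (child N i k + 1).
  by rewrite s1.
have l1' : iter n G (cyl n (i + 1)) - iter n G (cyl n i) <= 1 by rewrite l1.
split.
  have := bounded_distortion l1' hc s2 hx (lexx _).
  by rewrite e l1 mulr1.
have := bounded_distortion l1' hx (lexx _) hc s2.
by rewrite e l1 mul1r.
Qed.
End Cylinders.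

(** * Uniform limits of polynomials on the circle *)

Section DiscAlgebra.
Variable R : realType.
Implicit Types (z w c : R[i]) (h k : R[i] -> R[i]) (P Q : {poly R[i]}) (e : R).
Local Notation cis := (@cis2pi R).
Local Notation normc := (@Normc.normc R).

Lemma normcD z w : normc (z + w) <= normc z + normc w.
Proof. by rewrite -lecR rmorphD /= -!normcE ler_normD. Qed.

Lemma normc_ge0 z : 0 <= normc z.
Proof. by case: z => a b; exact: sqrtr_ge0. Qed.

Lemma normcN z : normc (- z) = normc z.
Proof. by case: z => a b /=; rewrite !sqrrN. Qed.

Lemma normcB z w : normc (z - w) <= normc z + normc w.
Proof. by rewrite -(normcN w) normcD. Qed.

Lemma normcX z n : normc (z ^+ n) = normc z ^+ n.
Proof. by elim: n => [|n IH]; rewrite ?Normc.normc1 // !exprS Normc.normcM IH. Qed.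

Lemma normc_conj z : normc z^*%C = normc z.
Proof. by case: z => a b /=; rewrite sqrrN. Qed.

Lemma normc_real (x : R) : normc x%:C%C = `|x|.
Proof. by rewrite /= expr0n /= addr0 sqrtr_sqr. Qed.

Lemma normc_sum (I : Type) (r : seq I) (F : I -> R[i]) :
  normc (\sum_(i <- r) F i) <= \sum_(i <- r) normc (F i).
Proof.
elim: r => [|i r IH]; first by rewrite !big_nil Normc.normc0.
by rewrite !big_cons (le_trans (normcD _ _)) // lerD2l.
Qed.

Lemma mul_conjc z : z * z^*%C = (normc z ^+ 2)%:C%C.
Proof.
case: z => a b; rewrite [normc _]/= sqr_sqrtr ?addr_ge0 ?sqr_ge0 //.
by apply/eqP; rewrite eq_complex /=; apply/andP; split; apply/eqP; ring.
Qed.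

Lemma conjc_unit z : normc z = 1 -> z^*%C = z^-1.
Proof.
move=> z1; have z0 : z != 0.
  by apply/eqP => h; move: z1; rewrite h Normc.normc0 => /eqP; rewrite eq_sym oner_eq0.
by apply: (mulfI z0); rewrite mul_conjc z1 expr1n divff.
Qed.

Definition bounded_on_circle h :=
  exists2 B : R, 0 < B & forall z, normc z = 1 -> normc (h z) <= B.

(** The disc algebra, seen from the circle: [c] is the value at the origin of the holomorphic
    extension of [h]. *)
Definition holo h c := forall e, 0 < e ->
  exists2 P, P.[0] = c & forall z, normc z = 1 -> normc (h z - P.[z]) <= e.

Lemma horner_bounded P : bounded_on_circle (horner P).
Proof.
exists (1 + \sum_(i < size P) normc P`_i).
  by rewrite ltr_pwDl // sumr_ge0 // => i _; exact: normc_ge0.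
move=> z z1; rewrite horner_coef; apply: (le_trans (normc_sum _ _)).
apply: (@le_trans _ _ (\sum_(i < size P) normc P`_i)); last by rewrite lerDr.
by apply: ler_sum => i _; rewrite Normc.normcM normcX z1 expr1n mulr1.
Qed.

Lemma holo_bounded h c : holo h c -> bounded_on_circle h.
Proof.
move=> /(_ 1 ltr01)[P _ HP]; have [B B0 HB] := horner_bounded P.
exists (1 + B); first by lra.
move=> z z1; rewrite -[h z](subrK P.[z]) (le_trans (normcD _ _)) //.
by rewrite lerD ?HP ?HB.
Qed.

Lemma holo_ext h k c : (forall z, normc z = 1 -> h z = k z) -> holo h c -> holo k c.
Proof.
move=> hk Hh e /Hh[P P0 HP]; exists P => // z z1.
by rewrite -hk // HP.
Qed.

Lemma holo_horner P : holo (horner P) P.[0].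
Proof. by move=> e e0; exists P => // z _; rewrite subrr Normc.normc0 ltW. Qed.

Lemma holo_id : holo id 0.
Proof.
apply: (@holo_ext (horner 'X)); first by move=> z _; rewrite hornerX.
by have := @holo_horner 'X; rewrite hornerX.
Qed.

Lemma holo_cst c : holo (fun=> c) c.
Proof.
apply: (@holo_ext (horner c%:P)); first by move=> z _; rewrite hornerC.
by have := @holo_horner c%:P; rewrite hornerC.
Qed.

Lemma holoD h k c c' : holo h c -> holo k c' -> holo (fun z => h z + k z) (c + c').
Proof.
move=> Hh Hk e e0; have e2 : 0 < e / 2 by lra.
have [P P0 HP] := Hh _ e2; have [Q Q0 HQ] := Hk _ e2.
exists (P + Q); first by rewrite hornerD P0 Q0.
move=> z z1; rewrite hornerD opprD addrACA (le_trans (normcD _ _)) //.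
by have := HP z z1; have := HQ z z1; lra.
Qed.

Lemma holoM h k c c' : holo h c -> holo k c' -> holo (fun z => h z * k z) (c * c').
Proof.
move=> Hh Hk e e0; have [B B0 HB] := holo_bounded Hk.
have e1 : 0 < e / (2 * B) by rewrite divr_gt0 ?mulr_gt0.
have [P P0 HP] := Hh _ e1; have [D D0 HD] := horner_bounded P.
have e2 : 0 < e / (2 * D) by rewrite divr_gt0 ?mulr_gt0.
have [Q Q0 HQ] := Hk _ e2.
exists (P * Q); first by rewrite hornerM P0 Q0.
move=> z z1; rewrite hornerM.
have -> : h z * k z - P.[z] * Q.[z] = (h z - P.[z]) * k z + P.[z] * (k z - Q.[z]).
  by ring.
apply: (le_trans (normcD _ _)); rewrite !Normc.normcM.
have -> : e = e / (2 * B) * B + D * (e / (2 * D)) by field; rewrite !gt_eqF.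
by rewrite lerD // ler_pM ?normc_ge0 ?HP ?HB ?HD ?HQ.
Qed.

Lemma holoX h c n : holo h c -> holo (fun z => h z ^+ n) (c ^+ n).
Proof.
move=> Hh; elim: n => [|n IH]; first exact: holo_cst.
rewrite [c ^+ _]exprS; apply: (holo_ext _ (holoM Hh IH)) => z _; by rewrite exprS.
Qed.

Lemma holoZ a h c : holo h c -> holo (fun z => a * h z) (a * c).
Proof. by move=> Hh; apply: holoM => //; exact: holo_cst. Qed.

Lemma holo_prod (T : eqType) (s : seq T) (F : T -> R[i] -> R[i]) (C : T -> R[i]) :
  (forall i, i \in s -> holo (F i) (C i)) ->
  holo (fun z => \prod_(i <- s) F i z) (\prod_(i <- s) C i).
Proof.
elim: s => [|i s IH] H.
  by rewrite big_nil; apply: (holo_ext _ (holo_cst 1)) => z _; rewrite big_nil.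
rewrite big_cons; apply: (@holo_ext (fun z => F i z * \prod_(j <- s) F j z)).
  by move=> z _; rewrite big_cons.
apply: holoM; first by apply: H; exact: mem_head.
by apply: IH => j js; apply: H; rewrite in_cons js orbT.
Qed.

Lemma holo_horner_comp P h c : holo h c -> holo (fun z => P.[h z]) P.[c].
Proof.
move=> Hh; elim/poly_ind: P => [|P a IH].
  by rewrite horner0; apply: (holo_ext _ (holo_cst 0)) => z _; rewrite horner0.
rewrite !hornerE; apply: (@holo_ext (fun z => P.[h z] * h z + a)).
  by move=> z _; rewrite !hornerE.
by apply: holoD; [exact: holoM|exact: holo_cst].
Qed.

(** A polynomial close to [F] on the circle remains close after substitution of [h], which takes its
    values there; a polynomial in [h] is in the algebra, and [h] vanishes at the origin. *)
Lemma holo_comp F h c : holo F c -> holo h 0 ->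
  (forall z, normc z = 1 -> normc (h z) = 1) -> holo (fun z => F (h z)) c.
Proof.
move=> HF Hh h1 e e0; have e2 : 0 < e / 2 by lra.
have [P P0 HP] := HF _ e2; have [Q Q0 HQ] := holo_horner_comp P Hh e2.
exists Q; first by rewrite Q0.
move=> z z1; rewrite -(subrKA P.[h z]) (le_trans (normcD _ _)) //.
by have := HP _ (h1 _ z1); have := HQ _ z1; lra.
Qed.

Lemma holo_geometric a : normc a < 1 -> holo (fun z => (1 - a * z)^-1) 1.
Proof.
move=> a1 e e0; pose r := normc a.
have r1 : 0 < 1 - r by rewrite /r; lra.
have [n Hn] := @expr_small R r (e * (1 - r)) (mulr_gt0 e0 r1)
  ltac:(by rewrite normc_ge0).
pose P := \sum_(i < n.+1) (a *: 'X) ^+ i.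
have PE z : P.[z] * (1 - a * z) = 1 - (a * z) ^+ n.+1.
  rewrite -[RHS]opprB subrX1 -[RHS]mulNr opprB [RHS]mulrC; congr (_ * _); rewrite /P horner_sum.
  by apply: eq_bigr => i _; rewrite horner_exp hornerZ hornerX.
exists P.
  rewrite /P horner_sum big_ord_recl /= expr0 hornerC big1 ?addr0 // => i _.
  by rewrite horner_exp hornerZ hornerX mulr0 expr0n.
move=> z z1.
have az : normc (a * z) = r by rewrite Normc.normcM z1 mulr1.
have w0 : 1 - r <= normc (1 - a * z).
  have := normcD (1 - a * z) (a * z); rewrite subrK Normc.normc1 az; lra.
have wn0 : 1 - a * z != 0.
  by apply/eqP => h; move: w0; rewrite h Normc.normc0; lra.
have -> : (1 - a * z)^-1 - P.[z] = (a * z) ^+ n.+1 / (1 - a * z).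
  apply: (mulIf wn0); rewrite mulrBl PE mulVf // divfK //; ring.
rewrite Normc.normcM Normc.normcV normcX az ler_pdivrMr; last by lra.
apply: (@le_trans _ _ (r ^+ n)).
  rewrite exprS ler_piMl ?exprn_ge0 ?normc_ge0 //; lra.
by apply: (le_trans (ltW Hn)); rewrite ler_pM2l.
Qed.

Lemma holo_factor a : normc a < 1 -> holo (fun z => (z - a) / (1 - a^*%C * z)) (- a).
Proof.
move=> a1; rewrite -[X in holo _ X]mulr1; apply: holoM.
  by have := holoD holo_id (holo_cst (- a)); rewrite add0r.
by apply: holo_geometric; rewrite normc_conj.
Qed.
End DiscAlgebra.

(** * Averages over roots of unity *)

Section CircleMeans.
Variables (R : realType) (p : R).
Implicit Types (z w c : R[i]) (h k : R[i] -> R[i]) (P Q : {poly R[i]}) (e : R) (X Y : R[i] -> R).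
Local Notation cis := (@cis2pi R).
Local Notation normc := (@Normc.normc R).

(** The offset [p] makes the parameters run through [[p, p + 1[], the interval that the cylinders
    partition. *)
Definition sample (N i : nat) : R[i] := cis (p + i%:R / N%:R).

Lemma normc_sample N i : normc (sample N i) = 1.
Proof. exact: normc_cis2pi. Qed.

Definition avg N h : R[i] := N%:R^-1 * \sum_(i < N) h (sample N i).

Definition mean0 h := forall e, 0 < e -> \forall N \near \oo, normc (avg N h) <= e.

Lemma normc_avg N h (B : R) : (forall z, normc z = 1 -> normc (h z) <= B) ->
  0 <= B -> normc (avg N h) <= B.
Proof.
move=> hB B0; case: N => [|N]; first by rewrite /avg big_ord0 mulr0 Normc.normc0.
rewrite /avg Normc.normcM Normc.normcV.
have -> : normc N.+1%:R = N.+1%:R :> R.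
  by rewrite -(rmorph_nat (real_complex R)) normc_real ger0_norm ?ler0n.
rewrite mulrC ler_pdivrMr ?ltr0n //; apply: (le_trans (normc_sum _ _)).
apply: (@le_trans _ _ (\sum_(i < N.+1) B)).
  by apply: ler_sum => i _; apply: hB; exact: normc_sample.
by rewrite sumr_const card_ord mulr_natr.
Qed.

Lemma eq_avg N h k : (forall z, normc z = 1 -> h z = k z) -> avg N h = avg N k.
Proof.
by move=> hk; congr (_ * _); apply: eq_bigr => i _; rewrite hk // normc_sample.
Qed.

Lemma avgD N h k : avg N (fun z => h z + k z) = avg N h + avg N k.
Proof. by rewrite /avg big_split mulrDr. Qed.

Lemma avgZ N a h : avg N (fun z => a * h z) = a * avg N h.
Proof. by rewrite /avg -mulr_sumr mulrCA. Qed.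

Lemma mean0_ext h k : (forall z, normc z = 1 -> h z = k z) -> mean0 h -> mean0 k.
Proof.
move=> hk Hh e e0; have := Hh e e0; apply: filterS => N.
by rewrite (eq_avg _ hk).
Qed.

Lemma mean0_0 : mean0 (fun=> 0).
Proof.
move=> e e0; apply: nearW => N; apply: normc_avg; last exact: ltW.
by move=> z _; rewrite Normc.normc0 ltW.
Qed.

Lemma mean0D h k : mean0 h -> mean0 k -> mean0 (fun z => h z + k z).
Proof.
move=> Hh Hk e e0; have e2 : 0 < e / 2 by lra.
apply: (filterS _ (filterI (Hh _ e2) (Hk _ e2))) => N [h1 h2].
by rewrite avgD (le_trans (normcD _ _)) //; lra.
Qed.

Lemma mean0Z a h : mean0 h -> mean0 (fun z => a * h z).
Proof.
move=> Hh e e0; have a0 := normc_ge0 a.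
have e2 : 0 < e / (1 + normc a) by rewrite divr_gt0 //; lra.
have := Hh _ e2; apply: filterS => N h1; rewrite avgZ Normc.normcM.
apply: (@le_trans _ _ (normc a * (e / (1 + normc a)))); first by rewrite ler_wpM2l.
by rewrite mulrCA ler_piMr ?(ltW e0) // ler_pdivrMr; lra.
Qed.

Lemma mean0_sum (I : Type) (r : seq I) (F : I -> R[i] -> R[i]) :
  (forall i, mean0 (F i)) -> mean0 (fun z => \sum_(i <- r) F i z).
Proof.
move=> HF; elim: r => [|i r IH].
  by apply: (mean0_ext _ mean0_0) => z _; rewrite big_nil.
by apply: (mean0_ext _ (mean0D (HF i) IH)) => z _; rewrite big_cons.
Qed.

Lemma mean0_conj h : mean0 h -> mean0 (fun z => (h z)^*%C).
Proof.
move=> Hh e e0; have := Hh e e0; apply: filterS => N.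
rewrite -normc_conj /avg rmorphM rmorph_sum /=.
by rewrite conjc_inv rmorph_nat.
Qed.

Lemma mean0_limit h : (forall e, 0 < e ->
  exists2 k, mean0 k & forall z, normc z = 1 -> normc (h z - k z) <= e) -> mean0 h.
Proof.
move=> Hh e e0; have e2 : 0 < e / 2 by lra.
have [k mk hk] := Hh _ e2.
have := mk _ e2; apply: filterS => N h1.
have -> : avg N h = avg N k + avg N (fun z => h z - k z).
  by rewrite -avgD; apply: eq_avg => z _; rewrite addrC subrK.
rewrite (le_trans (normcD _ _)) //.
by have := normc_avg N hk (ltW e2); lra.
Qed.

Lemma avg_monomial N q : (0 < q < N)%N -> avg N (fun z => z ^+ q) = 0.
Proof.
move=> /andP[q0 qN]; rewrite /avg.
have N0 : (0 < N)%N by exact: leq_ltn_trans qN.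
have N0' : 0 < N%:R :> R by rewrite ltr0n.
pose w := cis (q%:R / N%:R).
have -> : \sum_(i < N) sample N i ^+ q = cis p ^+ q * \sum_(i < N) w ^+ i.
  rewrite mulr_sumr; apply: eq_bigr => i _.
  rewrite /sample /w -!cis2piMn -cis2piD; congr cis.
  rewrite mulrnDl; congr (_ + _).
  by rewrite -[LHS]mulr_natr -[RHS]mulr_natr; ring.
have wN : w ^+ N = 1.
  by rewrite /w -cis2piMn -[X in cis X]mulr_natr divfK ?gt_eqF // cis2pi_nat.
suff w1 : w != 1.
  have : (w - 1) * \sum_(i < N) w ^+ i = 0 by rewrite -subrX1 wN subrr.
  by move/eqP; rewrite mulf_eq0 subr_eq0 (negPf w1) /= => /eqP ->; rewrite !mulr0.
apply/eqP => /cis2pi_eq1[k kE].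
have q0' : 0 < q%:R / N%:R :> R by rewrite divr_gt0 // ltr0n.
have q1 : q%:R / N%:R < 1 :> R by rewrite ltr_pdivrMr // mul1r ltr_nat.
have k0 : k = 0 by apply: (@int_small R); rewrite -kE ltr_norml; lra.
by move: q0'; rewrite kE k0 ltxx.
Qed.

(** The mean value property: the average of a polynomial [P] over more than [size P] points is
    exactly [P.[0]], since the powers of a nontrivial root of unity sum to zero. *)
Lemma mean0_holo h : holo h 0 -> mean0 h.
Proof.
move=> Hh; apply: mean0_limit => e /Hh[P P0 HP]; exists (horner P) => // e' e'0.
exists (size P).+1 => // N /= PN.
rewrite (_ : avg N (horner P) = 0) ?Normc.normc0 ?(ltW e'0) //.
have -> : avg N (horner P) = avg N (fun z => \sum_(i < size P) P`_i * z ^+ i).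
  by apply: eq_avg => z _; rewrite horner_coef.
have -> : avg N (fun z => \sum_(i < size P) P`_i * z ^+ i) =
    \sum_(i < size P) P`_i * avg N (fun z => z ^+ i).
  rewrite /avg exchange_big /= mulr_sumr; apply: eq_bigr => i _.
  by rewrite -mulr_sumr mulrCA.
apply: big1 => i _; have [i0|i0] := posnP (i : nat).
  by rewrite i0 -horner_coef0 P0 mul0r.
by rewrite avg_monomial ?mulr0 // i0 /= (ltn_trans (ltn_ord i)).
Qed.

(* [z ^- n * P.[z]] is the general trigonometric polynomial. *)
Definition trig h := forall e, 0 < e -> exists n P,
  forall z, normc z = 1 -> normc (h z - z ^- n * P.[z]) <= e.

Lemma trig_holo h c : holo h c -> trig h.
Proof.
move=> Hh e /Hh[P _ HP]; exists 0%N, P => z z1.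
by rewrite expr0 invr1 mul1r HP.
Qed.

Lemma trig_ext h k : (forall z, normc z = 1 -> h z = k z) -> trig h -> trig k.
Proof. by move=> hk Hh e /Hh[n [P HP]]; exists n, P => z z1; rewrite -hk ?HP. Qed.

Lemma circle_neq0 z : normc z = 1 -> z != 0.
Proof.
move=> z1; apply/eqP => h; move: z1; rewrite h Normc.normc0 => /eqP.
by rewrite eq_sym oner_eq0.
Qed.

(** On the circle [conj z = 1 / z], so the conjugate of a polynomial is its reversed conjugate
    polynomial divided by a power of [z]. *)
Lemma trig_conj_holo h c : holo h c -> trig (fun z => (h z)^*%C).
Proof.
move=> Hh e /Hh[P _ HP].
exists (size P), (\sum_(i < size P) (P`_i)^*%C *: 'X^(size P - i)) => z z1.
have z0 := circle_neq0 z1.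
have -> : z ^- size P * (\sum_(i < size P) (P`_i)^*%C *: 'X^(size P - i)).[z] =
    (P.[z])^*%C.
  rewrite horner_sum mulr_sumr horner_coef rmorph_sum /=; apply: eq_bigr => i _.
  rewrite hornerZ hornerXn rmorphM rmorphXn /= (conjc_unit z1) mulrCA; congr (_ * _).
  rewrite -[in z ^- _](subnK (ltnW (ltn_ord i))) exprD invfM mulrAC mulVf ?mul1r ?exprVn //.
  by rewrite expf_neq0.
by rewrite -rmorphB normc_conj HP.
Qed.

Lemma trigD h k : trig h -> trig k -> trig (fun z => h z + k z).
Proof.
move=> Hh Hk e e0; have e2 : 0 < e / 2 by lra.
have [n [P HP]] := Hh _ e2; have [l [Q HQ]] := Hk _ e2.
exists (n + l)%N, ('X^l * P + 'X^n * Q) => z z1.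
have z0 := circle_neq0 z1.
have -> : z ^- (n + l) * ('X^l * P + 'X^n * Q).[z] = z ^- n * P.[z] + z ^- l * Q.[z].
  rewrite hornerD !hornerM !hornerXn exprD invfM.
  by field; rewrite !expf_neq0.
rewrite opprD addrACA (le_trans (normcD _ _)) //.
by have := HP z z1; have := HQ z z1; lra.
Qed.

Lemma trig_bounded h : trig h -> bounded_on_circle h.
Proof.
move=> /(_ 1 ltr01)[n [P HP]]; have [B B0 HB] := horner_bounded P.
exists (1 + B); first by lra.
move=> z z1; rewrite -[h z](subrK (z ^- n * P.[z])) (le_trans (normcD _ _)) //.
by rewrite lerD ?HP // Normc.normcM Normc.normcV normcX z1 expr1n invr1 mul1r HB.
Qed.

Lemma trigM h k : trig h -> trig k -> trig (fun z => h z * k z).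
Proof.
move=> Hh Hk e e0; have [B B0 HB] := trig_bounded Hk.
have e1 : 0 < e / (2 * B) by rewrite divr_gt0 ?mulr_gt0.
have [n [P HP]] := Hh _ e1; have [D D0 HD] := horner_bounded P.
have e2 : 0 < e / (2 * D) by rewrite divr_gt0 ?mulr_gt0.
have [l [Q HQ]] := Hk _ e2.
exists (n + l)%N, (P * Q) => z z1; rewrite hornerM exprD invfM.
have -> : h z * k z - z ^- n / z ^+ l * (P.[z] * Q.[z]) =
    (h z - z ^- n * P.[z]) * k z + z ^- n * P.[z] * (k z - z ^- l * Q.[z]).
  by ring.
apply: (le_trans (normcD _ _)); rewrite !Normc.normcM Normc.normcV normcX z1 expr1n invr1 mul1r.
have -> : e = e / (2 * B) * B + D * (e / (2 * D)) by field; rewrite !gt_eqF.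
by rewrite lerD // ler_pM ?normc_ge0 ?HP ?HB ?HD ?HQ.
Qed.

Lemma trigX h n : trig h -> trig (fun z => h z ^+ n).
Proof.
move=> Hh; elim: n => [|n IH]; first exact: trig_holo (holo_cst 1).
by apply: (trig_ext _ (trigM Hh IH)) => z _; rewrite exprS.
Qed.

Lemma trig_Re h c : holo h c -> trig (fun z => (complex.Re (h z))%:C%C).
Proof.
move=> Hh; have := trigM (trig_holo (holo_cst 2^-1)) (trigD (trig_holo Hh) (trig_conj_holo Hh)).
by apply: trig_ext => z _; rewrite ReJ_add mulrC.
Qed.

Lemma trig_sum (I : Type) (r : seq I) (F : I -> R[i] -> R[i]) :
  (forall i, trig (F i)) -> trig (fun z => \sum_(i <- r) F i z).
Proof.
move=> HF; elim: r => [|i r IH].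
  by apply: (trig_ext _ (trig_holo (holo_cst 0))) => z _; rewrite big_nil.
by apply: (trig_ext _ (trigD (HF i) IH)) => z _; rewrite big_cons.
Qed.

End CircleMeans.

(** * Moments of sums of iterates *)

Section ReversedMartingale.
Variables (R : realType) (p : R) (f F : R[i] -> R[i]) (b : R[i]).
Local Notation cis := (@cis2pi R).
Local Notation normc := (@Normc.normc R).
Local Notation Re := (@complex.Re R).
Hypothesis F_holo : holo F b.
Hypothesis fE : forall z, normc z = 1 -> f z = z * F z.
Hypothesis f_circle : forall z, normc z = 1 -> normc (f z) = 1.
Hypothesis b_lt1 : normc b < 1.
Implicit Types (z w : R[i]) (h : R[i] -> R[i]) (X Y : R[i] -> R) (e : R).

Lemma iter_circle k z : normc z = 1 -> normc (iter k f z) = 1.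
Proof. by move=> z1; elim: k => //= k IH; exact: f_circle. Qed.

Lemma iter_holo k : holo (iter k f) 0.
Proof.
elim: k => [|k IH]; first exact: holo_id.
have := holoM IH (holo_comp F_holo IH (iter_circle k)); rewrite mul0r.
by apply: holo_ext => z z1; rewrite iterS fE // iter_circle.
Qed.

(* Since [b = f'(0)], [conj b * iter k.+1 f] is the conditional expectation of
   [iter k f] given [iter k.+1 f]. *)
Definition incr k z := iter k f z - b^*%C * iter k.+1 f z.

(** For [n <= j] the product is holomorphic and vanishes at the origin. For [n = j + r + 1] its
    conjugate is holomorphic: as [iter k.+1 f] is [iter k f] times [F (iter k f)], it is the
    function [B] of the proof. At the origin [B] vanishes for [r > 0] because the iterates do, and
    for [r = 0] because [F] takes the value [b] there. *)
Lemma incr_monomial k n j :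
  mean0 p (fun z => incr k z * (iter k.+1 f z ^- n * iter k.+1 f z ^+ j)).
Proof.
have kS := iter_holo k.+1; have k0 := iter_holo k.
have bE z : normc z = 1 -> iter k.+1 f z = iter k f z * F (iter k f z).
  by move=> z1; rewrite iterS fE // iter_circle.
have [nj|jn] := leqP n j.
  apply: mean0_holo; rewrite -(mul0r (0 ^+ (j - n))).
  have inc0 : holo (incr k) 0.
    by have := holoD k0 (holoZ (- b^*%C) kS); rewrite mulr0 addr0; apply: holo_ext
       => z _; rewrite mulNr.
  apply: (holo_ext _ (holoM inc0 (holoX (j - n) kS))) => z z1; congr (_ * _).
  rewrite -[in iter k.+1 f z ^+ j](subnK nj) exprD mulrCA mulVf ?mulr1 //.
  by rewrite expf_neq0 // circle_neq0 // iter_circle.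
have [r nE] : exists r, n = (r.+1 + j)%N by exists (n - j).-1; lia.
pose B z := iter k f z ^+ r * F (iter k f z) ^+ r.+1 - b * iter k.+1 f z ^+ r.
have HB : holo B 0.
  have := holoD (holoM (holoX r k0) (holoX r.+1 (holo_comp F_holo k0 (iter_circle k))))
    (holoZ (- b) (holoX r kS)).
  have -> : 0 ^+ r * b ^+ r.+1 + - b * 0 ^+ r = 0 :> R[i].
    case: r {nE B} => [|r]; first by rewrite !expr0 mul1r mulr1 expr1 subrr.
    by rewrite expr0n /= mul0r mulr0 addr0.
  by apply: holo_ext => z _; rewrite mulNr.
apply: (mean0_ext _ (mean0_conj (mean0_holo p HB))) => z z1.
have c1 := iter_circle k z1; have c2 := iter_circle k.+1 z1.
have n1 := circle_neq0 c1; have n2 := circle_neq0 c2.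
rewrite /B rmorphB !rmorphM !rmorphXn /= -/(iter k.+1 f z) nE exprD invfM.
rewrite -mulrA mulVf ?expf_neq0 // mulr1 /incr mulrBl.
have -> : (F (iter k f z))^*%C = iter k f z / iter k.+1 f z.
  rewrite bE // in c2 n2 *; have nF : normc (F (iter k f z)) = 1.
    by move: c2; rewrite Normc.normcM c1 mul1r.
  rewrite (conjc_unit nF); field.
  by rewrite n1 (circle_neq0 nF).
rewrite (conjc_unit c1) (conjc_unit c2) !exprVn; congr (_ - _).
  by rewrite expr_div_n !exprS; field; rewrite ?n1 ?n2 ?expf_neq0.
by rewrite exprS; field; rewrite ?n1 ?n2 ?expf_neq0.
Qed.

Lemma normc_incr k z : normc z = 1 -> normc (incr k z) <= 2.
Proof.
move=> z1; rewrite (le_trans (normcB _ _)) // Normc.normcM normc_conj.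
rewrite !iter_circle // mulr1; have := b_lt1; lra.
Qed.

Lemma incr_orth k h : trig h -> mean0 p (fun z => incr k z * h (iter k.+1 f z)).
Proof.
move=> Hh; apply: mean0_limit => e e0; have e2 : 0 < e / 2 by lra.
have [n [P HP]] := Hh _ e2.
exists (fun z => \sum_(j < size P) P`_j *
    (incr k z * (iter k.+1 f z ^- n * iter k.+1 f z ^+ j))).
  by apply: mean0_sum => j; apply: mean0Z; exact: incr_monomial.
move=> z z1.
have -> : \sum_(j < size P) P`_j * (incr k z * (iter k.+1 f z ^- n * iter k.+1 f z ^+ j)) =
    incr k z * (iter k.+1 f z ^- n * P.[iter k.+1 f z]).
  rewrite horner_coef !mulr_sumr; apply: eq_bigr => j _.
  by rewrite mulrCA; congr (_ * _); rewrite mulrCA.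
rewrite -mulrBr Normc.normcM.
have := HP _ (iter_circle k.+1 z1); have := normc_incr k z1.
move=> h1 h2; rewrite (_ : e = 2 * (e / 2)); last by field.
by apply: ler_pM => //; exact: normc_ge0.
Qed.

Definition avgR N X : R := N%:R^-1 * \sum_(i < N) X (sample p N i).

Definition rmean0 X := forall e, 0 < e -> \forall N \near \oo, `|avgR N X| <= e.

Lemma Re_avg N h : Re (avg p N h) = avgR N (fun z => Re (h z)).
Proof.
rewrite /avg /avgR.
have -> : N%:R^-1 = (N%:R^-1 : R)%:C%C by rewrite fmorphV rmorph_nat.
have -> : Re ((N%:R^-1 : R)%:C%C * \sum_(i < N) h (sample p N i)) =
    N%:R^-1 * Re (\sum_(i < N) h (sample p N i)).
  by case: (\sum_(_ < _) _) => a c /=; rewrite mul0r subr0.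
congr (_ * _).
elim: (index_enum _) => [|i r IH]; rewrite ?big_nil // !big_cons -IH.
by case: (h _) => a c; case: (\sum_(_ <- _) _).
Qed.

Lemma normr_Re z : `|Re z| <= normc z.
Proof. by have := normc_ge_Re z; rewrite normcE lecR. Qed.

Lemma rmean0_Re h : mean0 p h -> rmean0 (fun z => Re (h z)).
Proof.
move=> Hh e e0; have := Hh e e0; apply: filterS => N.
by rewrite -Re_avg; apply: le_trans (normr_Re _).
Qed.

Lemma avgRD N X Y : avgR N (fun z => X z + Y z) = avgR N X + avgR N Y.
Proof. by rewrite /avgR big_split mulrDr. Qed.

Lemma avgRZ N a X : avgR N (fun z => a * X z) = a * avgR N X.
Proof. by rewrite /avgR -mulr_sumr mulrCA. Qed.

Lemma avgR_le N X Y : (forall z, normc z = 1 -> X z <= Y z) -> avgR N X <= avgR N Y.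
Proof.
move=> XY; rewrite ler_wpM2l ?invr_ge0 ?ler0n //.
by apply: ler_sum => i _; apply: XY; exact: normc_sample.
Qed.

Lemma eq_avgR N X Y : (forall z, normc z = 1 -> X z = Y z) -> avgR N X = avgR N Y.
Proof. by move=> XY; apply/eqP; rewrite eq_le !avgR_le // => z z1; rewrite XY. Qed.

Lemma avgR_cst N a : (0 < N)%N -> avgR N (fun=> a) = a.
Proof.
move=> N0; rewrite /avgR sumr_const card_ord -[a *+ N]mulr_natl mulKf //.
by rewrite pnatr_eq0 -lt0n.
Qed.

Lemma rmean0_ext X Y : (forall z, normc z = 1 -> X z = Y z) -> rmean0 X -> rmean0 Y.
Proof.
move=> hk Hh e e0; have := Hh e e0; apply: filterS => N.
by rewrite (eq_avgR _ hk).
Qed.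

Lemma Re_mul_real z (a : R) : Re (z * a%:C%C) = Re z * a.
Proof. by case: z => x y /=; rewrite mulr0 subr0. Qed.

Lemma Re_sqr z : Re z ^+ 2 = 2^-1 * (normc z ^+ 2 + Re (z ^+ 2)).
Proof.
case: z => x y; rewrite [normc _]/= sqr_sqrtr ?addr_ge0 ?sqr_ge0 //= .
by field.
Qed.

Variables (N : nat) (v : nat -> R[i]) (w : R[i]).

Definition term k z := Re (v k * incr k z).
Definition tail k z := \sum_(k <= l < N) term l z + Re (w * iter N f z).

Lemma tailS k z : (k < N)%N -> tail k z = term k z + tail k.+1 z.
Proof. by move=> kN; rewrite /tail big_ltn // addrA. Qed.

Lemma term_le k z : normc z = 1 -> `|term k z| <= 2 * normc (v k).
Proof.
move=> z1; apply: le_trans (normr_Re _) _.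
by rewrite Normc.normcM mulrC ler_wpM2r ?normc_ge0 // normc_incr.
Qed.

(** The sum from index [k] on is a function of [iter k f] alone, as orthogonality to the preceding
    increment requires. *)
Lemma tail_trig k : (k <= N)%N -> exists2 h, trig h &
  forall z, (tail k z)%:C%C = h (iter k f z).
Proof.
move=> kN.
exists (fun z => \sum_(0 <= l < N - k) (Re (v (l + k)%N * incr l z))%:C%C +
          (Re (w * iter (N - k) f z))%:C%C).
  apply: trigD.
    apply: trig_sum => l; apply: trig_Re; apply: holoZ.
    by apply: (holo_ext _ (holoD (iter_holo l) (holoZ (- b^*%C) (iter_holo l.+1)))) => z _;
      rewrite mulNr.
  by apply: trig_Re; apply: holoZ; exact: iter_holo.
move=> z; rewrite /tail rmorphD rmorph_sum /=; congr (_ + _); last first.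
  by rewrite -iterD subnK.
rewrite -{1}[k]add0n big_addn; apply: eq_bigr => l _.
by rewrite /term /incr -!iterD addSn.
Qed.

Lemma term_tail_orth k r : (k < N)%N -> rmean0 (fun z => term k z * tail k.+1 z ^+ r).
Proof.
move=> kN; have [h Hh hE] := tail_trig kN.
have := rmean0_Re (mean0Z (v k) (incr_orth k (trigX r Hh))).
apply: rmean0_ext => z z1; rewrite -hE -rmorphXn mulrA Re_mul_real.
by [].
Qed.

Definition sig : R := (1 - normc b ^+ 2) / 2.

(** On the circle [|incr|^2 = 1 + |b|^2 - 2 Re (conj b * F (iter k f))], of mean [1 - |b|^2]. Taking
    the real part of [v k * incr k] halves it, since the square of a holomorphic function vanishing
    at the origin has mean zero. *)
Lemma term_sqr_mean k : rmean0 (fun z => term k z ^+ 2 - sig * normc (v k) ^+ 2).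
Proof.
have k0 := iter_holo k; have kS := iter_holo k.+1.
have Fk := holo_comp F_holo k0 (iter_circle k).
have inc0 : holo (incr k) 0.
  by have := holoD k0 (holoZ (- b^*%C) kS); rewrite mulr0 addr0; apply: holo_ext
     => z _; rewrite mulNr.
have h1 : holo (fun z => 2^-1 * (v k * incr k z) ^+ 2 +
    - (normc (v k) ^+ 2)%:C%C * b^*%C * (F (iter k f z) - b)) 0.
  have e1 := holoZ 2^-1 (holoX 2 (holoZ (v k) inc0)).
  have e2 := holoZ (- (normc (v k) ^+ 2)%:C%C * b^*%C) (holoD Fk (holo_cst (- b))).
  have := holoD e1 e2.
  by rewrite !mulr0 expr0n mulr0 subrr mulr0 addr0.
apply: (rmean0_ext _ (rmean0_Re (mean0_holo p h1))) => z z1.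
have c1 := iter_circle k z1; have c2 := iter_circle k.+1 z1.
have Fc : normc (F (iter k f z)) = 1.
  by move: c2; rewrite iterS fE // Normc.normcM c1 mul1r.
rewrite /term Re_sqr Normc.normcM [(normc _ * normc _) ^+ 2]exprMn.
have -> : normc (incr k z) ^+ 2 = 1 + normc b ^+ 2 - 2 * Re (b^*%C * F (iter k f z)).
  have -> : incr k z = iter k f z * (1 - b^*%C * F (iter k f z)).
    by rewrite /incr iterS fE //; ring.
  rewrite Normc.normcM c1 mul1r.
  move: Fc; case: (F _) => x y; case: (b) => b1 b2 /= Fc.
  rewrite !sqr_sqrtr ?addr_ge0 ?sqr_ge0 //.
  have {}Fc : x ^+ 2 = 1 - y ^+ 2.
    have : Num.sqrt (x ^+ 2 + y ^+ 2) ^+ 2 = 1 by rewrite Fc expr1n.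
    rewrite sqr_sqrtr ?addr_ge0 ?sqr_ge0 //; lra.
  by ring: Fc.
have bb : b^*%C * b = (normc b ^+ 2)%:C%C by rewrite mulrC mul_conjc.
have -> : - (normc (v k) ^+ 2)%:C%C * b^*%C * (F (iter k f z) - b) =
    - (normc (v k) ^+ 2)%:C%C * (b^*%C * F (iter k f z) - (normc b ^+ 2)%:C%C).
  by rewrite -bb; ring.
rewrite /sig.
move: (normc (v k)) (normc b) => V B.
case: ((v k * _) ^+ 2) => q1 q2; case: (b) => b1 b2; case: (F _) => x y /=.
by simpc; rewrite /=; field.
Qed.

Definition sumsq k : R := \sum_(k <= l < N) normc (v l) ^+ 2.

Lemma sumsqS k : (k < N)%N -> sumsq k = normc (v k) ^+ 2 + sumsq k.+1.
Proof. by move=> kN; rewrite /sumsq big_ltn. Qed.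

Lemma sumsq_ge0 k : 0 <= sumsq k.
Proof. by apply: sumr_ge0 => l _; exact: sqr_ge0. Qed.

Lemma downward_ind (Q : nat -> Prop) :
  Q N -> (forall k, (k < N)%N -> Q k.+1 -> Q k) -> forall k, (k <= N)%N -> Q k.
Proof.
move=> QN QS k kN; rewrite -(subKn kN); have : (N - k <= N)%N by exact: leq_subr.
elim: (N - k)%N => [|j IH] jN; first by rewrite subn0.
apply: QS; first by rewrite ltn_subrL //= (leq_ltn_trans _ jN).
by rewrite -subSn // subSS; apply: IH; exact: ltnW.
Qed.

Lemma tail_last z : tail N z = Re (w * iter N f z).
Proof. by rewrite /tail big_geq // add0r. Qed.

Lemma tail_last_le z : normc z = 1 -> `|tail N z| <= normc w.
Proof.
move=> z1; rewrite tail_last (le_trans (normr_Re _)) // Normc.normcM.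
by rewrite iter_circle // mulr1.
Qed.

Lemma mean_tail k : (k <= N)%N -> rmean0 (tail k).
Proof.
move: k; apply: downward_ind => [|k kN IH].
  apply: (rmean0_ext _ (rmean0_Re (mean0_holo p _))) => [z _|].
    by rewrite tail_last.
  by have := holoZ w (iter_holo N); rewrite mulr0; apply.
move=> e e0; have e2 : 0 < e / 2 by lra.
have orth := term_tail_orth 0 kN.
apply: (filterS _ (filterI (IH _ e2) (orth _ e2))) => n [h1 h2].
rewrite (@eq_avgR n (tail k) (fun z => term k z * tail k.+1 z ^+ 0 + tail k.+1 z)).
  by rewrite avgRD (le_trans (ler_normD _ _)) //; lra.
by move=> z _; rewrite expr0 mulr1 tailS.
Qed.

(** The cross term averages to zero, so second moments add up, going down from [N]. The constant [4]
    is the square of the bound [2] on the increments. *)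
Lemma second_moment k : (k <= N)%N -> forall e, 0 < e -> \forall n \near \oo,
  sig * sumsq k - e <= avgR n (fun z => tail k z ^+ 2) <= 4 * (sumsq k + normc w ^+ 2) + e.
Proof.
move: k; apply: downward_ind => [|k kN IH] e e0.
  near=> n; have n0 : (0 < n)%N by near: n; exists 1%N.
  rewrite /sumsq big_geq // mulr0; apply/andP; split.
    rewrite (@le_trans _ _ 0) //; first by lra.
    rewrite -(avgR_cst 0 n0); apply: avgR_le => z _; exact: sqr_ge0.
  apply: (@le_trans _ _ (normc w ^+ 2)); last by have := sqr_ge0 (normc w); lra.
  rewrite -(avgR_cst (normc w ^+ 2) n0); apply: avgR_le => z z1.
  rewrite -(real_normK (num_real (tail N z))).
  by rewrite ler_pXn2r ?nnegrE ?normc_ge0 // tail_last_le.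
have e4 : 0 < e / 4 by lra.
have orth := term_tail_orth 1 kN.
near=> n; have n0 : (0 < n)%N by near: n; exists 1%N.
have h1 : `|avgR n (fun z => term k z * tail k.+1 z ^+ 1)| <= e / 4.
  by near: n; exact: orth.
have h2 : `|avgR n (fun z => term k z ^+ 2 - sig * normc (v k) ^+ 2)| <= e / 4.
  by near: n; exact: term_sqr_mean.
have h3 : sig * sumsq k.+1 - e / 4 <= avgR n (fun z => tail k.+1 z ^+ 2)
    <= 4 * (sumsq k.+1 + normc w ^+ 2) + e / 4.
  by near: n; exact: IH.
have h4 : avgR n (fun z => term k z ^+ 2) <= 4 * normc (v k) ^+ 2.
  rewrite -(avgR_cst (4 * normc (v k) ^+ 2) n0); apply: avgR_le => z z1.
  rewrite -(real_normK (num_real (term k z))) (_ : 4 * _ = (2 * normc (v k)) ^+ 2).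
    by rewrite ler_pXn2r ?nnegrE ?mulr_ge0 ?normc_ge0 // term_le.
  by ring.
have E1 : avgR n (fun z => tail k z ^+ 2) =
    avgR n (fun z => term k z ^+ 2) + (2 * avgR n (fun z => term k z * tail k.+1 z ^+ 1)
    + avgR n (fun z => tail k.+1 z ^+ 2)).
  rewrite -avgRZ -!avgRD; apply: eq_avgR => z _; rewrite tailS //; ring.
have E2 : avgR n (fun z => term k z ^+ 2 - sig * normc (v k) ^+ 2) =
    avgR n (fun z => term k z ^+ 2) - sig * normc (v k) ^+ 2.
  by rewrite avgRD avgR_cst.
rewrite E1 sumsqS //; move: h1 h2 h3; rewrite E2 !ler_norml.
move=> /andP[? ?] /andP[? ?] /andP[? ?]; apply/andP; split; lra.
Unshelve. all: by end_near. Qed.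

(** In [(x + y)^4], with [x] the term and [y] the following tail, [4 x y^3] averages to zero. From
    [2 x^2 (x - y)^2 >= 0], the terms other than it and [y^4] are at most [8 x^2 y^2 + 3 x^4]. The
    constant is stable under the recursion because [64 T^2 + 128 V T + 48 V^2 <= 64 (T + V)^2]. *)
Lemma fourth_moment k : (k <= N)%N -> forall e, 0 < e -> \forall n \near \oo,
  avgR n (fun z => tail k z ^+ 4) <= 64 * (sumsq k + normc w ^+ 2) ^+ 2 + e.
Proof.
move: k; apply: downward_ind => [|k kN IH] e e0.
  near=> n; have n0 : (0 < n)%N by near: n; exists 1%N.
  rewrite /sumsq big_geq // add0r.
  apply: (@le_trans _ _ (normc w ^+ 4)).
    rewrite -(avgR_cst (normc w ^+ 4) n0); apply: avgR_le => z z1.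
    rewrite -[4%N]/(2 * 2)%N !exprM -(real_normK (num_real (tail N z))) -!exprM.
    by rewrite ler_pXn2r ?nnegrE ?normc_ge0 // tail_last_le.
  by rewrite -exprM; have := exprn_ge0 4 (normc_ge0 w); lra.
set V := normc (v k) ^+ 2; have V0 : 0 <= V by exact: sqr_ge0.
(* The errors are [e'] for the fourth moment, [4 e'] for the cross term and [32 V e'] for the second
   moment. *)
pose e' := e / (5 + 32 * V).
have e'0 : 0 < e' by rewrite divr_gt0 //; lra.
have orth := term_tail_orth 3 kN.
near=> n; have n0 : (0 < n)%N by near: n; exists 1%N.
have h1 : `|avgR n (fun z => term k z * tail k.+1 z ^+ 3)| <= e'.
  by near: n; exact: orth.
have h2 : avgR n (fun z => tail k.+1 z ^+ 4) <=
    64 * (sumsq k.+1 + normc w ^+ 2) ^+ 2 + e'.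
  by near: n; exact: IH.
have h3 : avgR n (fun z => tail k.+1 z ^+ 2) <= 4 * (sumsq k.+1 + normc w ^+ 2) + e'.
  near: n; apply: (filterS _ (second_moment (k := k.+1) kN e'0)) => n /andP[_].
  by [].
have h4 : avgR n (fun z => tail k z ^+ 4) <=
    avgR n (fun z => tail k.+1 z ^+ 4) + (4 * avgR n (fun z => term k z * tail k.+1 z ^+ 3)
    + (32 * V * avgR n (fun z => tail k.+1 z ^+ 2) + 48 * V ^+ 2)).
  rewrite -!avgRZ -[48 * V ^+ 2](avgR_cst _ n0) -!avgRD; apply: avgR_le => z z1.
  rewrite tailS //; move: (term_le k z1); move: (term k z) (tail k.+1 z) => x y xV.
  have x2 : x ^+ 2 <= 4 * V.
    rewrite -(real_normK (num_real x)) (_ : 4 * V = (2 * normc (v k)) ^+ 2).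
      by rewrite ler_pXn2r ?nnegrE ?mulr_ge0 ?normc_ge0.
    by rewrite /V; ring.
  have x20 := sqr_ge0 x; have y20 := sqr_ge0 y.
  have x4 : x ^+ 2 * x ^+ 2 <= 4 * V * (4 * V) by apply: ler_pM.
  have xy : x ^+ 2 * y ^+ 2 <= 4 * V * y ^+ 2 by apply: ler_wpM2r.
  have := mulr_ge0 x20 (sqr_ge0 (x - y)).
  rewrite -subr_ge0 => h; rewrite -subr_ge0.
  have -> : y ^+ 4 + (4 * (x * y ^+ 3) + (32 * V * y ^+ 2 + 48 * V ^+ 2)) - (x + y) ^+ 4 =
    2 * (x ^+ 2 * (x - y) ^+ 2 - 0) + 8 * (4 * V * y ^+ 2 - x ^+ 2 * y ^+ 2)
    + 3 * (4 * V * (4 * V) - x ^+ 2 * x ^+ 2) by ring.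
  by rewrite !addr_ge0 // mulr_ge0 // subr_ge0.
apply: (le_trans h4); rewrite sumsqS // -/V.
set T := sumsq k.+1 + normc w ^+ 2.
have T0 : 0 <= T by rewrite addr_ge0 ?sumsq_ge0 ?sqr_ge0.
have -> : V + sumsq k.+1 + normc w ^+ 2 = V + T by rewrite addrA.
have eE : e = e' * (5 + 32 * V) by rewrite /e' divfK // gt_eqF //; lra.
have h5 := ler_wpM2l V0 h3; rewrite -/T in h3 h5 h2.
have VV : 0 <= V * V by exact: mulr_ge0.
move: h1; rewrite ler_norml => /andP[_ h1].
rewrite eE; lra.
Unshelve. all: by end_near. Qed.

End ReversedMartingale.

(** * Block sums large in a given direction *)

Section LargeBlocks.
Variables (R : realType) (p : R) (f F : R[i] -> R[i]) (b : R[i]).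
Local Notation cis := (@cis2pi R).
Local Notation normc := (@Normc.normc R).
Local Notation Re := (@complex.Re R).
Hypothesis F_holo : holo F b.
Hypothesis fE : forall z, normc z = 1 -> f z = z * F z.
Hypothesis f_circle : forall z, normc z = 1 -> normc (f z) = 1.
Hypothesis b_lt1 : normc b < 1.
Implicit Types (z w u : R[i]) (X : R[i] -> R) (e : R).

(* A polynomial minorant of the indicator function of a half-line: it turns
   bounds on the moments of order 1, 2, 4 into a lower bound on a probability. *)
Lemma quartic_minorant (s del x : R) : 1 <= s -> 0 < del <= 1 ->
  s * x + x ^+ 2 - x ^+ 4 / s ^+ 2 - del <=
  6 * s ^+ 2 * (del / (s + 1) <= x)%R%:R.
Proof.
move=> s1 /andP[d0 d1]; have s0 : 0 < s by lra.
have s20 : 0 < s ^+ 2 by rewrite exprn_gt0.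
have x20 := sqr_ge0 x.
have large c : 0 <= c -> c * s ^+ 2 <= x ^+ 2 -> c * x ^+ 2 <= x ^+ 4 / s ^+ 2.
  move=> c0 h; rewrite ler_pdivlMr // mulrAC -[4%N]/(2 + 2)%N exprD.
  by rewrite ler_wpM2r.
have q0 : 0 <= x ^+ 4 / s ^+ 2 by rewrite divr_ge0 ?(ltW s20) // -[4%N]/(2 * 2)%N exprM sqr_ge0.
move: (x ^+ 4 / s ^+ 2) q0 large => q q0 large.
have [x0|x0] := leP x 0.
  apply: (@le_trans _ _ 0); last by rewrite mulr_ge0 ?ler0n // mulr_ge0 // ltW.
  have sx : s * x <= 0 by rewrite mulr_ge0_le0 // ltW.
  have [h|h] := leP (s ^+ 2) (x ^+ 2).
    by have := large 1 ler01; rewrite !mul1r => /(_ h); lra.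
  have : - x <= s.
    rewrite -(@ler_pXn2r _ 2) ?nnegrE ?(ltW s0) ?oppr_ge0 // sqrrN.
    exact: ltW.
  move=> xs; have : x * (x + s) <= 0 by rewrite mulr_le0_ge0 //; lra.
  lra.
have [xt|xt] := leP (del / (s + 1)) x; last first.
  rewrite mulr0; have xd : x * (s + 1) < del by rewrite -ltr_pdivlMr //; lra.
  have xs : 0 < x * s by rewrite mulr_gt0.
  have : x * x <= x * 1 by rewrite ler_pM2l //; lra.
  lra.
rewrite mulr1; have [h|h] := leP x (2 * s).
  have : s * x <= s * (2 * s) by rewrite ler_pM2l.
  have : x * x <= 2 * s * (2 * s) by apply: ler_pM => //; exact: ltW.
  lra.
have h1 : s * x <= x * x by rewrite ler_pM2r //; lra.
have h2 : 2 * s * (2 * s) <= x * x by apply: ler_pM; lra.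
have h3 : 4 * x ^+ 2 <= q by apply: large; lra.
lra.
Qed.

Lemma sig_gt0 : 0 < sig b.
Proof.
have b1 := b_lt1; have := normc_ge0 b; rewrite /sig => b0.
by rewrite divr_gt0 // subr_gt0 expr_lt1.
Qed.

(** Constants of a Paley-Zygmund inequality. The scale is such that the fourth moment costs little
    more than half of the second moment [sig b]. With the loss [sig b / 4] that fixes the level, and
    small errors, more than [sig b / 8] is left; dividing it by the factor [6 * pz_scale ^ 2] of
    [quartic_minorant] yields [pz_proba]. *)
Definition pz_scale : R := Num.sqrt (2 ^+ 9 / sig b).
Definition pz_level : R := sig b / 4 / (pz_scale + 1).
Definition pz_proba : R := sig b / (48 * pz_scale ^+ 2).

Lemma pz_scaleE : pz_scale ^+ 2 = 2 ^+ 9 / sig b.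
Proof. by rewrite sqr_sqrtr // ltW // divr_gt0 ?exprn_gt0 // sig_gt0. Qed.

Lemma pz_scale_ge1 : 1 <= pz_scale.
Proof.
rewrite -(@ler_pXn2r _ 2) ?nnegrE ?sqrtr_ge0 // pz_scaleE expr1n.
have s0 := sig_gt0; have := sqr_ge0 (normc b).
by rewrite ler_pdivlMr // mul1r /sig; lra.
Qed.

Lemma pz_level_gt0 : 0 < pz_level.
Proof.
have s1 := pz_scale_ge1; rewrite /pz_level divr_gt0 //.
  by rewrite divr_gt0 // sig_gt0.
by lra.
Qed.

Lemma pz_proba_gt0 : 0 < pz_proba.
Proof.
have s1 := pz_scale_ge1; rewrite /pz_proba divr_gt0 ?sig_gt0 // mulr_gt0 //.
by rewrite exprn_gt0 //; lra.
Qed.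

Lemma tail_large N v w : 0 < sumsq N v 0 -> normc w ^+ 2 <= sumsq N v 0 ->
  \forall n \near \oo, pz_proba <=
    avgR p n (fun z => (pz_level * Num.sqrt (sumsq N v 0) <= tail f b N v w 0 z)%R%:R).
Proof.
set A2 := sumsq N v 0 => A20 wA; set A := Num.sqrt A2; set X := tail f b N v w 0.
have A0 : 0 < A by rewrite sqrtr_gt0.
have AE : A ^+ 2 = A2 by rewrite sqr_sqrtr // ltW.
have A4E : A ^+ 4 = A2 ^+ 2 by rewrite -AE -exprM.
have s1 := pz_scale_ge1; set s := pz_scale in s1 *; have s0 : 0 < s by lra.
have sg0 := sig_gt0; set sg := sig b in sg0 *.
have s2E : s ^+ 2 = 2 ^+ 9 / sg := pz_scaleE.
have sg4 : 0 < sg / 4 <= 1 by have := sqr_ge0 (normc b); rewrite {2}/sg /sig; lra.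
(* One tolerance for each of the moments of order 1, 2 and 4, in units of the size [A] of the
   block. *)
pose e := Num.min (sg * A / (32 * s)) (Num.min (sg * A2 / 32) (A2 ^+ 2)).
have A220 : 0 < A2 ^+ 2 by rewrite exprn_gt0.
have e0 : 0 < e.
  rewrite /e !lt_min A220 andbT; apply/andP; split.
    by rewrite divr_gt0 // mulr_gt0.
  by rewrite divr_gt0 // mulr_gt0.
have [e1 e2 e3] : [/\ e <= sg * A / (32 * s), e <= sg * A2 / 32 & e <= A2 ^+ 2].
  by rewrite /e; split; rewrite ?ge_min ?lexx ?orbT.
near=> n; have n0 : (0 < n)%N by near: n; exists 1%N.
have h1 : `|avgR p n X| <= e.
  by near: n; exact: (mean_tail p F_holo fE f_circle b_lt1 v w (leq0n N)).
have h2 : sg * A2 - e <= avgR p n (fun z => X z ^+ 2) <= 4 * (A2 + normc w ^+ 2) + e.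
  by near: n; exact: (second_moment p F_holo fE f_circle b_lt1 v w (leq0n N)).
have h4 : avgR p n (fun z => X z ^+ 4) <= 64 * (A2 + normc w ^+ 2) ^+ 2 + e.
  by near: n; exact: (fourth_moment p F_holo fE f_circle b_lt1 v w (leq0n N)).
have : avgR p n (fun z => s / A * X z + (A ^- 2 * X z ^+ 2 +
      (- (A ^- 4 / s ^+ 2) * X z ^+ 4 + - (sg / 4)))) <=
    avgR p n (fun z => 6 * s ^+ 2 * (pz_level * A <= X z)%R%:R).
  apply: avgR_le => z _.
  have := quartic_minorant (X z / A) s1 sg4.
  rewrite -/pz_level ler_pdivlMr //; apply: le_trans.
  by rewrite le_eqVlt; apply/orP; left; apply/eqP; field; rewrite !gt_eqF.
rewrite avgRZ !avgRD !avgRZ avgR_cst // => h.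
rewrite /pz_proba ler_pdivrMr ?mulr_gt0 ?exprn_gt0 //.
have k1 : - (sg / 32) <= s / A * avgR p n X.
  move: h1; rewrite ler_norml => /andP[h1 _].
  have : - (sg * A / (32 * s)) <= avgR p n X by lra.
  move=> h1'; apply: (@le_trans _ _ (s / A * - (sg * A / (32 * s)))).
    by rewrite le_eqVlt; apply/orP; left; apply/eqP; field; rewrite !gt_eqF.
  by rewrite ler_pM2l // divr_gt0.
have k2 : sg - sg / 32 <= A ^- 2 * avgR p n (fun z => X z ^+ 2).
  rewrite AE [leRHS]mulrC ler_pdivlMr //; move: h2 => /andP[h2 _]; lra.
have k4 : A ^- 4 / s ^+ 2 * avgR p n (fun z => X z ^+ 4) <= sg / 2 + sg / 2 ^+ 9.
  have : avgR p n (fun z => X z ^+ 4) <= (2 ^+ 8 + 1) * A2 ^+ 2.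
    apply: (le_trans h4).
    have w0 := sqr_ge0 (normc w).
    have : (A2 + normc w ^+ 2) ^+ 2 <= (2 * A2) ^+ 2.
      by rewrite ler_pXn2r ?nnegrE //; lra.
    rewrite exprMn; lra.
  move=> h4'; rewrite mulrAC ler_pdivrMr ?exprn_gt0 // s2E A4E [leLHS]mulrC.
  have -> : (sg / 2 + sg / 2 ^+ 9) * (2 ^+ 9 / sg) = 2 ^+ 8 + 1 by field; rewrite gt_eqF.
  by rewrite ler_pdivrMr.
move: h; rewrite mulNr -/sg -/s => h; lra.
Unshelve. all: by end_near. Qed.

(* Summation by parts: the coefficients of a block sum with respect to the
   reversed martingale differences [incr f b k]. *)
Fixpoint resolvent (a : nat -> R[i]) (k : nat) : R[i] :=
  if k is k'.+1 then a k' + b^*%C * resolvent a k' else 0.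

Lemma sum_by_incr (a : nat -> R[i]) u N z : u * (\sum_(k < N) a k * iter k f z) =
  \sum_(k < N) u * resolvent a k.+1 * incr f b k z +
  u * b^*%C * resolvent a N * iter N f z.
Proof.
elim: N => [|N IH]; first by rewrite !big_ord0 /=; ring.
by rewrite !big_ord_recr /= mulrDr IH /incr /=; ring.
Qed.

Lemma normc_sqrD z w : normc (z + w) ^+ 2 <= 2 * normc z ^+ 2 + 2 * normc w ^+ 2.
Proof.
have := normcD z w; have := normc_ge0 (z + w); have := normc_ge0 z; have := normc_ge0 w.
by have := sqr_ge0 (normc z - normc w); nra.
Qed.

(** Each [a k] is the difference of [resolvent a k.+1] and [conj b * resolvent a k], with [|b| < 1].
    The extra term [2 |resolvent a N|^2] closes the induction. *)
Lemma resolvent_sqr (a : nat -> R[i]) N :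
  \sum_(k < N) normc (a k) ^+ 2 <= 4 * \sum_(k < N) normc (resolvent a k.+1) ^+ 2.
Proof.
have bsq : normc b ^+ 2 <= 1 by rewrite expr_le1 ?normc_ge0 // ltW.
suff : \sum_(k < N) normc (a k) ^+ 2 + 2 * normc (resolvent a N) ^+ 2 <=
    4 * \sum_(k < N) normc (resolvent a k.+1) ^+ 2.
  by have := sqr_ge0 (normc (resolvent a N)); lra.
elim: N => [|N IH].
  by rewrite !big_ord0 [resolvent _ _]/= Normc.normc0 expr0n /= !mulr0 addr0.
rewrite !big_ord_recr /=; set r := resolvent a N in IH *.
have h := normc_sqrD (a N + b^*%C * r) (- (b^*%C * r)).
rewrite addrK normcN Normc.normcM normc_conj exprMn in h.
have r0 := sqr_ge0 (normc r).
have : normc b ^+ 2 * normc r ^+ 2 <= normc r ^+ 2 by rewrite ler_piMl.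
lra.
Qed.

Lemma block_gain_avg (a : nat -> R[i]) u N : normc u = 1 ->
  \forall n \near \oo, pz_proba <= avgR p n (fun z =>
    (pz_level / 2 * Num.sqrt (\sum_(k < N) normc (a k) ^+ 2) <=
     Re (u * \sum_(k < N) a k * iter k f z))%R%:R).
Proof.
move=> u1; set A2 := \sum_(k < N) _.
pose v k := u * resolvent a k.+1; pose w := u * b^*%C * resolvent a N.
have vE : sumsq N v 0 = \sum_(k < N) normc (resolvent a k.+1) ^+ 2.
  rewrite /sumsq big_mkord; apply: eq_bigr => k _.
  by rewrite /v Normc.normcM u1 mul1r.
have Av : A2 <= 4 * sumsq N v 0 by rewrite vE; exact: resolvent_sqr.
have tE z : tail f b N v w 0 z = Re (u * \sum_(k < N) a k * iter k f z).
  rewrite sum_by_incr /tail big_mkord /term.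
  have ReD x y : Re (x + y) = Re x + Re y by case: x; case: y.
  rewrite ReD; congr (_ + _).
  by elim/big_ind2: _ => // x1 x2 y1 y2 -> ->.
(* A block with zero coefficients: the inequality reads [0 <= 0] and holds everywhere, and
   [pz_proba <= 1]. *)
have [A0|A0] := leP (sumsq N v 0) 0.
  have a0 k : (k < N)%N -> a k = 0.
    move=> kN; have : A2 <= 0 by lra.
    rewrite /A2 (bigD1 (Ordinal kN)) //= => h.
    have h1 := sqr_ge0 (normc (a k)).
    have h2 : 0 <= \sum_(i < N | i != Ordinal kN) normc (a i) ^+ 2.
      by apply: sumr_ge0 => i _; exact: sqr_ge0.
    have /eqP : normc (a k) ^+ 2 = 0 by lra.
    by rewrite sqrf_eq0 => /eqP /Normc.eq0_normc.
  near=> n; have n0 : (0 < n)%N by near: n; exists 1%N.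
  apply: (@le_trans _ _ 1).
    rewrite ler_pdivrMr; last by rewrite mulr_gt0 // exprn_gt0 // (lt_le_trans _ pz_scale_ge1).
    rewrite mul1r pz_scaleE; have s0 := sig_gt0; have b0 := sqr_ge0 (normc b).
    rewrite mulrA ler_pdivlMr //; rewrite /sig in s0 *.
    have : ((1 - normc b ^+ 2) / 2) * ((1 - normc b ^+ 2) / 2) <= 1 * 1.
      by apply: ler_pM; lra.
    by lra.
  rewrite -[leLHS](avgR_cst p 1 n0); apply: avgR_le => z _.
  have -> : A2 = 0 by apply: big1 => i _; rewrite a0 // Normc.normc0 expr0n.
  rewrite (_ : \sum_(k < N) _ = 0); last by apply: big1 => i _; rewrite a0 // mul0r.
  by rewrite sqrtr0 !mulr0 /= lexx.
have wv : normc w ^+ 2 <= sumsq N v 0.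
  rewrite vE; case: N @A2 @w vE Av tE A0 => [|N] A2 w vE Av tE A0.
    by rewrite /w [resolvent _ _]/= mulr0 Normc.normc0 expr0n big_ord0.
  rewrite /w !Normc.normcM u1 mul1r normc_conj exprMn big_ord_recr /=.
  apply: (@le_trans _ _ (normc (resolvent a N.+1) ^+ 2)).
    by rewrite ler_piMl ?sqr_ge0 // expr_le1 ?normc_ge0 // ltW.
  by rewrite lerDr sumr_ge0 // => i _; exact: sqr_ge0.
have := tail_large A0 wv; apply: filterS => n /le_trans; apply.
apply: avgR_le => z _; rewrite tE ler_nat.
have le2 : pz_level / 2 * Num.sqrt A2 <= pz_level * Num.sqrt (sumsq N v 0).
  rewrite -mulrA ler_pM2l ?pz_level_gt0 //.
  have : Num.sqrt A2 <= Num.sqrt (4 * sumsq N v 0) by rewrite ler_wsqrtr.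
  rewrite sqrtrM // (_ : 4 = 2 ^+ 2); last by ring.
  by rewrite sqrtr_sqr ger0_norm // => h; lra.
by case: leP => //= h; rewrite (le_trans le2 h).
Unshelve. all: by end_near. Qed.
End LargeBlocks.


(** * From averages over sample points to lengths of intervals *)

Section SampleCount.
Variable R : realType.

Lemma count_nat_itv (al be : R) (n : nat) :
  \sum_(i < n) ((al <= i%:R) && (i%:R < be))%:R <= Num.max 0 (be - al + 1).
Proof.
pose c (i : nat) : R := ((al <= i%:R) && (i%:R < be))%:R.
rewrite -[leLHS]/(\sum_(i < n) c i).
suff H m : \sum_(i < m) c i = 0 \/
    (\sum_(i < m) c i <= m%:R - al /\ \sum_(i < m) c i <= be - al + 1).
  by case: (H n) => [->|[_ h]]; rewrite le_max ?lexx // h orbT.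
elim: m => [|m IH]; first by left; rewrite big_ord0.
rewrite big_ord_recr /=; move: IH; move: (\sum_(i < m) c i) => S; rewrite /c -natr1.
case: (boolP (_ && _)) => [/andP[h1 h2]|_] [->|[h3 h4]]; rewrite ?addr0 ?add0r.
- by right; rewrite /=; split; lra.
- by right; rewrite /=; split; lra.
- by left.
- by right; split; lra.
Qed.

(** An interval contains at most [n] times its length plus one of the [n] sample points. Summed over
    the intervals that meet [P], the excess is at most [K], which is below [n * p0 / 2] for large
    [n]; hence half of [p0] is kept, without any regularity of [P]. *)
Lemma partition_gain (p p0 : R) (K : nat) (t : nat -> R) (P : R[i] -> bool) :
  0 < p0 -> t 0%N = p -> t K = p + 1 -> (forall k, t k <= t k.+1) ->
  (\forall n \near \oo, p0 <= avgR p n (fun z => (P z)%:R)) ->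
  p0 / 2 <= \sum_(k < K | `[< exists2 x, t k <= x <= t k.+1 & P (cis2pi x) >])
              (t k.+1 - t k).
Proof.
move=> p00 t0 tK tS Hn.
pose N0 := Num.truncn (2 * K%:R / p0).
have [n [n0 nK Hp]] : exists n : nat, [/\ (0 < n)%N, K%:R / n%:R <= p0 / 2 &
    p0 <= avgR p n (fun z => (P z)%:R)].
  case: Hn => m _ Hm; exists (maxn m N0.+1); split.
  - by rewrite (leq_trans _ (leq_maxr _ _)).
  - rewrite ler_pdivrMr ?ltr0n ?(leq_trans _ (leq_maxr _ _)) //.
    have h : 2 * K%:R / p0 <= (maxn m N0.+1)%:R.
      by apply: ltW; rewrite (lt_le_trans (truncnS_gt _)) // ler_nat leq_maxr.
    by move: h; rewrite ler_pdivrMr //; lra.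
  - by apply: Hm => /=; exact: leq_maxl.
have n0' : 0 < n%:R :> R by rewrite ltr0n.
pose good k := `[< exists2 x, t k <= x <= t k.+1 & P (cis2pi x) >].
have locate m x : t 0%N <= x < t m -> exists2 k, (k < m)%N & t k <= x < t k.+1.
  elim: m => [|m IH] /andP[x0 xm]; first by lra.
  have [h|h] := leP (t m) x; first by exists m; rewrite ?h.
  have [|k km kx] := IH; first by rewrite x0.
  by exists k => //; exact: ltnW.
have pt (i : 'I_n) : (P (sample p n i))%:R <=
    \sum_(k < K | good k) ((t k <= p + i%:R / n%:R) && (p + i%:R / n%:R < t k.+1))%:R :> R.
  case: (boolP (P _)) => Pi; last by rewrite sumr_ge0.
  have [|k kK kx] := locate K (p + i%:R / n%:R).
    rewrite t0 tK lerDl divr_ge0 ?ler0n //= ltrD2l ltr_pdivrMr // mul1r ltr_nat.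
    exact: ltn_ord.
  have gk : good (Ordinal kK).
    by apply/asboolP; exists (p + i%:R / n%:R) => //; move: kx => /andP[-> /ltW].
  by rewrite (bigD1 (Ordinal kK)) //= kx lerDl sumr_ge0.
have : n%:R * p0 <= \sum_(k < K | good k) (n%:R * (t k.+1 - t k) + 1).
  apply: (@le_trans _ _ (\sum_(i < n) (P (sample p n i))%:R)).
    by move: Hp; rewrite /avgR -[leRHS]mulrC ler_pdivlMr // mulrC.
  apply: (le_trans (ler_sum _ (fun i _ => pt i))); rewrite exchange_big /=.
  apply: ler_sum => k _.
  apply: le_trans (_ : Num.max 0 (n%:R * (t k.+1 - p) - n%:R * (t k - p) + 1) <= _).
    apply: le_trans (count_nat_itv _ _ n); apply: ler_sum => i _.
    rewrite ler_nat; case: andP => //= -[h1 h2].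
    have e : i%:R = n%:R * (i%:R / n%:R) :> R by rewrite mulrC divfK // gt_eqF.
    by rewrite e ler_pM2l // ltr_pM2l //; case: andP => // -[]; split; lra.
  rewrite ge_max; apply/andP; split; last by lra.
  by have := tS k; rewrite -subr_ge0 => h; rewrite addr_ge0 // mulr_ge0 // ltW.
rewrite big_split /= -mulr_sumr sumr_const => h.
have cK : #|[pred k : 'I_K | good k]|%:R <= K%:R :> R.
  by rewrite ler_nat -[leqRHS]card_ord; exact: max_card.
have {}h : n%:R * p0 <= n%:R * (\sum_(k < K | good k) (t k.+1 - t k)) + K%:R.
  exact: le_trans h (lerD (lexx _) cK).
move: nK; rewrite ler_pdivrMr // => nK.
by rewrite -(ler_pM2l n0'); lra.
Qed.
End SampleCount.

(** * Steering partial sums *)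

Section Steering.
Variable R : realType.

(** One-sided on purpose: it is also applied to potentials that may be negative. *)
Definition null_seq (u : nat -> R) :=
  forall e, 0 < e -> exists n0, forall n, (n0 <= n)%N -> u n <= e.

Lemma null_seqD u v : null_seq u -> null_seq v -> null_seq (fun n => u n + v n).
Proof.
move=> Hu Hv e e0; have e2 : 0 < e / 2 by lra.
have [n1 H1] := Hu _ e2; have [n2 H2] := Hv _ e2.
exists (maxn n1 n2) => n; rewrite geq_max => /andP[h1 h2].
by have := H1 _ h1; have := H2 _ h2; lra.
Qed.

Lemma null_seqZ c u : 0 <= c -> null_seq u -> null_seq (fun n => c * u n).
Proof.
move=> c0 Hu e e0; have [|n0 H] := Hu (e / (1 + c)); first by rewrite divr_gt0 //; lra.
exists n0 => n /H h; apply: (@le_trans _ _ (c * (e / (1 + c)))).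
  by rewrite ler_wpM2l.
by rewrite mulrCA ler_piMr ?(ltW e0) // ler_pdivrMr; lra.
Qed.

Lemma null_seq_le u v : (forall n, u n <= v n) -> null_seq v -> null_seq u.
Proof.
by move=> uv Hv e /Hv[n0 H]; exists n0 => n /H; apply: le_trans (uv n).
Qed.

Lemma null_seq_sub u (nu : nat -> nat) : (forall j, (j <= nu j)%N) ->
  null_seq u -> null_seq (fun j => u (nu j)).
Proof.
move=> nuj Hu e /Hu[n0 H]; exists n0 => n nn; apply: H.
exact: leq_trans nn (nuj n).
Qed.

Lemma null_seqS u : null_seq u -> null_seq (fun n => u n.+1).
Proof. by apply: null_seq_sub. Qed.

Definition unbounded_sums (u : nat -> R) := forall B, exists n, B <= \sum_(k < n) u k.

Lemma unbounded_sums_tail u n0 : unbounded_sums u ->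
  forall B, exists n, B <= \sum_(k < n) u (n0 + k)%N.
Proof.
move=> Hu B; have [n Hn] := Hu (B + \sum_(k < n0) `|u k|).
have u_le : \sum_(k < n0) u k <= \sum_(k < n0) `|u k|.
  by apply: ler_sum => i _; exact: ler_norm.
have [nn|nn] := leqP n n0.
  exists 0%N; rewrite big_ord0.
  have h1 : \sum_(k < n) u k <= \sum_(k < n0) `|u k|.
    apply: (@le_trans _ _ (\sum_(k < n) `|u k|)).
      by apply: ler_sum => i _; exact: ler_norm.
    have [m ->] : exists m, n0 = (n + m)%N by exists (n0 - n)%N; lia.
    by rewrite big_split_ord /= lerDl sumr_ge0.
  lra.
have [m nE] : exists m, n = (n0 + m)%N by exists (n - n0)%N; lia.
by exists m; move: Hn; rewrite nE big_split_ord /=; lra.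
Qed.

(** Once [B <= e], a value [V > e] can only come from the first alternative. Such descents cannot go
    on forever, because the sums of [A] are unbounded while [V] is bounded below; and after one late
    value at most [e], both alternatives keep [V] there. *)
Lemma steering_abstract (V A B : nat -> R) (c : R) :
  0 < c -> null_seq A -> null_seq B -> unbounded_sums A ->
  (forall j, 0 <= A j) -> (forall j, - c * A j <= V j) ->
  (forall j, V j.+1 <= V j - c * A j \/ V j.+1 <= B j) -> null_seq V.
Proof.
move=> c0 A0 B0 Asum Age Vge step e e_gt0.
have [n0 Hn0] := B0 _ e_gt0.
have c1 : 0 < c^-1 by rewrite invr_gt0.
have [n1 Hn1] := A0 _ c1.
pose m := maxn n0 n1.
have [J mJ VJ] : exists2 J, (m <= J)%N & V J <= e.
  apply: contrapT => /forall2NP noJ.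
  have big j : (m <= j)%N -> e < V j.
    by move=> mj; rewrite ltNge; apply/negP; case: (noJ j).
  have dec k : V (m + k)%N <= V m - c * \sum_(i < k) A (m + i)%N.
    elim: k => [|k IH]; first by rewrite big_ord0 addn0 mulr0 subr0.
    rewrite big_ord_recr /= addnS; case: (step (m + k)%N) => h; first by lra.
    have mk : (m <= m + k)%N by exact: leq_addr.
    have := big _ (leqW mk); have := Hn0 _ (leq_trans (leq_maxl n0 n1) mk); lra.
  have [k Hk] := unbounded_sums_tail m Asum ((V m + 2) / c).
  have d := dec k; have g := Vge (m + k)%N.
  have mk : (n1 <= m + k)%N by rewrite (leq_trans (leq_maxr n0 n1)) // leq_addr.
  have a1 : c * A (m + k)%N <= 1.
    by rewrite -(divff (lt0r_neq0 c0)) ler_pM2l // Hn1.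
  move: Hk; rewrite ler_pdivrMr // => Hk; rewrite mulNr in g.
  by move: (\sum_(i < k) A (m + i)%N) Hk d => S; lra.
exists J => n Jn; rewrite -(subnKC Jn); elim: (n - J)%N => [|k IH].
  by rewrite addn0.
rewrite addnS; case: (step (J + k)%N) => h.
  by have := mulr_ge0 (ltW c0) (Age (J + k)%N); lra.
apply: (le_trans h); apply: Hn0.
by rewrite (leq_trans (leq_maxl n0 n1)) // (leq_trans mJ) // leq_addr.
Qed.

Lemma sum_sqr_le (r : seq nat) (x : nat -> R) : (forall i, 0 <= x i) ->
  \sum_(i <- r) x i ^+ 2 <= (\sum_(i <- r) x i) ^+ 2 <=
  (size r)%:R * \sum_(i <- r) x i ^+ 2.
Proof.
move=> x0; elim: r => [|i r]; first by rewrite !big_nil expr0n /= mul0r lexx.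
rewrite !big_cons /= -natr1.
have S0 : 0 <= \sum_(j <- r) x j by exact: sumr_ge0.
have T0 : 0 <= \sum_(j <- r) x j ^+ 2 by apply: sumr_ge0 => j _; exact: sqr_ge0.
move: (\sum_(j <- r) x j) S0 => S S0; move: (\sum_(j <- r) x j ^+ 2) T0 => T T0.
move=> /andP[h1 h2]; apply/andP; split.
  by have := mulr_ge0 (x0 i) S0; lra.
case: (size r) h2 => [|n] h2.
  have S00 : S ^+ 2 = 0 by apply/eqP; rewrite eq_le sqr_ge0 andbT; lra.
  have -> : S = 0 by apply/eqP; rewrite -sqrf_eq0 S00.
  by rewrite !addr0 add0r mul1r lerDl.
have n0 : 0 < n.+1%:R :> R by rewrite ltr0n.
have h := sqr_ge0 (n.+1%:R * x i - S).
have : n.+1%:R * (2 * x i * S) <= n.+1%:R * (n.+1%:R * x i ^+ 2 + T) by lra.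
rewrite ler_pM2l //; lra.
Qed.

Variables (al : nat -> R) (lam : R) (n0 N : nat).
Hypothesis lam01 : 0 < lam < 1.
Hypothesis al_ge0 : forall n, 0 <= al n.
Hypothesis al_null : null_seq al.
Hypothesis al_sum : unbounded_sums al.
Hypothesis N_gt0 : (0 < N)%N.

(* Up to a constant factor, the oscillation of the [n]-th partial sum on a
   cylinder of generation [n]; see [errE]. *)
Fixpoint err n : R := if n is n'.+1 then lam * (err n' + al n') else 0.

Lemma err_ge0 n : 0 <= err n.
Proof.
have /andP[l0 _] := lam01; elim: n => //= n IH.
by rewrite mulr_ge0 ?addr_ge0 // ltW.
Qed.

Lemma errE n : err n = \sum_(k < n) lam ^+ (n - k) * al k.
Proof.
elim: n => [|n IH]; first by rewrite big_ord0.
rewrite big_ord_recr /= IH mulrDr subSnn expr1 mulr_sumr; congr (_ + _).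
by apply: eq_bigr => k _; rewrite mulrA -exprS subSn // ltnW.
Qed.

Lemma err_null : null_seq err.
Proof.
have /andP[l0 l1] := lam01 => e e0.
have e1 : 0 < e / 2 * (1 - lam) by rewrite mulr_gt0 //; lra.
have [n1 H1] := al_null e1.
have [k Hk] := @expr_small R lam (e / 2 / (1 + err n1))
  ltac:(have := err_ge0 n1 => h; rewrite divr_gt0 //; lra) ltac:(by rewrite (ltW l0)).
have bnd j : err (n1 + j) <= lam ^+ j * err n1 + e / 2.
  elim: j => [|j IH]; first by rewrite addn0 mul1r; lra.
  rewrite addnS /= exprS -mulrA.
  have h1 := H1 _ (leq_addr j n1).
  apply: (@le_trans _ _ (lam * (lam ^+ j * err n1 + e / 2 + e / 2 * (1 - lam)))).
    by rewrite ler_pM2l //; lra.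
  have : 0 <= (1 - lam) * (1 - lam) * e by rewrite !mulr_ge0 //; lra.
  lra.
exists (n1 + k)%N => n nn; rewrite -(subnKC nn) -addnA; apply: (le_trans (bnd _)).
have e0' := err_ge0 n1.
suff : lam ^+ (k + (n - (n1 + k))) * err n1 <= e / 2 by lra.
have lk : lam ^+ (k + (n - (n1 + k))) <= lam ^+ k.
  rewrite exprD ler_piMr ?exprn_ge0 ?(ltW l0) // exprn_ile1 //; exact: ltW.
apply: (@le_trans _ _ (e / 2 / (1 + err n1) * err n1)).
  by rewrite ler_wpM2r // (le_trans lk) // ltW.
by rewrite -mulrA ler_piMr ?divr_ge0 ?(ltW e0) // mulrC ler_pdivrMr; lra.
Qed.

Let Lam := lam / (1 - lam).

Lemma Lam_gt0 : 0 < Lam.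
Proof. by have /andP[l0 l1] := lam01; rewrite divr_gt0 // subr_gt0. Qed.

Lemma err_sum n L : \sum_(i < L) err (n + i.+1) + Lam * err (n + L) =
  Lam * (err n + \sum_(k < L) al (n + k)).
Proof.
have /andP[l0 l1] := lam01.
elim: L => [|L IH]; first by rewrite !big_ord0 addn0 add0r addr0.
rewrite !big_ord_recr /= !addnS /= [err n + _]addrA [RHS]mulrDr -IH /Lam; field.
by rewrite gt_eqF // subr_gt0.
Qed.

(** Pigeonhole: [err_sum] bounds the sum of [err] over the [N] candidates from [n + N + 1] to
    [n + 2 N], so one of them is at most the average. *)
Lemma next_block n : exists n', [/\ (n + N < n')%N, (n' <= n + 2 * N)%N &
  N%:R * err n' <= Lam * (err n + \sum_(k < 2 * N) al (n + k))].
Proof.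
apply: contrapT => H; set B := Lam * _ in H.
have big (i : 'I_N) : B < N%:R * err (n + (N + i).+1).
  rewrite ltNge; apply/negP => h; apply: H; exists (n + (N + i).+1)%N.
  by have := ltn_ord i; split=> //; lia.
have := err_sum n (2 * N); rewrite -/B.
have -> : \sum_(i < 2 * N) err (n + i.+1) =
    \sum_(i < N) err (n + i.+1) + \sum_(i < N) err (n + (N + i).+1).
  by rewrite mul2n -addnn big_split_ord.
have s1 : 0 <= \sum_(i < N) err (n + i.+1) by apply: sumr_ge0 => i _; exact: err_ge0.
have Lg := Lam_gt0; have s3 : 0 <= Lam * err (n + 2 * N).
  by rewrite mulr_ge0 ?err_ge0 // ltW.
have : \sum_(i < N) B < \sum_(i < N) N%:R * err (n + (N + i).+1).
  by apply: ltr_sum => //; apply/hasP; exists (Ordinal N_gt0); rewrite ?mem_index_enum.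
rewrite sumr_const card_ord -mulr_sumr -[B *+ N]mulr_natl ltr_pM2l ?ltr0n // => h.
lra.
Qed.

Definition block (nu : nat -> nat) :=
  [/\ nu 0%N = n0, forall j, (nu j + N < nu j.+1)%N, forall j, (nu j.+1 <= nu j + 2 * N)%N &
   forall j, N%:R * err (nu j.+1) <= Lam * (err (nu j) + \sum_(k < 2 * N) al (nu j + k))].

Lemma block_exists : exists nu, block nu.
Proof.
pose F k := iter k (fun n => sval (cid (next_block n))) n0.
by exists F; split=> // j; have [] := svalP (cid (next_block (F j))).
Qed.

Variable nu : nat -> nat.
Hypothesis nu_block : block nu.

Definition mass j := \sum_(nu j <= k < nu j.+1) al k.
Definition size2 j := Num.sqrt (\sum_(nu j <= k < nu j.+1) al k ^+ 2).

Lemma nu_lt j : (nu j < nu j.+1)%N.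
Proof. by have [_ h _ _] := nu_block; have := h j; lia. Qed.

Lemma nu_ge j : (j <= nu j)%N.
Proof. by elim: j => // j IH; exact: leq_ltn_trans (nu_lt j). Qed.

Lemma size2_ge0 j : 0 <= size2 j.
Proof. exact: sqrtr_ge0. Qed.

Lemma size2_sqr j : size2 j ^+ 2 = \sum_(nu j <= k < nu j.+1) al k ^+ 2.
Proof. by rewrite sqr_sqrtr // sumr_ge0 // => k _; exact: sqr_ge0. Qed.

Lemma mass_ge0 j : 0 <= mass j.
Proof. exact: sumr_ge0. Qed.

Lemma size2_le_mass j : size2 j <= mass j.
Proof.
rewrite -(@ler_pXn2r _ 2) ?nnegrE ?size2_ge0 ?mass_ge0 // size2_sqr.
by have /andP[] := @sum_sqr_le (index_iota (nu j) (nu j.+1)) al al_ge0.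
Qed.

Lemma mass_le_size2 j : mass j <= Num.sqrt (2 * N%:R) * size2 j.
Proof.
rewrite -(@ler_pXn2r _ 2) ?nnegrE ?mass_ge0 ?mulr_ge0 ?sqrtr_ge0 //.
rewrite exprMn size2_sqr sqr_sqrtr ?mulr_ge0 ?ler0n //.
have /andP[_ h] := @sum_sqr_le (index_iota (nu j) (nu j.+1)) al al_ge0.
apply: (le_trans h); apply: ler_wpM2r.
  by apply: sumr_ge0 => k _; exact: sqr_ge0.
rewrite size_iota -natrM ler_nat; have [_ _ hn _] := nu_block.
by have := hn j; lia.
Qed.

Lemma mass_null : null_seq mass.
Proof.
move=> e e0; have N0 : 0 < (2 * N)%:R :> R by rewrite ltr0n muln_gt0.
have [m Hm] := al_null (divr_gt0 e0 N0); exists m => j mj.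
apply: (@le_trans _ _ (\sum_(nu j <= k < nu j.+1) e / (2 * N)%:R)).
  rewrite /mass !big_nat; apply: ler_sum => k /andP[jk _]; apply: Hm.
  by rewrite (leq_trans mj) // (leq_trans (nu_ge j)).
rewrite sumr_const_nat -[leLHS]mulr_natr mulrAC ler_pdivrMr // ler_pM2l // ler_nat.
by have [_ _ hn _] := nu_block; have := hn j; lia.
Qed.

Lemma size2_null : null_seq size2.
Proof. exact: null_seq_le size2_le_mass mass_null. Qed.

Lemma err_nu_null : null_seq (fun j => err (nu j)).
Proof. exact: null_seq_sub nu_ge err_null. Qed.

Lemma mass_sum J : \sum_(j < J) mass j = \sum_(nu 0%N <= k < nu J) al k.
Proof.
elim: J => [|J IH]; first by rewrite big_ord0 big_geq.
rewrite big_ord_recr /= IH -big_cat_nat //.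
  by elim: {IH} J => // J; move/leq_trans; apply; exact: ltnW (nu_lt J).
exact: ltnW (nu_lt J).
Qed.

Lemma size2_sum : unbounded_sums size2.
Proof.
move=> B; pose C := Num.sqrt (2 * N%:R) : R.
have C0 : 0 < C by rewrite sqrtr_gt0 mulr_gt0 // ltr0n.
have [n Hn] := unbounded_sums_tail (nu 0%N) al_sum (C * B).
exists n; rewrite -(ler_pM2l C0) (le_trans Hn) // mulr_sumr.
apply: (@le_trans _ _ (\sum_(j < n) mass j)); last first.
  by apply: ler_sum => j _; exact: mass_le_size2.
have nn : (nu 0 + n <= nu n)%N.
  elim: n {Hn} => [|n IH]; first by rewrite addn0.
  by have := nu_lt n; lia.
rewrite mass_sum (big_cat_nat (leq_addr n _) nn) /=.
have -> : \sum_(k < n) al (nu 0 + k)%N = \sum_(nu 0%N <= k < nu 0%N + n) al k.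
  rewrite -{2}[nu 0%N]add0n big_addn addKn big_mkord.
  by apply: eq_bigr => k _; rewrite addnC.
by rewrite lerDl sumr_ge0.
Qed.

Let ratio := Lam * Num.sqrt (2 * N%:R) / N%:R.

(** The window of [2 N] coefficients that bounds [err] is contained in two consecutive blocks, each
    longer than [N]. Cauchy-Schwarz on these blocks turns the bound [1 / N] into [N ^ (-1/2)]. *)
Lemma err_next j : err (nu j.+1) <= ratio * (err (nu j) + size2 j + size2 j.+1).
Proof.
have N0 : 0 < N%:R :> R by rewrite ltr0n.
have [_ h1 h2 h3] := nu_block.
rewrite /ratio mulrAC ler_pdivlMr // mulrC (le_trans (h3 j)) //.
rewrite -[leRHS]mulrA.
rewrite ler_pM2l ?Lam_gt0 // -addrA mulrDr; apply: lerD.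
  rewrite ler_peMl ?err_ge0 // -[leLHS]sqrtr1 ler_wsqrtr //.
  have : 1 <= N%:R :> R by rewrite ler1n.
  lra.
rewrite mulrDr (le_trans _ (lerD (mass_le_size2 j) (mass_le_size2 j.+1))) //.
have nn : (nu j + 2 * N <= nu j.+2)%N by have := h1 j; have := h1 j.+1; lia.
have -> : mass j + mass j.+1 = \sum_(nu j <= k < nu j.+2) al k.
  by rewrite /mass -big_cat_nat // ltnW ?nu_lt.
rewrite (big_cat_nat (leq_addr (2 * N) _) nn) /=.
have -> : \sum_(k < 2 * N) al (nu j + k)%N = \sum_(nu j <= k < nu j + 2 * N) al k.
  rewrite -{2}[nu j]add0n big_addn addKn big_mkord.
  by apply: eq_bigr => k _; rewrite addnC.
by rewrite lerDl sumr_ge0.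
Qed.

Lemma steering (r : nat -> R) (K c Q : R) :
  0 < K -> 0 < c -> 0 <= Q -> 3 * K * ratio <= K -> 3 * K * ratio <= c / 4 ->
  (forall j, 0 <= r j) ->
  (forall j, r j.+1 <= r j + mass j + K * (err (nu j) + err (nu j.+1))) ->
  (forall j, Q * size2 j <= r j ->
     r j.+1 <= r j - c * size2 j + K * (err (nu j) + err (nu j.+1))) ->
  null_seq r.
Proof.
move=> K0 c0 Q0 rK rc r0 step1 step2.
(* The error at the end of block [j] involves [size2 j.+1], which the gain of block [j] does not
   control; the term [- c / 4 * size2 j] of the potential is there to absorb it one step later, and
   [2 K err] absorbs the error at the start. *)
pose V j := r j + 2 * K * err (nu j) - c / 4 * size2 j.
(* Bounds the next potential when [r j < Q * size2 j], where no gain is available but everything is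
   small. *)
pose B j := (Q + 1) * mass j + K * err (nu j) + 3 * K * err (nu j.+1).
have s0 := size2_ge0; have e0 := err_ge0.
have V_null : null_seq V.
  apply: (@steering_abstract V size2 B (c / 4)).
  - by lra.
  - exact: size2_null.
  - apply: null_seqD; last first.
      by apply: null_seqZ; [lra|exact: (null_seqS err_nu_null)].
    by apply: null_seqD; apply: null_seqZ; [lra|exact: mass_null|lra|exact: err_nu_null].
  - exact: size2_sum.
  - exact: size2_ge0.
  - move=> j; have := mulr_ge0 (ltW K0) (e0 (nu j)); have := r0 j.
    by rewrite /V mulNr; lra.
  - move=> j; have [h|h] := leP (Q * size2 j) (r j).
      left; have := step2 j h; have := err_next j.
      move=> /(ler_wpM2l (_ : 0 <= 3 * K)) -/(_ ltac:(lra)).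
      rewrite mulrA; set X := err (nu j) + size2 j + size2 j.+1 => h1.
      have h2 : 3 * K * ratio * err (nu j) <= K * err (nu j) by rewrite ler_wpM2r.
      have h3 : 3 * K * ratio * size2 j <= c / 4 * size2 j by rewrite ler_wpM2r.
      have h4 : 3 * K * ratio * size2 j.+1 <= c / 4 * size2 j.+1 by rewrite ler_wpM2r.
      have := mulr_ge0 (ltW c0) (s0 j).
      by move: h1; rewrite /X /V !mulrDr; lra.
    right; have := step1 j; have := size2_le_mass j => h1 h2.
    have := ler_wpM2l Q0 h1; have := mulr_ge0 (ltW c0) (s0 j.+1).
    by rewrite /V /B; lra.
apply: (@null_seq_le r (fun j => V j + c / 4 * size2 j)).
  by move=> j; rewrite /V; have := mulr_ge0 (ltW K0) (e0 (nu j)); lra.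
by apply: null_seqD => //; apply: null_seqZ; [lra|exact: size2_null].
Qed.
End Steering.

(** * Positive Hausdorff measure of the limit set of a tree *)

Section TreeHausdorff.
Variables (R : realType) (T : eqType) (lo hi : T -> R) (ch : T -> seq T).
Variables (s kap : R) (root : T) (E : set R[i]).
Local Notation cis := (@cis2pi R).
Hypothesis s01 : 0 < s < 1.
Hypothesis kap01 : 0 < kap <= 1.
Hypothesis len_gt0 : forall I, 0 < hi I - lo I.
Hypothesis ch_sub : forall I J, J \in ch I -> lo I <= lo J /\ hi J <= hi I.
Hypothesis ch_half : forall I J, J \in ch I -> hi J - lo J <= (hi I - lo I) / 2.
Hypothesis ch_kap : forall I J, J \in ch I -> kap * (hi I - lo I) <= hi J - lo J.
Hypothesis ch_disj : forall I (phi : R -> R),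
  (forall x y, x <= y -> phi x <= phi y) ->
  \sum_(J <- ch I) (phi (hi J) - phi (lo J)) <= phi (hi I) - phi (lo I).
Hypothesis ch_pow : forall I,
  (hi I - lo I) `^ s <= \sum_(J <- ch I) (hi J - lo J) `^ s.
Hypothesis root_len : hi root - lo root <= 2^-1.
Hypothesis branchE : forall (J : nat -> T) x, J 0%N = root ->
  (forall k, J k.+1 \in ch (J k)) -> (forall k, lo (J k) <= x <= hi (J k)) -> E (cis x).

(** A cover by arcs of s-cost below [c] is pulled back to parameter sets [U n] of diameter at most
    [u n]. The branch that avoids them yields a point of [E] outside the cover. Arcs shorter than
    [len / 2 <= 1/4] meet the condition of [arc_dist]. *)
Lemma tree_hausdorff : (0 < hausdorff_measure s E)%E.
Proof.
have /andP[s0 s1] := s01; have /andP[kap0 kap1] := kap01.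
set len := hi root - lo root; have len0 : 0 < len := len_gt0 root.
have len12 : len <= 2^-1 := root_len.
have lens0 : 0 < len `^ s by exact: powR_gt0.
(* With arcs costing [2 c] and the corrections below costing [c], the bound [4 / kap * (3 c)] equals
   3/8 of the s-weight of the root. *)
pose c := kap * len `^ s / 32.
have c0 : 0 < c by rewrite divr_gt0 // mulr_gt0.
apply: (@hausdorff_measure_gt0 R s E c (len / 2) c0); first by rewrite divr_gt0.
move=> I Ia EI Id; rewrite leNgt; apply/negP => small.
pose l n := fine (circle_length (I n)).
have lE n : circle_length (I n) = (l n)%:E.
  rewrite /l fineK // ge0_fin_numE ?circle_length_ge0 //.
  by rewrite (lt_trans (Id n)) // ltry.
have l0 n : 0 <= l n by have := circle_length_ge0 (I n); rewrite lE lee_fin.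
have ld n : l n < len / 2 by have := Id n; rewrite lE lte_fin.
(* Arcs of length zero also need a positive [u n]; the s-powers of these corrections add up to at
   most [c]. *)
pose tiny n := (c / 2 ^+ n.+1) `^ s^-1.
have tiny0 n : 0 < tiny n by rewrite powR_gt0 // divr_gt0 // exprn_gt0.
have tinyE n : tiny n `^ s = c / 2 ^+ n.+1.
  by rewrite /tiny -powRrM mulVf ?gt_eqF // powRr1 // ltW // divr_gt0 // exprn_gt0.
(* The factor [2] is that of [arc_dist]; the minimum with [len] keeps [kap * u n <= len]. *)
pose u n := Num.max (2 * l n) (Num.min len (tiny n)).
pose U n : set R := [set x | lo root <= x <= hi root /\ I n (cis x)].
have u0 n : 0 < u n by rewrite /u lt_max lt_min len0 tiny0 orbT.
have upow n : u n `^ s <= 2 * l n `^ s + c / 2 ^+ n.+1.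
  rewrite /u; case: (leP (2 * l n)) => h.
    apply: (@le_trans _ _ (tiny n `^ s)).
      apply: ge0_ler_powR; rewrite ?nnegrE ?(ltW s0) ?(ltW (tiny0 n)) //.
        by rewrite le_min (ltW len0) (ltW (tiny0 n)).
      by rewrite ge_min lexx orbT.
    by rewrite tinyE lerDr mulr_ge0 // powR_ge0.
  rewrite powRM //; apply: (@le_trans _ _ (2 * l n `^ s)).
    rewrite ler_wpM2r ?powR_ge0 // -[leRHS]powRr1 //.
    by apply: ler_powR; [lra|exact: ltW].
  by rewrite lerDl divr_ge0 ?(ltW c0) // exprn_ge0.
have Ud n x y : U n x -> U n y -> `|x - y| <= u n.
  move=> [/andP[x1 x2] Ix] [/andP[y1 y2] Iy].
  apply: (@le_trans _ _ (2 * l n)); last by rewrite /u le_max lexx.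
  apply: (@arc_dist R (I n)) => //.
  - by rewrite lE.
  - by have := ld n; lra.
  - by rewrite ler_norml; move: len12; rewrite /len; lra.
have uroot n : kap * u n <= len.
  apply: (@le_trans _ _ (1 * len)); last by rewrite mul1r.
  apply: ler_pM => //; first exact: ltW.
    exact: ltW.
  rewrite /u ge_max ge_min lexx /= andbT.
  by have := ld n; lra.
have sum_l N : \sum_(n < N) l n `^ s <= c.
  have : (\sum_(0 <= n < N) (circle_length (I n)) `^ s <=
          \sum_(0 <= n <oo) (circle_length (I n)) `^ s)%E.
    by apply: nneseries_lim_ge => *; exact: poweR_ge0.
  move=> /le_lt_trans /(_ small).
  rewrite big_mkord (eq_bigr (fun n : 'I_N => (l n `^ s)%:E)); last first.
    by move=> n _; rewrite lE poweR_EFin.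
  by rewrite sumEFin lte_fin => /ltW.
have sum_c N : \sum_(n < N) c / 2 ^+ n.+1 <= c.
  suff -> : \sum_(n < N) c / 2 ^+ n.+1 = c - c / 2 ^+ N.
    by rewrite gerBl divr_ge0 ?(ltW c0) // exprn_ge0.
  elim: N => [|N IH]; first by rewrite big_ord0 divr1 subrr.
  rewrite big_ord_recr /= IH exprS; field.
  by rewrite expf_neq0.
have [||||J [x [J0 JS Jx Ux]]] := branch_avoiding s0 kap0 len_gt0 ch_sub ch_half
    ch_kap ch_disj ch_pow (root := root) (U := U) (u := u) => //.
  exists (12 / kap * c).
    by rewrite /c -/len; have : 0 < len `^ s * (5 / 8); [lra|];
       rewrite (_ : 12 / kap * _ = len `^ s * (3 / 8)); [lra|field; rewrite gt_eqF].
  move=> N; rewrite -mulr_sumr.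
  have -> : 12 / kap * c = 4 / kap * (2 * c + c) by ring.
  rewrite ler_wpM2l ?divr_ge0 ?(ltW kap0) //.
  apply: (@le_trans _ _ (\sum_(n < N) (2 * l n `^ s + c / 2 ^+ n.+1))).
    by apply: ler_sum => n _.
  rewrite big_split /= -mulr_sumr.
  have h1 := sum_l N; have h2 := sum_c N.
  by apply: lerD => //; rewrite ler_pM2l.
have [n _ In] := EI _ (branchE J0 JS Jx).
apply: (Ux n); split=> //.
by have := Jx 0%N; rewrite J0.
Qed.
End TreeHausdorff.

(** * The factorization [f z = z * F z] and the bound on the derivative at the origin *)

Section BlaschkeHolo.
Variable R : realType.
Local Notation normc := (@Normc.normc R).

(** The value [b] of [F] at the origin is [0] if the exponent of [z] exceeds one, and otherwise a
    product of moduli less than one, which is empty only for a rotation. *)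
Lemma blaschke_holo (f : R[i] -> R[i]) : finite_blaschke0 f -> ~ is_rotation f ->
  exists F b, [/\ holo F b, forall z, normc z = 1 -> f z = z * F z & normc b < 1].
Proof.
move=> [al [n [zs [/normc_eq1 al1 n0 zs1 fE]]]] nrot.
have zs1' x : x \in zs -> normc x < 1 by move/zs1; rewrite normcE ltcR.
pose F z := al * z ^+ n.-1 * \prod_(x <- zs) ((z - x) / (1 - x^*%C * z)).
exists F, (al * 0 ^+ n.-1 * \prod_(x <- zs) - x); split.
- apply: holoM.
    by apply: holoZ; apply: holoX; exact: holo_id.
  by apply: holo_prod => x /zs1'; exact: holo_factor.
- move=> z z1; rewrite fE; last by rewrite normcE z1.
  by rewrite /F -{1}(prednK n0) exprS; ring.
rewrite !Normc.normcM al1 mul1r.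
have prod_le (s : seq R[i]) : (forall x, x \in s -> normc x < 1) ->
    normc (\prod_(x <- s) - x) <= 1.
  elim: s => [|x s IH] sx; first by rewrite big_nil Normc.normc1.
  rewrite big_cons Normc.normcM normcN.
  have h1 := sx x (mem_head _ _).
  have h2 : normc (\prod_(y <- s) - y) <= 1.
    by apply: IH => y ys; apply: sx; rewrite in_cons ys orbT.
  by rewrite -[leRHS]mul1r; apply: ler_pM; rewrite ?normc_ge0 // ltW.
case: n n0 fE @F => // -[|n] _ fE F; last first.
  by rewrite exprS mul0r Normc.normc0 mul0r ltr01.
rewrite expr0 Normc.normc1 mul1r.
case: zs zs1 zs1' fE @F => [|x s] zs1 zs1' fE F.
  exfalso; apply: nrot; exists al; split; first exact/normc_eq1.
  by move=> z z1; rewrite fE // big_nil mulr1 expr1.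
rewrite big_cons Normc.normcM normcN.
have h1 := zs1' x (mem_head _ _).
have h2 : normc (\prod_(y <- s) - y) <= 1.
  by apply: prod_le => y ys; apply: zs1'; rewrite in_cons ys orbT.
by apply: le_lt_trans h1; rewrite ler_piMr ?normc_ge0.
Qed.
End BlaschkeHolo.

(** * The tree of good cylinders *)

Lemma block_length_exists (R : realType) (lam x y : R) : 0 < lam < 1 -> 0 < x -> 0 < y ->
  exists N : nat, [/\ (0 < N)%N, Num.sqrt (2 * N%:R) / N%:R <= x & lam ^+ N <= y].
Proof.
move=> /andP[l0 l1] x0 y0; have [k Hk] := @expr_small R lam y y0 ltac:(by rewrite (ltW l0)).
pose N := maxn k (Num.truncn (2 / x ^+ 2)).+1.
have N0 : (0 < N)%N by rewrite leq_max orbT.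
have N0' : 0 < N%:R :> R by rewrite ltr0n.
exists N; split=> //.
  rewrite ler_pdivrMr // -(@ler_pXn2r _ 2) ?nnegrE ?sqrtr_ge0 ?mulr_ge0 ?(ltW x0) ?(ltW N0') //.
  rewrite sqr_sqrtr ?mulr_ge0 ?(ltW N0') // exprMn [N%:R ^+ 2]expr2 mulrA ler_pM2r //.
  rewrite -ler_pdivrMl ?exprn_gt0 // mulrC.
  by apply/ltW/(lt_le_trans (truncnS_gt _)); rewrite ler_nat leq_maxr.
rewrite -[N](subnKC (leq_maxl k _ : (k <= N)%N)) exprD.
apply: le_trans (ltW Hk); rewrite ler_piMr ?exprn_ge0 ?(ltW l0) //.
by rewrite exprn_ile1 // ltW.
Qed.

(** As [l k <= eta * len], the sum of the [l k ^ s] is at least [(eta * len) ^ (s - 1)] times that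
    of the [l k], itself at least [p0 / D * len]. A fixed proportion thus suffices for any [s < 1]
    once [eta] is small. *)
Lemma select_pow (R : realType) (I : finType) (P : pred I) (W l : I -> R)
    (len D eta p0 s : R) : 0 < s < 1 -> 0 < len -> 0 < D -> 0 < eta ->
  (forall k, P k -> W k * len <= D * l k) ->
  (forall k, P k -> 0 < l k <= eta * len) ->
  p0 <= \sum_(k | P k) W k -> eta `^ (1 - s) <= p0 / D ->
  len `^ s <= \sum_(k | P k) l k `^ s.
Proof.
move=> /andP[s0 s1] len0 D0 eta0 Wl leta pW etas.
have s1' : 0 < 1 - s by rewrite subr_gt0.
have split_pow x : 0 < x -> x = x `^ s * x `^ (1 - s).
  move=> x0; rewrite -powRD; last by apply/implyP => _; rewrite gt_eqF.
  by rewrite addrCA subrr addr0 powRr1 // ltW.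
have q0 : 0 < p0 / D by apply: lt_le_trans etas; exact: powR_gt0.
set S := \sum_(k | P k) l k `^ s.
have h1 : p0 * len <= D * \sum_(k | P k) l k.
  apply: (@le_trans _ _ ((\sum_(k | P k) W k) * len)); first by rewrite ler_pM2r.
  by rewrite mulr_suml mulr_sumr; apply: ler_sum.
have h2 : \sum_(k | P k) l k <= (eta * len) `^ (1 - s) * S.
  rewrite /S mulr_sumr; apply: ler_sum => k Pk; have /andP[lk0 lk] := leta k Pk.
  rewrite {1}(split_pow _ lk0) mulrC ler_wpM2r ?powR_ge0 //.
  apply: ge0_ler_powR => //; first exact: ltW.
    by rewrite nnegrE ltW.
  by rewrite nnegrE mulr_ge0 // ltW.
have S0 : 0 <= S by apply: sumr_ge0 => k _; exact: powR_ge0.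
have L0 : 0 < len `^ (1 - s) by exact: powR_gt0.
rewrite powRM ?(ltW eta0) ?(ltW len0) // in h2.
rewrite -(ler_pM2r L0) -split_pow // -(ler_pM2l q0).
apply: (@le_trans _ _ (\sum_(k | P k) l k)).
  by rewrite mulrAC ler_pdivrMr // mulrC [leRHS]mulrC mulrC.
apply: (le_trans h2); rewrite -mulrA [len `^ _ * S]mulrC ler_wpM2r //.
by rewrite mulr_ge0 // ltW.
Qed.

Section Assembly.
Variables (R : realType) (f F : R[i] -> R[i]) (b : R[i]).
Variables (G g : R -> R) (d : nat) (m M C p : R).
Variables (a : nat -> R[i]) (w : R[i]) (s : R).
Local Notation cis := (@cis2pi R).
Local Notation normc := (@Normc.normc R).
Local Notation Re := (@complex.Re R).
Hypothesis L : circle_lift f G g d m M C.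
Hypothesis m_gt1 : 1 < m.
Hypothesis Gp : G p = p.
Hypothesis F_holo : holo F b.
Hypothesis fE : forall z, normc z = 1 -> f z = z * F z.
Hypothesis b_lt1 : normc b < 1.
Hypothesis s01 : 0 < s < 1.
Let al n := normc (a n).
Let lam := m^-1.
Hypothesis al_null : null_seq al.
Hypothesis al_sum : unbounded_sums al.
Local Notation D := (distortion m C).
Local Notation q := (cyl L m_gt1 p).
Let c0 := pz_level b / 2.
Let p0 := pz_proba b / 2.
Let K : R := 4 * pi.
Variables (n0 N : nat) (nu : nat -> nat).
Hypothesis N_gt0 : (0 < N)%N.
Hypothesis nu_block : block al lam n0 N nu.
(** The root has length at most [1/2], as the covering argument demands. The conditions on [N] serve
    in turn to halve the intervals, to preserve the s-weight, and to make the oscillation errors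
    negligible in [steering]. *)
Hypothesis root_small : lam ^+ n0 <= 2^-1.
Hypothesis N_half : D * lam ^+ N <= 2^-1.
Hypothesis N_pow : (D * lam ^+ N) `^ (1 - s) <= p0 / D.
Hypothesis N_err : 3 * K * (lam / (1 - lam) * Num.sqrt (2 * N%:R) / N%:R) <= K.
Hypothesis N_gain : 3 * K * (lam / (1 - lam) * Num.sqrt (2 * N%:R) / N%:R) <= c0 / 2 / 4.

Let al_ge0 n : 0 <= al n. Proof. exact: normc_ge0. Qed.

Let lam01 : 0 < lam < 1.
Proof. by rewrite /lam invr_gt0 invf_lt1 ?(lt_trans ltr01) // m_gt1. Qed.

Let K_gt0 : 0 < K. Proof. by rewrite mulr_gt0 // pi_gt0. Qed.

Let c0_gt0 : 0 < c0. Proof. by rewrite divr_gt0 // pz_level_gt0. Qed.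

Let D_ge1 : 1 <= D. Proof. exact: distortion_ge1 L m_gt1. Qed.

Let f_circle z : normc z = 1 -> normc (f z) = 1.
Proof. by move=> /cis2pi_surj[t ->]; rewrite (lift_eq L) normc_cis2pi. Qed.

Definition psum n x := \sum_(k < n) a k * iter k f (cis x).
Definition bsum j x := \sum_(nu j <= k < nu j.+1) a k * iter k f (cis x).

(** Backwards from time [n] distances shrink by [m] at each step, so the term of index [k] varies by
    at most [4 pi m^(k-n) |a_k|]. *)
Lemma psum_dist n x y : `|iter n G x - iter n G y| <= 1 ->
  normc (psum n x - psum n y) <= K * err al lam n.
Proof.
move=> xy; rewrite /psum -sumrB (le_trans (normc_sum _ _)) // errE mulr_sumr.
apply: ler_sum => k _; rewrite -mulrBr Normc.normcM -/(al k) mulrA mulrC.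
by rewrite ler_wpM2r // (iter_dist L m_gt1) // ltnW.
Qed.

Let nu_le j : (nu j <= nu j.+1)%N.
Proof. by apply: ltnW; exact: nu_lt nu_block j. Qed.

Lemma psumS j x : psum (nu j.+1) x = psum (nu j) x + bsum j x.
Proof.
rewrite /psum /bsum -(big_mkord xpredT (fun k => a k * iter k f (cis x))).
rewrite -(big_mkord xpredT (fun k => a k * iter k f (cis x))).
by rewrite -big_cat_nat.
Qed.

Lemma normc_iter k x : normc (iter k f (cis x)) = 1.
Proof. by rewrite (iter_lift_cis L) normc_cis2pi. Qed.

Lemma sum_le_mass (A B : nat) x :
  normc (\sum_(A <= k < B) a k * iter k f (cis x)) <= \sum_(A <= k < B) al k.
Proof.
apply: (le_trans (normc_sum _ _)); apply: ler_sum => k _.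
by rewrite Normc.normcM normc_iter mulr1.
Qed.

(** The default [1] at [z = 0] keeps the modulus equal to one. *)
Definition dir (z : R[i]) : R[i] := if z == 0 then 1 else z^*%C / (normc z)%:C%C.

Lemma dirP z : normc (dir z) = 1 /\ dir z * z = (normc z)%:C%C.
Proof.
rewrite /dir; case: eqVneq => [->|z0]; first by rewrite Normc.normc1 Normc.normc0 mulr0.
have n0' : normc z != 0 by apply: contra_neq z0; exact: Normc.eq0_normc.
split.
  rewrite Normc.normcM Normc.normcV normc_conj normc_real ger0_norm ?normc_ge0 //.
  by rewrite divff.
rewrite mulrAC [_ * z]mulrC mul_conjc expr2 rmorphM mulfK //.
by apply: contra_neq n0' => /complexI.
Qed.

Lemma normc_sub_sqr z x : normc (z - x) ^+ 2 =
  normc z ^+ 2 - 2 * (normc z * Re (dir z * x)) + normc x ^+ 2.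
Proof.
have -> : normc z * Re (dir z * x) = Re (z^*%C * x).
  rewrite /dir; case: eqVneq => [->|z0].
    by rewrite Normc.normc0 mul0r conjc0 mul0r.
  have n0' : normc z != 0 by apply: contra_neq z0; exact: Normc.eq0_normc.
  rewrite mulrAC -fmorphV Re_mul_real mulrCA divff ?mulr1 //.
case: z x => z1 z2 [x1 x2]; rewrite /= !sqr_sqrtr ?addr_ge0 ?sqr_ge0 //.
by ring.
Qed.

(** A node [(j, i)] is the cylinder of generation [nu j] and index [i]; partial sums are read at its
    left endpoint. *)
Definition rem (I : nat * int) := w - psum (nu I.1) (q (nu I.1) I.2).
Definition gain (I : nat * int) x :=
  c0 * size2 al nu I.1 <= Re (dir (rem I) * bsum I.1 x).
Let Len j := (nu j.+1 - nu j)%N.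
(** A single point of gain is asked for: the oscillation on the child then accounts for its left
    endpoint. *)
Definition good (I : nat * int) k := `[< exists2 x,
  q (nu I.1.+1) (child d (Len I.1) I.2 k) <= x <=
  q (nu I.1.+1) (child d (Len I.1) I.2 k + 1) & gain I x >].
Definition kids (I : nat * int) : seq (nat * int) :=
  [seq (I.1.+1, child d (Len I.1) I.2 k) | k <- iota 0 (d ^ Len I.1) & good I k].
Let lo (I : nat * int) := q (nu I.1) I.2.
Let hi (I : nat * int) := q (nu I.1) (I.2 + 1).

Let nuS j : nu j.+1 = (nu j + Len j)%N.
Proof. by rewrite /Len subnKC. Qed.

Lemma kidsP I J : J \in kids I -> exists k, [/\ (k < d ^ Len I.1)%N, good I k &
  J = (I.1.+1, child d (Len I.1) I.2 k)].
Proof.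
case/mapP => k; rewrite mem_filter mem_iota add0n /= => /andP[gk kd] ->.
by exists k.
Qed.

Lemma kids_sum I (h : nat * int -> R) : \sum_(J <- kids I) h J =
  \sum_(k < d ^ Len I.1 | good I k) h (I.1.+1, child d (Len I.1) I.2 k).
Proof.
rewrite /kids big_map big_filter.
by rewrite -(big_mkord (good I) (fun k => h (I.1.+1, child d (Len I.1) I.2 k))) /index_iota subn0.
Qed.

Lemma kids_sub I J : J \in kids I -> lo I <= lo J /\ hi J <= hi I.
Proof.
move=> /kidsP[k [kd _ ->]]; rewrite /lo /hi /= nuS.
exact: (child_sub L m_gt1 Gp).
Qed.

Let Len_ge j : (N <= Len j)%N.
Proof. by have [_ h _ _] := nu_block; rewrite /Len leq_subRL ?nu_le // ltnW. Qed.

Let Len_le j : (Len j <= 2 * N)%N.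
Proof. by have [_ _ h _] := nu_block; rewrite /Len leq_subLR. Qed.

Let len_gt0 I : 0 < hi I - lo I.
Proof. exact: (cyl_len_gt0 L m_gt1). Qed.

Lemma cyl_len_upper n i : cyl_len L m_gt1 p n i <= lam ^+ n.
Proof.
have /andP[h _] := cyl_len_bounds L m_gt1 p n i.
have mn : 0 < m ^+ n by rewrite exprn_gt0 // (lt_trans ltr01).
by rewrite /lam exprVn -[_^-1]mulr1 -ler_pdivrMl ?invr_gt0 // invrK.
Qed.

Lemma kids_ratio I J : J \in kids I -> hi J - lo J <= D * lam ^+ N * (hi I - lo I).
Proof.
move=> /kidsP[k [kd _ ->]]; rewrite /lo /hi /= nuS.
have [_ h] := child_len L m_gt1 Gp (nu I.1) I.2 kd.
apply: (le_trans h); rewrite ler_wpM2r ?(ltW (len_gt0 I)) //.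
rewrite ler_wpM2l ?(le_trans ler01) // (le_trans (cyl_len_upper _ _)) //.
have /andP[l0 l1] := lam01; rewrite -(subnKC (Len_ge I.1)) exprD.
by rewrite ler_piMr ?exprn_ge0 ?(ltW l0) // exprn_ile1 // ltW.
Qed.

Lemma kids_half I J : J \in kids I -> hi J - lo J <= (hi I - lo I) / 2.
Proof.
move=> /kids_ratio h; apply: (le_trans h); rewrite mulrC.
by rewrite ler_wpM2l // ltW // len_gt0.
Qed.

Let kap := (M ^+ (2 * N) * D)^-1.

Let M_ge1 : 1 <= M. Proof. exact: lift_gmax_ge1 L m_gt1. Qed.

Lemma kap01 : 0 < kap <= 1.
Proof.
have M0 : 0 < M by exact: lt_le_trans M_ge1.
have D0 : 0 < D by exact: lt_le_trans D_ge1.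
rewrite /kap invr_gt0 mulr_gt0 ?exprn_gt0 //= invf_le1 ?mulr_gt0 ?exprn_gt0 //.
by rewrite -[leLHS]mul1r ler_pM // exprn_ege1.
Qed.

Lemma kids_kap I J : J \in kids I -> kap * (hi I - lo I) <= hi J - lo J.
Proof.
move=> /kidsP[k [kd _ ->]]; rewrite /lo /hi /= nuS.
have M0 : 0 < M by exact: lt_le_trans M_ge1.
have D0 : 0 < D by exact: lt_le_trans D_ge1.
have [h _] := child_len L m_gt1 Gp (nu I.1) I.2 kd.
rewrite /kap -ler_pdivlMl ?invr_gt0 ?mulr_gt0 ?exprn_gt0 // invrK -mulrA.
rewrite -ler_pdivrMl ?exprn_gt0 //; apply: le_trans h.
rewrite ler_wpM2r ?(ltW (len_gt0 I)) //.
have /andP[_ h] := cyl_len_bounds L m_gt1 p (Len I.1) k.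
have e : M ^+ (2 * N) = M ^+ Len I.1 * M ^+ (2 * N - Len I.1).
  by rewrite -exprD subnKC.
rewrite -[_^-1]mulr1 ler_pdivrMl ?exprn_gt0 // (le_trans h) //.
rewrite ler_wpM2r ?(ltW (cyl_len_gt0 _ _ _ _ _)) //.
by rewrite e ler_peMr ?exprn_ge0 ?(ltW M0) // exprn_ege1.
Qed.

Lemma kids_disj I (phi : R -> R) : (forall x y, x <= y -> phi x <= phi y) ->
  \sum_(J <- kids I) (phi (hi J) - phi (lo J)) <= phi (hi I) - phi (lo I).
Proof.
move=> mono; rewrite kids_sum /lo /hi /= nuS.
rewrite -(child_telescope L m_gt1 Gp (nu I.1) (Len I.1)) big_mkcond.
apply: ler_sum => k _; case: ifP => // _; rewrite subr_ge0 mono //.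
have := cyl_len_gt0 L m_gt1 p (nu I.1 + Len I.1) (child d (Len I.1) I.2 k).
by rewrite /cyl_len subr_gt0 => /ltW.
Qed.

(** On [I] the block sum is a sum of first iterates, with shifted coefficients, evaluated at
    [iter (nu I.1) G x]. The proportion known on the whole circle for the fixed direction
    [dir (rem I)] thus applies to the children of [I]. *)
Lemma good_mass I : p0 <= \sum_(k < d ^ Len I.1 | good I k) cyl_len L m_gt1 p (Len I.1) k.
Proof.
set n := Len I.1; pose u := dir (rem I).
have u1 : normc u = 1 by have [] := dirP (rem I).
pose P z := c0 * Num.sqrt (\sum_(l < n) normc (a (nu I.1 + l)) ^+ 2) <=
  Re (u * \sum_(l < n) a (nu I.1 + l)%N * iter l f z).
have S2 : \sum_(l < n) normc (a (nu I.1 + l)) ^+ 2 =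
    \sum_(nu I.1 <= k < nu I.1.+1) al k ^+ 2.
  rewrite -{2}[nu I.1]add0n big_addn big_mkord.
  by apply: eq_bigr => l _; rewrite addnC.
have fix0 : q n 0 = p.
  apply: (@iter_lift_inj _ _ _ _ _ _ _ _ L m_gt1 n); rewrite cylE.
  by have := iter_lift_fix L Gp n 0; rewrite mulr0 addr0.
have kS (k : nat) : k%:Z + 1 = k.+1%:Z by rewrite -[k.+1]addn1 PoszD.
have := @partition_gain R p (pz_proba b) (d ^ n) (fun k => q n k) P
  (pz_proba_gt0 b_lt1) fix0.
rewrite -/p0 => H; apply: le_trans (H _ _ _) _.
- have := cyl_shift L m_gt1 p n 1 0; rewrite mulr1 addr0 => ->.
  by rewrite fix0.
- by move=> k; rewrite -kS; apply: (cyl_le L m_gt1); rewrite lerDl.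
- exact: (block_gain_avg p F_holo fE f_circle b_lt1 (fun l => a (nu I.1 + l)%N) n u1).
rewrite [leLHS]big_mkcond [leRHS]big_mkcond; apply: ler_sum => k _.
case: (boolP `[< _ >]) => [/asboolP[y yk Py]|_]; last first.
  by case: ifP => // _; exact: ltW (cyl_len_gt0 _ _ _ _ _).
rewrite ifT; first by rewrite /cyl_len kS.
(* The point [y] of the model interval [[p, p + 1]] is translated by the index of [I] and pulled
   back into [I]. *)
have [x xy] := iter_lift_surj L m_gt1 (nu I.1) (y + I.2%:~R).
apply/asboolP; exists x.
  move: yk => /andP[y1 y2]; rewrite nuS -/n childS; apply/andP.
  by split; rewrite -(iter_lift_le L m_gt1 (nu I.1)) xy child_image lerD2r.
rewrite /gain /size2 -S2; move: Py; rewrite /P -/u.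
suff -> : bsum I.1 x = \sum_(l < n) a (nu I.1 + l)%N * iter l f (cis y) by [].
rewrite /bsum -{1}[nu I.1]add0n big_addn big_mkord; apply: eq_bigr => l _.
rewrite addnC; congr (_ * _); rewrite addnC iterD (iter_lift_cis L (nu I.1)) xy.
by rewrite cis2piD cis2pi_int mulr1.
Qed.

Lemma kids_pow I : (hi I - lo I) `^ s <= \sum_(J <- kids I) (hi J - lo J) `^ s.
Proof.
have D0 : 0 < D by exact: lt_le_trans D_ge1.
have /andP[l0 _] := lam01.
rewrite kids_sum; apply: (@select_pow R _ _ (fun k : 'I__ => cyl_len L m_gt1 p (Len I.1) k)
  _ _ D (D * lam ^+ N) p0) => //.
- by rewrite mulr_gt0 ?exprn_gt0.
- move=> k _; rewrite /lo /hi /= nuS.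
  by have [h _] := child_len L m_gt1 Gp (nu I.1) I.2 (ltn_ord k).
- move=> k gk; rewrite len_gt0 /=; apply: kids_ratio.
  by apply: map_f; rewrite mem_filter gk mem_iota add0n /=.
- exact: good_mass.
Qed.

Let root : nat * int := (0%N, 0).

Lemma root_len : hi root - lo root <= 2^-1.
Proof.
apply: le_trans root_small; rewrite /lo /hi /=.
by have [-> _ _ _] := nu_block; exact: cyl_len_upper.
Qed.

Section Branch.
Variables (J : nat -> nat * int) (x : R).
Hypothesis J0 : J 0%N = root.
Hypothesis JS : forall k, J k.+1 \in kids (J k).
Hypothesis Jx : forall k, lo (J k) <= x <= hi (J k).

Lemma branch_stage k : (J k).1 = k.
Proof.
elim: k => [|k IH]; first by rewrite J0.
by have [l [_ _ ->]] := kidsP (JS k); rewrite /= IH.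
Qed.

Let r k := normc (rem (J k)).

Lemma same_cyl I y z : lo I <= y <= hi I -> lo I <= z <= hi I ->
  `|iter (nu I.1) G y - iter (nu I.1) G z| <= 1.
Proof.
have le u v : u <= v -> iter (nu I.1) G u <= iter (nu I.1) G v.
  by rewrite (iter_lift_le L m_gt1).
move=> /andP[/le h1 /le h2] /andP[/le h3 /le h4]; move: h1 h2 h3 h4.
by rewrite !cylE intrD ler_norml; lra.
Qed.

Lemma lo_in I : lo I <= lo I <= hi I.
Proof. by rewrite lexx -subr_ge0 (ltW (len_gt0 I)). Qed.

(** The base point moves twice: from the left endpoint of [J k] to [y] at order [nu k], and from [y]
    to the left endpoint of [J k.+1] at order [nu k.+1]. Each move costs one oscillation. *)
Lemma branch_step k : exists y,
  r k.+1 <= normc (rem (J k) - bsum k y) + K * (err al lam (nu k) + err al lam (nu k.+1)) /\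
  gain (J k) y.
Proof.
have [l [ld /asboolP[y yk gy] JE]] := kidsP (JS k).
have Jk := branch_stage k.
exists y; split=> //; rewrite /r /rem branch_stage Jk.
have y1 : lo (J k.+1) <= y <= hi (J k.+1) by rewrite JE /lo /hi /=.
have [s1 s2] := kids_sub (JS k).
have y0 : lo (J k) <= y <= hi (J k) by move: y1 => /andP[? ?]; lra.
have h1 := psum_dist (same_cyl y1 (lo_in (J k.+1))).
have h0 := psum_dist (same_cyl (lo_in (J k)) y0).
rewrite branch_stage /lo branch_stage in h1; rewrite Jk /lo Jk in h0.
rewrite psumS in h1.
set A := psum _ (q _ _) in h1 *; set B := psum (nu k) (q _ _) in h0 *.
set Y := psum (nu k) y in h0 h1; set Z := bsum k y in h1 *.
have -> : w - A = (w - B - Z) + ((B - Y) + (Y + Z - A)) by ring.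
apply: (le_trans (normcD _ _)); rewrite lerD2l mulrDr.
by apply: (le_trans (normcD _ _)); exact: lerD.
Qed.

(** Above the threshold [Q * size2], the first summand gives [|bsum|^2 <= c0 * size2 * r], and the
    second ensures [c0 / 2 * size2 <= r]. *)
Let Q := 2 * N%:R / c0 + c0.

(** Writing [A] for [size2], the law of cosines gives [|rem - bsum|^2 <= r^2 - 2 c0 A r + c0 A r <=
    (r - c0 A / 2)^2] when [r] is above the threshold. Half of the gain is spent on the square of
    the block sum, hence the rate [c0 / 2]. *)
Lemma branch_rem_null : null_seq r.
Proof.
have c00 := c0_gt0.
apply: (@steering R al lam n0 N lam01 al_ge0 al_null al_sum N_gt0 nu nu_block r K (c0 / 2) Q) => //.
- by rewrite divr_gt0.
- by rewrite /Q addr_ge0 ?(ltW c00) // divr_ge0 ?(ltW c00) // mulr_ge0 ?ler0n.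
- by move=> k; exact: normc_ge0.
- move=> k; have [y [h _]] := branch_step k; apply: (le_trans h).
  rewrite lerD2r (le_trans (normcB _ _)) // lerD2l.
  exact: sum_le_mass.
move=> k QA; have [y [h gy]] := branch_step k; apply: (le_trans h).
rewrite lerD2r; move: gy; rewrite /gain branch_stage => gy.
have N0 : 0 < N%:R :> R by rewrite ltr0n.
set A := size2 al nu k in QA gy *; have A0 : 0 <= A := size2_ge0 al nu k.
have rk0 : 0 <= r k := normc_ge0 _.
have B2 : normc (bsum k y) ^+ 2 <= 2 * N%:R * A ^+ 2.
  have h1 : normc (bsum k y) <= Num.sqrt (2 * N%:R) * A.
    apply: (le_trans (sum_le_mass _ _ _)).
    exact: (mass_le_size2 lam01 al_ge0 N_gt0 nu_block k).
  rewrite -[2 * N%:R]sqr_sqrtr ?mulr_ge0 ?ler0n // -exprMn.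
  by rewrite ler_pXn2r ?nnegrE ?normc_ge0 // mulr_ge0 ?sqrtr_ge0.
have h2 : 2 * N%:R * A ^+ 2 <= c0 * A * r k.
  have : c0 * A * (2 * N%:R / c0 * A) <= c0 * A * r k.
    apply: ler_wpM2l; first by apply: mulr_ge0 => //; exact: ltW.
    apply: le_trans QA.
    by rewrite [leRHS]mulrDl lerDl; apply: mulr_ge0 => //; exact: ltW.
  move=> h2; apply: le_trans h2.
  by rewrite le_eqVlt; apply/orP; left; apply/eqP; field; rewrite gt_eqF.
have h3 : c0 / 2 * A <= r k.
  apply: le_trans QA; rewrite ler_wpM2r // /Q.
  have : 0 <= 2 * N%:R / c0.
    by apply: divr_ge0; [rewrite mulr_ge0 ?ler0n|exact: ltW].
  by move: (2 * N%:R / c0) => t; lra.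
rewrite -(@ler_pXn2r _ 2) ?nnegrE ?normc_ge0 ?subr_ge0 // normc_sub_sqr.
have h4 : r k * (c0 * A) <= r k * Re (dir (rem (J k)) * bsum k y) by rewrite ler_wpM2l.
have h5 := sqr_ge0 (c0 / 2 * A).
rewrite -/(r k); lra.
Qed.

(** For [n] inside block [j], the distance to [w] is at most the remainder at stage [j], plus the
    oscillation on [J j], plus the mass of the block; all three tend to zero. *)
Lemma branch_psum e : 0 < e -> exists n1, forall n, (n1 <= n)%N -> normc (w - psum n x) <= e.
Proof.
move=> e0; have e3 : 0 < e / 3 by lra.
have [j1 H1] := branch_rem_null e3.
have [j2 H2] := null_seqZ (ltW K_gt0) (err_nu_null lam01 al_ge0 al_null N_gt0 nu_block) e3.
have [j3 H3] := mass_null lam01 al_null N_gt0 nu_block e3.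
pose j0 := maxn j1 (maxn j2 j3); exists (nu j0) => n nn.
have [j jj jn] : exists2 j, (j0 <= j)%N & (nu j <= n < nu j.+1)%N.
  have [i ni] : exists i, (n < nu (j0 + i))%N.
    exists n.+1; apply: leq_trans (nu_ge lam01 N_gt0 nu_block _); exact: leq_addl.
  elim: i ni => [|i IH]; first by rewrite addn0 ltnNge nn.
  rewrite addnS => ni; have [h|h] := ltnP n (nu (j0 + i)%N); first exact: IH.
  by exists (j0 + i)%N; rewrite ?leq_addr ?h.
move: jj; rewrite !geq_max => /andP[/H1 h1 /andP[/H2 h2 /H3 h3]].
have -> : w - psum n x = rem (J j) + (psum (nu j) (lo (J j)) - psum (nu j) x)
    - \sum_(nu j <= k < n) a k * iter k f (cis x).
  rewrite /rem branch_stage /lo branch_stage.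
  have -> : psum n x = psum (nu j) x + \sum_(nu j <= k < n) a k * iter k f (cis x).
    rewrite /psum -(big_mkord xpredT (fun k => a k * iter k f (cis x))).
    rewrite -(big_mkord xpredT (fun k => a k * iter k f (cis x))).
    by rewrite -big_cat_nat //; case/andP: jn.
  by ring.
have h4 := psum_dist (same_cyl (lo_in (J j)) (Jx j)); rewrite branch_stage in h4.
have h5 : normc (\sum_(nu j <= k < n) a k * iter k f (cis x)) <= mass al nu j.
  apply: (le_trans (sum_le_mass _ _ _)); rewrite /mass.
  have /andP[jn1 jn2] := jn.
  by rewrite (big_cat_nat jn1 (ltnW jn2)) /= lerDl sumr_ge0.
apply: (le_trans (normcB _ _)); have := normcD (rem (J j)) (psum (nu j) (lo (J j)) - psum (nu j) x).
rewrite /r in h1; lra.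
Qed.
End Branch.

Lemma level_set_hausdorff (E : set R[i]) :
  (forall x, (forall e, 0 < e -> exists n1, forall n, (n1 <= n)%N ->
     normc (w - psum n x) <= e) -> E (cis x)) -> (0 < hausdorff_measure s E)%E.
Proof.
move=> HE; apply: (tree_hausdorff s01 kap01 len_gt0 kids_sub kids_half kids_kap kids_disj
  kids_pow root_len) => J x J0 JS Jx.
by apply: HE => e e0; exact: branch_psum J0 JS Jx _ e0.
Qed.
End Assembly.

(** * Choice of the constants and conclusion *)

Lemma normc_null_seq (R : realType) (a : nat -> R[i]) :
  ((a n : R[i]^o) @[n --> \oo] --> (0 : R[i]^o)) -> null_seq (fun n => Normc.normc (a n)).
Proof.
move=> /cvgr0_norm_lt a0 e e0.
have e0' : 0 < e%:C%C :> R[i] by rewrite ltcR.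
have [n0 _ Hn] := a0 _ e0'.
exists n0 => n nn; have := Hn n nn; rewrite normcE ltcR; exact: ltW.
Qed.

Lemma unbounded_sums_eseries (R : realType) (u : nat -> R) : (forall n, 0 <= u n) ->
  (\sum_(1 <= n <oo) (u n)%:E)%E = +oo%E -> unbounded_sums u.
Proof.
move=> u0 uoo B; apply: contrapT => /forallNP H.
have : (\sum_(1 <= n <oo) (u n)%:E <= B%:E)%E.
  apply: lime_le.
    by apply: is_cvg_nneseries => n _ _; rewrite lee_fin.
  apply: nearW => n; rewrite sumEFin lee_fin.
  have /negP := H n; rewrite -ltNge => /ltW; apply: le_trans.
  rewrite -(big_mkord xpredT u); case: n => [|n]; first by rewrite big_geq // big_geq.
  by rewrite [leRHS]big_ltn // lerDr.
by rewrite uoo leye_eq.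
Qed.

Unset Implicit Arguments.

Theorem theorem1 (R : realType) (f : R[i] -> R[i]) (a : nat -> R[i])
  (f_blaschke : finite_blaschke0 f)
  (f_not_rotation : ~ is_rotation f)
  (a_to0 : (a n : R[i]^o) @[n --> \oo] --> (0 : R[i]^o))
  (a_diverges : (\sum_(1 <= n <oo) (Normc.normc (a n))%:E)%E = +oo%E)
  (w : R[i]) :
  hausdorff_dim (series_level_set f a w) = 1%E.
Proof.
have [G [g [d [m [M [C [L m1]]]]]]] := blaschke_lift f_blaschke f_not_rotation.
have [F [b [F_holo fE b1]]] := blaschke_holo f_blaschke f_not_rotation.
have [p Gp] := lift_fixpoint L m1.
apply: hausdorff_dim_eq1 => [xi []//|s s01].
(* The series starts at index 1 while [psum] starts at 0, so the coefficient of index 0 is set to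
   zero. *)
pose a' n : R[i] := if n is 0%N then 0 else a n.
pose al n := Normc.normc (a' n).
have al_null : null_seq al.
  move=> e e0; have [n0 Hn] := normc_null_seq a_to0 e0.
  exists n0.+1 => -[|n] // nn; exact: Hn (ltnW nn).
have al_sum : unbounded_sums al.
  apply: unbounded_sums_eseries => [n|]; first exact: normc_ge0.
  rewrite -a_diverges; congr (limn _); apply/funext => n.
  by apply: eq_big_nat => -[|i].
pose lam : R := m^-1; pose K : R := 4 * pi; pose D := distortion m C.
have lam01 : 0 < lam < 1.
  by rewrite /lam invr_gt0 invf_lt1 ?(lt_trans ltr01).
have D0 : 0 < D by exact: lt_le_trans (distortion_ge1 L m1).
have K0 : 0 < K by rewrite mulr_gt0 // pi_gt0.
have lv0 := pz_level_gt0 b1; have pr0 := pz_proba_gt0 b1.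
have /andP[s0 s1] := s01; have s10 : 0 < 1 - s by rewrite subr_gt0.
have /andP[l0 l1] := lam01.
pose Lam := lam / (1 - lam); have Lam0 : 0 < Lam by rewrite divr_gt0 // subr_gt0.
pose gn := pz_level b / 2 / 2 / 4; have gn0 : 0 < gn.
  by rewrite /gn; do 3 ?[apply: divr_gt0 => //].
(* Bound for [sqrt (2 N) / N]: errors are both at most [K], to be absorbed by the potential, and at
   most a quarter of the gain rate. *)
pose z := Num.min K gn / (3 * K * Lam).
have KL0 : 0 < 3 * K * Lam by apply: mulr_gt0 => //; apply: mulr_gt0.
have z0 : 0 < z by apply: divr_gt0 => //; rewrite lt_min K0 gn0.
pose pD := pz_proba b / 2 / D; have pD0 : 0 < pD.
  by rewrite /pD; do 2 ?[apply: divr_gt0 => //].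
(* Bound for [lam ^ N], giving both the halving of lengths and the s-weight condition. *)
pose y := Num.min 2^-1 (pD `^ (1 - s)^-1) / D.
have y0 : 0 < y.
  by apply: divr_gt0 => //; rewrite lt_min powR_gt0 // andbT invr_gt0.
have [N [N0 Nz Ny]] := block_length_exists lam01 z0 y0.
have [n0 Hn0] := @expr_small R lam 2^-1 ltac:(by rewrite invr_gt0) ltac:(by rewrite (ltW l0)).
have al0 n : 0 <= al n by exact: normc_ge0.
have [nu nuB] := @block_exists R al lam n0 N lam01 al0 N0.
have DN : D * lam ^+ N <= Num.min 2^-1 (pD `^ (1 - s)^-1).
  by rewrite mulrC -ler_pdivlMr.
have NK : 3 * K * (Lam * Num.sqrt (2 * N%:R) / N%:R) <= Num.min K gn.
  rewrite -[Lam * _ / _]mulrA [3 * K * _]mulrA -ler_pdivlMl //.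
  by rewrite [leRHS]mulrC.
move: DN NK; rewrite !le_min => /andP[DN1 DN2] /andP[NK1 NK2].
have DNp : (D * lam ^+ N) `^ (1 - s) <= pD.
  have -> : pD = (pD `^ (1 - s)^-1) `^ (1 - s).
    by rewrite -powRrM mulVf ?powRr1 ?(ltW pD0) // gt_eqF.
  apply: ge0_ler_powR => //; first exact: ltW.
    by rewrite nnegrE mulr_ge0 ?exprn_ge0 ?(ltW l0) // ltW.
  by rewrite nnegrE powR_ge0.
apply: (level_set_hausdorff L m1 Gp F_holo fE b1 s01 al_null al_sum N0 nuB (ltW Hn0)
  DN1 DNp NK1 NK2 (w := w)) => x Hx.
split; first by rewrite /unit_circle /= normcE normc_cis2pi.
apply/cvgrPdist_le => e e0.
have [r rE] : exists r, e = r%:C%C by apply/complex_realP; exact: gtr0_real.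
have r0 : 0 < r by move: e0; rewrite rE ltcR.
have [n1 Hn1] := Hx r r0; exists n1 => // n /= nn.
(* The partial sum over [1 <= k < n.+1] is [psum] of order [n.+1], whose term of index 0
   vanishes. *)
rewrite rE normcE lecR; apply: le_trans (Hn1 n.+1 (leqW nn)).
rewrite /psum big_ord_recl /= mul0r add0r big_add1 big_mkord.
exact: lexx.
Qed.
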